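(* Let $\mathcal G$ be a connected compact metric graph, let $\mathcal V^D\subseteq\mathcal V$ be a nonempty set of degree-one vertices, let $1<p<\infty$ and $q=p/(p-1)$. Then $$\lambda_{1,p}(\mathcal G,\mathcal V^D)\,T_p(\mathcal G,\mathcal V^D)^{\frac{p}{2p-1}}\ge C_p^{\mathrm{KJ}},$$ where, with $J=[0,1]$ (the unit interval regarded as a metric graph with vertices $0,1$) and Dirichlet set $\{1\}$, $$C_p^{\mathrm{KJ}}:=\lambda_{1,p}(J,\{1\})\,T_p(J,\{1\})^{\frac{p}{2p-1}}=(p-1)\Bigl(\frac{\pi_p}{2}\Bigr)^p\Bigl(\frac1{q+1}\Bigr)^{\frac{p(p-1)}{2p-1}},\qquad \pi_p=\frac{2\pi}{p\sin(\pi/p)}.$$ Equality holds if and only if $\mathcal G$ is an interval with a single Dirichlet endpoint.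
   Context: A compact metric graph $\mathcal G$ is obtained from a finite combinatorial graph with vertex set $\mathcal V$ and finite edge set $\mathcal E$ by identifying the endpoints of compact intervals $[0,\ell_e]$, $\ell_e>0$, $e\in\mathcal E$, according to the graph structure; $|\mathcal G|=\sum_{e}\ell_e$. $\mathcal E_v$ is the set of edges incident with $v$ (a loop at $v$ counted twice, once for each endpoint) and $\deg(v)=|\mathcal E_v|$. Set $\mathcal V^N=\mathcal V\setminus\mathcal V^D$. $u_e$ denotes the restriction of $u$ to $e$. $W^{1,p}(\mathcal G)$ is the space of $u:\mathcal G\to\mathbb R$ with $u|_e\in W^{1,p}(0,\ell_e)$ for all $e\in\mathcal E$ and $u$ continuous at every vertex; $W^{1,p}_{\mathcal V^D}(\mathcal G)=\{u\in W^{1,p}(\mathcal G): u(v)=0\ \forall v\in\mathcal V^D\}$. Integrals over $\mathcal G$ are sums of integrals over edges. The $p$-torsion function $w_p$ is the unique function in $W^{1,p}_{\mathcal V^D}(\mathcal G)$ with $-(|w_{p,e}'|^{p-2}w_{p,e}')'=1$ on each edge $e$, $w_p(v)=0$ for $v\in\mathcal V^D$, and $\sum_{e\in\mathcal E_v}|w_{p,e}'(v)|^{p-2}\partial_{\nu_e}w_{p,e}(v)=0$ for $v\in\mathcal V^N$, where $\partial_{\nu_e}$ is the derivative at $v$ in the outward direction along $e$ (pointing from $v$ into $e$). Equivalently, $\int_{\mathcal G}|w_p'|^{p-2}w_p'\phi'\,dx=\int_{\mathcal G}\phi\,dx$ for all $\phi\in W^{1,p}_{\mathcal V^D}(\mathcal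 G)$. The $p$-torsional rigidity is $T_p(\mathcal G,\mathcal V^D)=\bigl(\int_{\mathcal G}w_p\,dx\bigr)^{p-1}$. The first eigenvalue of the Dirichlet--Kirchhoff $p$-Laplacian is $$\lambda_{1,p}(\mathcal G,\mathcal V^D)=\inf_{u\in W^{1,p}_{\mathcal V^D}(\mathcal G),\,u\ne0}\frac{\int_{\mathcal G}|u'|^p\,dx}{\int_{\mathcal G}|u|^p\,dx}.$$ ''$\mathcal G$ is an interval with a single Dirichlet endpoint'' means: up to subdivision by vertices of degree two, $\mathcal G$ is the metric graph $[0,L]$ with $L=|\mathcal G|$, and $\mathcal V^D$ consists of exactly one of its two endpoints. *)

(* Defs.v *)
From mathcomp Require Import all_boot all_order all_algebra.
From mathcomp Require Import all_classical all_reals all_analysis.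
Import Order.TTheory GRing.Theory Num.Theory.
Import numFieldNormedType.Exports.

Set Implicit Arguments.
Unset Strict Implicit.
Unset Printing Implicit Defensive.

Local Open Scope classical_set_scope.
Local Open Scope ring_scope.

(** * Compact metric graphs *)

(* The edge [e] is the interval [0, len e] with 0 glued to [src e] and [len e]
   glued to [tgt e].  The orientation is only a choice of coordinate; loops and
   multiple edges are allowed. *)
Record metric_graph (R : realType) := MetricGraph {
  vertex : finType;
  edge : finType;
  src : edge -> vertex;
  tgt : edge -> vertex;
  len : edge -> R;
  len_gt0 : forall e, 0 < len e }.

(* A loop contributes to both terms. *)
Definition deg (R : realType) (G : metric_graph R) (v : vertex G) : nat :=
  (#|[pred e : edge G | src e == v]| + #|[pred e : edge G | tgt e == v]|)%N.

Definition joins (R : realType) (G : metric_graph R) (e : edge G)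
    (x y : vertex G) : bool :=
  ((src e == x) && (tgt e == y)) || ((src e == y) && (tgt e == x)).

Definition connected_graph (R : realType) (G : metric_graph R) : Prop :=
  forall x y : vertex G,
    connect (fun x y : vertex G => [exists e : edge G, joins e x y]) x y.

(** * Sobolev functions *)

Section sobolev_interval.
Variable R : realType.
Local Notation mu := (@lebesgue_measure R).

Definition in_Lp (p l : R) (f : R -> R) : Prop :=
  measurable_fun `]0, l[ f /\
  mu.-integrable `]0, l[ (fun x => (`|f x| `^ p)%:E).

(* C^1 functions with compact support in ]0, l[. *)
Definition test_function (l : R) (phi : R -> R) : Prop :=
  [/\ forall x, derivable phi x 1,
      continuous (derive1 phi) &
      exists a b : R, [/\ 0 < a, b < l &
        forall x, x \notin `[a, b] -> phi x = 0]].

Definition weak_derivative (l : R) (f g : R -> R) : Prop :=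
  forall phi, test_function l phi ->
    \int[mu]_(x in `]0, l[) (f x * derive1 phi x) =
      - \int[mu]_(x in `]0, l[) (g x * phi x).

(* [f] belongs to W^{1,p}(0, l), with weak derivative [g]; [f] is the
   representative which is continuous up to the endpoints. *)
Definition W1p_interval (p l : R) (f g : R -> R) : Prop :=
  [/\ {within `[0, l], continuous f}, in_Lp p l f, in_Lp p l g &
      weak_derivative l f g].

(* Classical derivative of the restriction of [f] to [0, l], hence one-sided
   at 0 and at [l]. *)
Definition classical_derivative (l : R) (f g : R -> R) : Prop :=
  forall x, x \in `[0, l] ->
    (f y - f x) / (y - x) @[y --> within `[0, l] x^'] --> g x.

End sobolev_interval.

(* A function on G is given by its restrictions to the edges; only the values
   [u e x] with 0 <= x <= len e are meaningful. *)
Definition graph_fun (R : realType) (G : metric_graph R) := edge G -> R -> R.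

Section metric_graph_theory.
Variables (R : realType) (G : metric_graph R).
Implicit Types (u du w dw : graph_fun G) (VD : {set vertex G}) (p : R).
Local Notation mu := (@lebesgue_measure R).

Definition graph_integral u : R :=
  \sum_(e : edge G) \int[mu]_(x in `[0, len e]) u e x.

(* [u] belongs to W^{1,p}_{VD}(G), with edgewise weak derivative [du]; [uv]
   collects the values of [u] at the vertices. *)
Definition W1p_D p VD u du : Prop :=
  (forall e, W1p_interval p (len e) (u e) (du e)) /\
  exists uv : vertex G -> R,
    [/\ forall e, u e 0 = uv (src e),
        forall e, u e (len e) = uv (tgt e) &
        forall v, v \in VD -> uv v = 0].

Definition nonzero_fun u : Prop :=
  exists e x, x \in `[0, len e] /\ u e x != 0.

Definition lambda1 p VD : R :=
  inf [set r : R | exists u du,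
    [/\ W1p_D p VD u du, nonzero_fun u &
        r = graph_integral (fun e x => `|du e x| `^ p) /
            graph_integral (fun e x => `|u e x| `^ p)]].

(* |s|^(p-2) s; since p > 1, its value at s = 0 is 0. *)
Definition flux p (s : R) : R := `|s| `^ (p - 2) * s.

(* The derivative pointing from the vertex into the edge is [dw e 0] at the
   source and [- dw e (len e)] at the target. *)
Definition kirchhoff p dw (v : vertex G) : Prop :=
  \sum_(e : edge G | src e == v) flux p (dw e 0) +
  \sum_(e : edge G | tgt e == v) flux p (- dw e (len e)) = 0.

Definition is_torsion p VD w : Prop :=
  exists dw,
    [/\ W1p_D p VD w dw,
        forall e, classical_derivative (len e) (w e) (dw e),
        forall e, classical_derivative (len e)
          (fun x => flux p (dw e x)) (fun=> -1) &
        forall v, v \notin VD -> kirchhoff p dw v].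

(* The torsion function is determined only on the edges, but the values
   outside [0, len e] do not enter the rigidity below. *)
Definition torsion p VD : graph_fun G :=
  xget (fun _ _ => 0) [set w : edge G -> R -> R | is_torsion p VD w].

Definition rigidity p VD : R :=
  graph_integral (torsion p VD) `^ (p - 1).

(* G is a path v_0, ..., v_(n+1), i.e. an interval subdivided by n vertices of
   degree two, and VD is one of its two ends. *)
Definition interval_one_dirichlet VD : Prop :=
  exists (n : nat) (v : 'I_n.+2 -> vertex G) (e : 'I_n.+1 -> edge G),
    [/\ bijective v, bijective e,
        forall i : 'I_n.+1,
          joins (e i) (v (widen_ord (leqnSn n.+1) i)) (v (lift ord0 i)) &
        VD = [set v ord0]%SET \/ VD = [set v ord_max]%SET].

End metric_graph_theory.

(** * The reference interval *)

(* [0, 1] with vertices [false] (at 0) and [true] (at 1). *)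
Definition unit_interval (R : realType) : metric_graph R :=
  @MetricGraph R bool unit (fun=> false) (fun=> true) (fun=> 1)
    (fun=> ltr01).

Definition C_KJ (R : realType) (p : R) : R :=
  let VD : {set vertex (unit_interval R)} := [set true]%SET in
  lambda1 p VD * rigidity p VD `^ (p / (2 * p - 1)).

Definition pi_p (R : realType) (p : R) : R := 2 * pi / (p * sin (pi / p)).

(* Main.v *)
(* The torsion function solves its equation by fluxes [c e - x] on the edges
   which balance at the Kirchhoff vertices, and the integral [W] of the torsion
   function is the q-energy of this flux.  Given a test function [u], made
   piecewise affine, balance on the superlevel set [{u > t}] bounds its measure
   by the flux through the level set, and Hoelder's inequality turns this into a
   decay estimate for the q-energy of the flux on [{u > t}].  Following
   Kohler-Jobin, [u] is compared level by level with the function on an interval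
   whose superlevel sets have the same torsion; the comparison is carried out
   with the Riccati substitution [A' = lam + (p - 1) A^q], [A(0) = 0], which
   blows up exactly at the length of the interval with first eigenvalue [lam].
   This yields [lambda_1 >= (p - 1) (pi_p / 2)^p ((q + 1) W)^(- p / (q + 1))].

   If the graph is not an interval with one Dirichlet end, two distinct thirds
   of edges cannot both meet level sets reduced to a single point; on one of
   them every level is attained at least twice, which improves the decay by an
   amount independent of [u], so the inequality is strict.  On an interval the
   flux is the distance to the free end and the function [(lam + (p - 1) A^q)^(-1/p)]
   attains equality. *)
Require Import Defs.
From mathcomp Require Import all_boot all_order all_algebra.
From mathcomp Require Import all_classical all_reals all_analysis.
From mathcomp Require Import measurable_realfun ring lra.
Import Order.TTheory GRing.Theory Num.Theory.
Import numFieldNormedType.Exports.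

Set Implicit Arguments.
Unset Strict Implicit.
Unset Printing Implicit Defensive.

Local Open Scope classical_set_scope.
Local Open Scope ring_scope.

(** * One-variable calculus *)

Section calculus.
Variable R : realType.
Implicit Types (f g h : R -> R) (a b x y z : R) (s : seq R).

(** The infimum defining [lambda1] is never shown to be attained, so strictness cannot be read off
    from the equality case of a minimiser; it has to come from a gap valid for all test functions at
    once. Piecewise affine functions with distinct adjacent node values have finitely many
    exceptional levels. Off these, all quantities depending on the level are differentiable, and
    monotonicity arguments take the place of the coarea formula and of absolute continuity. The
    torsion of a superlevel set is not computed: an antiderivative of the guaranteed decay rate of
    the dual energy stands for it. Its total may fall short of the torsion of the graph, but a
    shortfall only shortens the comparison interval. Of the eigenfunction V of that interval the
    lower bound needs only A = (|V'| / V)^(p-1), as a function of the distance to the free end; this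
    is the origin of the Riccati equation. *)

Lemma is_derive_ext f g x df : (\near x, f x = g x) ->
  is_derive x (1 : R) f df -> is_derive x (1 : R) g df.
Proof. exact: near_eq_is_derive. Qed.

Lemma is_derive1_continuous f x df :
  is_derive x (1 : R) f df -> {for x, continuous f}.
Proof. by move=> [fd _]; apply/differentiable_continuous/derivable1_diffP. Qed.

Lemma continuous_within f (A : set R) :
  (forall x, A x -> {for x, continuous f}) -> {within A, continuous f}.
Proof.
move=> cf; apply/subspace_continuousP => x Ax.
apply: cvg_trans (cf _ Ax); exact: cvg_within_filter.
Qed.

Lemma continuous_maxr f g x : {for x, continuous f} -> {for x, continuous g} ->
  {for x, continuous (fun t => Num.max (f t) (g t))}.
Proof. exact: continuous_max. Qed.

Lemma continuous_minr f g x : {for x, continuous f} -> {for x, continuous g} ->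
  {for x, continuous (fun t => Num.min (f t) (g t))}.
Proof. exact: continuous_min. Qed.

Lemma lipschitz_continuous f (B : R) :
  (forall x y, `|f x - f y| <= B * `|x - y|) -> continuous f.
Proof.
move=> fB x; apply/cvgrPdist_le => e e0.
have B0 : 0 < `|B| + 1 by rewrite ltr_wpDl.
near=> y; apply: le_trans (fB _ _) _.
apply: (@le_trans _ _ ((`|B| + 1) * `|x - y|)).
  by rewrite ler_wpM2r// (le_trans (ler_norm _))// lerDl.
rewrite mulrC -ler_pdivlMr//; near: y.
by apply: cvgr_dist_le; rewrite ?divr_gt0//; exact: cvg_id.
Unshelve. all: by end_near. Qed.

(** The functions of the level used below are differentiable only off a finite set [s]. Splitting
    the interval at one exceptional point at a time reduces the claim to the mean value theorem. *)
Lemma derive_ge0_le f s a b : a <= b -> {within `[a, b], continuous f} ->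
  (forall x, a < x < b -> x \notin s ->
     exists2 df, is_derive x (1 : R) f df & 0 <= df) ->
  f a <= f b.
Proof.
elim: s a b => [|c s IH] a b ab cf fd.
  have H x : x \in `]a, b[ -> is_derive x (1 : R) f ('D_1 f x).
    by rewrite in_itv/= => /fd-/(_ isT)[df [fx <-] _].
  move: ab; rewrite le_eqVlt => /predU1P[->//|ab].
  have [c cab E] := MVT ab H cf.
  move: cab; rewrite in_itv/= => /fd-/(_ isT)[df [_ dE] d0].
  by rewrite -subr_ge0 E mulr_ge0 ?subr_ge0 ?(ltW ab)// dE.
have [/andP[ac cb]|cab] := boolP (a < c < b); last first.
  apply: IH => // x xab xs; apply: fd => //.
  by rewrite inE negb_or xs andbT; apply: contraNneq cab => <-.
apply: (@le_trans _ _ (f c)).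
  apply: IH (ltW ac) _ _.
    by apply: continuous_subspaceW cf; apply: subset_itvl; rewrite bnd_simp ltW.
  move=> x /andP[ax xc] xs; apply: fd; first by rewrite ax (lt_trans xc).
  by rewrite inE negb_or xs lt_eqF.
apply: IH (ltW cb) _ _.
  by apply: continuous_subspaceW cf; apply: subset_itvr; rewrite bnd_simp ltW.
move=> x /andP[cx xb] xs; apply: fd; first by rewrite xb (lt_trans ac).
by rewrite inE negb_or xs gt_eqF.
Qed.

Lemma derive_norm_le f g a b : a <= b ->
  {within `[a, b], continuous f} -> {within `[a, b], continuous g} ->
  (forall x, a < x < b -> exists df dg : R,
    [/\ is_derive x (1 : R) f df, is_derive x (1 : R) g dg & `|df| <= dg]) ->
  `|f b - f a| <= g b - g a.
Proof.
move=> ab cf cg H; rewrite ler_norml; apply/andP; split.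
  suff : f a + g a <= f b + g b by lra.
  apply: (@derive_ge0_le (fun x => f x + g x) [::]) => //.
    by move=> x; apply: cvgD; [exact: cf|exact: cg].
  move=> x /H[df [dg [dfx dgx]]]; rewrite ler_norml => /andP[h1 h2] _.
  eexists; first exact: (is_deriveD dfx dgx).
  by rewrite addrC -lerBlDr sub0r lerNl.
suff : g a - f a <= g b - f b by lra.
apply: (@derive_ge0_le (fun x => g x - f x) [::]) => //.
  by move=> x; apply: cvgB; [exact: cg|exact: cf].
move=> x /H[df [dg [dfx dgx]]]; rewrite ler_norml => /andP[h1 h2] _.
by eexists; [exact: (is_deriveB dgx dfx)|rewrite subr_ge0].
Qed.

End calculus.

(** * Antiderivatives of bounded functions with finitely many discontinuities *)

Section antiderivative.
Variable R : realType.
Implicit Types (f g h : R -> R) (a b x y z : R) (s : seq R).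
Local Notation mu := (@lebesgue_measure R).

Lemma cofinite_continuous_measurable h s :
  (forall x, x \notin s -> {for x, continuous h}) ->
  measurable_fun setT h.
Proof.
move=> hs; rewrite -(setvU [set` s]).
have scons c (r : seq R) : [set` c :: r] = [set c] `|` [set` r].
  by apply/seteqP; split => x /=; rewrite inE => /predU1P.
have ms (r : seq R) : measurable [set` r].
  apply: countable_measurable; first by move=> t; exact: measurable_set1.
  exact/finite_set_countable/finite_seq.
have cs : closed [set` s].
  elim: s {hs} => [|c s IH]; first by rewrite set_nil; exact: closed0.
  rewrite scons; apply: closedU IH.
  exact/accessible_closed_set1/hausdorff_accessible/Rhausdorff.
apply/measurable_funU; [exact: measurableC|exact: ms|split].
  apply: open_continuous_measurable_fun; first exact: closed_openC.
  by move=> x; rewrite inE => /negP /hs.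
elim: s {hs cs} => [|c s IH]; first by rewrite set_nil; exact: measurable_fun_set0.
rewrite scons; apply/measurable_funU; [exact: measurable_set1|exact: ms|split => //].
exact: measurable_fun_set1.
Qed.

Lemma bounded_integrable h (B a b : R) : measurable_fun setT h ->
  (forall x, `|h x| <= B) -> mu.-integrable `[a, b] (EFin \o h).
Proof.
move=> mh hB; apply: measurable_bounded_integrable => //.
- rewrite /= lebesgue_measure_itv/=; case: ifP => _; last exact: ltry.
  by rewrite -EFinD ltry.
- exact: measurable_funTS.
- exists B; split; first exact: num_real.
  by move=> M BM x _ /=; rewrite (le_trans (hB x))// ltW.
Qed.

(** [H] is the integral from 0, hence constant on the negative axis; this is why the derivative is
    claimed for [0 < x] only. The bound on [h] makes [H] Lipschitz, so it is continuous through the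
    exceptional points. *)
Lemma exists_antiderivative h (B : R) s :
  (forall x, `|h x| <= B) -> (forall x, x \notin s -> {for x, continuous h}) ->
  exists H : R -> R,
  [/\ H 0 = 0, continuous H,
      forall x, 0 < x -> x \notin s -> is_derive x (1 : R) H (h x) &
      (forall x, 0 <= h x) -> {homo H : x y / x <= y}].
Proof.
move=> hB hs; have mh := cofinite_continuous_measurable hs.
have ih a b := bounded_integrable a b mh hB.
pose H x := \int[mu]_(t in `[0, x]) h t.
have H0 x : x <= 0 -> H x = 0.
  rewrite le_eqVlt /H => /predU1P[->|x0]; first by rewrite set_itv1 Rintegral_set1.
  by rewrite set_itv_ge ?Rintegral_set0// bnd_simp -ltNge.
have HB x y : 0 <= x -> x <= y -> H y - H x = \int[mu]_(t in `]x, y]) h t.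
  by move=> x0 xy; apply: Rintegral_itvB; rewrite ?bnd_simp.
have io x y : mu.-integrable `]x, y] (EFin \o h).
  apply: (integrableS _ _ _ (ih x y)) => //; exact: subset_itv_oc_cc.
have lenoc x y : x <= y -> fine (mu `]x, y]) = y - x.
  rewrite /= lebesgue_measure_itv/= lte_fin; case: ltP => //= xy yx.
  by apply/esym/eqP; rewrite subr_eq0 eq_le xy yx.
have B0 : 0 <= B by exact: le_trans (hB 0).
have HLip x y : x <= y -> `|H x - H y| <= B * (y - x).
  move=> xy; have [y0|y0] := leP y 0.
    by rewrite !H0// ?(le_trans xy)// subrr normr0 mulr_ge0// subr_ge0.
  pose x' := Num.max 0 x.
  have -> : H x = H x' by rewrite /x'; case: (leP 0 x) => // /ltW /H0 ->; rewrite H0.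
  have x'0 : 0 <= x' by rewrite le_max lexx.
  have xx' : x <= x' by rewrite le_max lexx orbT.
  have x'y : x' <= y by rewrite ge_max xy ltW.
  rewrite distrC HB//; apply: (@le_trans _ _ (B * (y - x'))); last first.
    by rewrite ler_wpM2l// lerB.
  apply: le_trans (le_normr_Rintegral _ _) _ => //.
  rewrite -lenoc// -Rintegral_cst//; apply: le_Rintegral => //.
    exact: integrable_norm.
  have := @bounded_integrable (cst B) `|B| x' y (@measurable_cst _ _ _ _ _ _) (fun=> lexx _).
  by apply: integrableS => //; exact: subset_itv_oc_cc.
exists H; split.
- exact: H0.
- apply: (@lipschitz_continuous _ _ B) => x y; have [xy|/ltW yx] := leP x y.
    by rewrite (distrC x) (ger0_norm (_ : 0 <= y - x)) ?subr_ge0// HLip.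
  by rewrite distrC (ger0_norm (_ : 0 <= x - y)) ?subr_ge0// HLip.
- move=> x x0 xs.
  have xx1 : x < x + 1 by rewrite ltrDl.
  have [dH <-] := continuous_FTC1_closed xx1 (ih _ _) x0 (hs x xs).
  by rewrite derive1E; exact: derivableP.
- move=> h0 x y xy; have [y0|y0] := leP y 0; first by rewrite !H0// (le_trans xy).
  have [x0|/ltW x0] := leP 0 x; last by rewrite H0// Rintegral_ge0.
  by rewrite -subr_ge0 HB// Rintegral_ge0.
Qed.

End antiderivative.

(** * Powers of absolute values and the flux map *)

Section powers.
Variable R : realType.
Implicit Types (a b p q x y z : R).

Lemma is_derive_const (k x : R) : is_derive x (1 : R) (fun _ : R => k) (0 : R).
Proof. exact: is_derive_cst. Qed.

(** The even extension of the power. Its antiderivative is odd, which makes energies independent of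
    the orientation of an edge. *)
Definition npow q z := `|z| `^ q.
(* The antiderivative of [npow q] vanishing at 0. *)
Definition npow_int q z := z * `|z| `^ q / (q + 1).

Lemma ler_powRl q x y : 0 <= q -> 0 <= x -> x <= y -> x `^ q <= y `^ q.
Proof. by move=> q0 x0 xy; rewrite ge0_ler_powR// nnegrE// (le_trans x0). Qed.

Lemma ltr_powRl q x y : 0 < q -> 0 <= x -> x < y -> x `^ q < y `^ q.
Proof. by move=> q0 x0 xy; rewrite gt0_ltr_powR// nnegrE// (le_trans x0)// ltW. Qed.

Lemma is_derive_powR_comp (f : R -> R) (q x df : R) : 0 < f x -> is_derive x (1 : R) f df ->
  is_derive x (1 : R) (fun y => f y `^ q) (q * f x `^ (q - 1) * df).
Proof. move=> fx0 fd; exact: (is_derive1_comp (is_derive1_powR q fx0) fd). Qed.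

Lemma continuous_npow q : 0 < q -> continuous (npow q).
Proof.
move=> q0 x; have [->|x0] := eqVneq x 0.
  rewrite /continuous_at /npow normr0 powR0 ?gt_eqF//.
  apply/cvgrPdist_lt => e e0; near=> y.
  rewrite sub0r normrN ger0_norm ?powR_ge0//.
  rewrite -[ltRHS](@powRr1 _ e) ?ltW// -(mulVf (lt0r_neq0 q0)) powRrM.
  rewrite ltr_powRl//; near: y.
  exists (e `^ q^-1); first by rewrite /= powR_gt0.
  by move=> y /=; rewrite sub0r normrN.
have h : is_derive (`|x|) (1 : R) (fun y => y `^ q) (q * `|x| `^ (q - 1)).
  by apply: is_derive1_powR; rewrite normr_gt0.
apply: (@continuous_comp _ _ _ (@Num.norm R R) (fun y => y `^ q)).
  exact: norm_continuous.
exact: is_derive1_continuous h.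
Unshelve. all: by end_near. Qed.

Lemma npowN q z : npow q (- z) = npow q z. Proof. by rewrite /npow normrN. Qed.
Lemma npow_intN q z : npow_int q (- z) = - npow_int q z.
Proof. by rewrite /npow_int normrN !mulNr. Qed.

Lemma is_derive_npow_int q z : 0 < q -> is_derive z (1 : R) (npow_int q) (npow q z).
Proof.
move=> q0; have q1 : q + 1 != 0 by rewrite gt_eqF// addr_gt0.
have pos y : 0 < y -> is_derive y (1 : R) (npow_int q) (npow q y).
  move=> y0; apply: (@is_derive_ext _ (fun x => (q + 1)^-1 * x `^ (q + 1))).
    near=> x; have x0 : 0 < x by near: x; exact: lt_nbhsr.
    rewrite /npow_int gtr0_norm// mulrC; congr (_ / _).
    by rewrite -(@mulr_powRB1 _ x (q + 1)) ?ltW ?addr_gt0// addrK.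
  have d := @is_derive1_powR _ (q + 1) y y0.
  apply: is_derive_eq.
  by rewrite /npow /= gtr0_norm// addrK /GRing.scale/= mulKf.
have [z0|z0|->] := ltgtP z 0; last 1 first.
- apply/is_derive1_caratheodory; exists (fun z => npow q z / (q + 1)).
  split; last by rewrite /npow normr0 powR0 ?gt_eqF// mul0r.
    by move=> x; rewrite /npow_int/npow mul0r mul0r !subr0 -mulrA mulrC.
  apply: cvgM; [exact: continuous_npow|exact: cvg_cst].
- rewrite -npowN.
  have Nz : 0 < - z by rewrite oppr_gt0.
  have := is_derive1_comp (pos _ Nz) (is_deriveNid z 1).
  move=> /is_deriveN; rewrite mulrN1 opprK; apply: is_derive_ext.
  by near=> x; rewrite /= fctE /= npow_intN opprK.
- exact: pos.
Unshelve. all: by end_near. Qed.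

Lemma flux_gt0 q z : 0 < z -> flux q z = z `^ (q - 1).
Proof.
move=> z0; rewrite /flux gtr0_norm// mulrC.
by rewrite -{1}(powRr1 (ltW z0)) -powRD ?(gt_eqF z0) ?implybT//; congr (_ `^ _); ring.
Qed.

Lemma fluxN q z : flux q (- z) = - flux q z.
Proof. by rewrite /flux normrN mulrN. Qed.

Lemma flux0 q : flux q (0 : R) = 0. Proof. by rewrite /flux mulr0. Qed.

Lemma normr_flux q z : 1 < q -> `|flux q z| = `|z| `^ (q - 1).
Proof.
move=> q1; have [->|z0] := eqVneq z 0.
  by rewrite flux0 normr0 powR0// gt_eqF// subr_gt0.
rewrite -flux_gt0 ?normr_gt0// /flux normrM normr_id.
by rewrite (ger0_norm (powR_ge0 _ _)).
Qed.

Lemma is_derive_npow q z : 1 < q -> is_derive z (1 : R) (npow q) (q * flux q z).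
Proof.
move=> q1; have q0 : 0 < q by exact: lt_trans q1.
have pos y : 0 < y -> is_derive y (1 : R) (npow q) (q * flux q y).
  move=> y0; apply: (@is_derive_ext _ (fun x => x `^ q)).
    near=> x; have x0 : 0 < x by near: x; exact: lt_nbhsr.
    by rewrite /npow gtr0_norm.
  by have d := @is_derive1_powR _ q y y0; apply: is_derive_eq; rewrite flux_gt0.
have [z0|z0|->] := ltgtP z 0; last 1 first.
- rewrite flux0 mulr0.
  apply/is_derive1_caratheodory; exists (flux q).
  split; rewrite ?flux0//.
    move=> x; rewrite /npow normr0 powR0 ?gt_eqF// !subr0.
    have [->|x0] := eqVneq x 0; first by rewrite normr0 powR0 ?gt_eqF// mulr0.
    rewrite /flux -mulrA -expr2 -real_normK ?num_real// -powR_mulrn//.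
    by rewrite -powRD ?normr_eq0 ?(negPf x0) ?implybT//; congr (_ `^ _); ring.
  suff h : flux q x @[x --> (0 : R)] --> (0 : R) by rewrite -{2}(flux0 q) in h.
  apply: norm_cvg0.
  under eq_fun do rewrite (normr_flux _ q1).
  have := @continuous_npow (q - 1) _ 0; rewrite subr_gt0 => /(_ q1).
  by rewrite /continuous_at {2}/npow normr0 powR0// gt_eqF// subr_gt0.
- rewrite -[z]opprK fluxN.
  have Nz : 0 < - z by rewrite oppr_gt0.
  have := is_derive1_comp (pos _ Nz) (is_deriveNid z 1).
  rewrite opprK mulrN1 mulrN; apply: is_derive_ext.
  by near=> x; rewrite /= npowN.
- exact: pos.
Unshelve. all: by end_near. Qed.

End powers.

(** * Conjugate exponents *)

Section conjugate.
Variables (R : realType) (p q : R).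
Hypotheses (p1 : 1 < p) (q1 : 1 < q) (pq : p + q = p * q).

Let p0 : 0 < p. Proof. exact: lt_trans p1. Qed.
Let q0 : 0 < q. Proof. exact: lt_trans q1. Qed.

Lemma conj_subr1M : (p - 1) * (q - 1) = 1.
Proof. by rewrite mulrBl mulrBr -pq; ring. Qed.

Lemma conj_subr1l : (p - 1) * q = p.
Proof. by rewrite mulrBl -pq; ring. Qed.

Lemma conj_inv : p^-1 + q^-1 = 1.
Proof.
apply: (mulfI (lt0r_neq0 (mulr_gt0 p0 q0))).
by rewrite mulr1 mulrDr mulrAC mulfV ?gt_eqF// mulfK ?gt_eqF// mul1r addrC.
Qed.

(** Young's inequality multiplied by [p]; the second coefficient is p / q = p - 1. *)
Lemma young a b : 0 <= a -> 0 <= b -> p * (a * b) <= a `^ p + (p - 1) * b `^ q.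
Proof.
move=> a0 b0; have := conjugate_powR a0 b0 p0 q0 conj_inv.
rewrite -(ler_pM2l p0) mulrDr => /le_trans; apply.
rewrite [p * _]mulrC divfK ?gt_eqF// lerD2l -{1}conj_subr1l -mulrA.
by rewrite [q * _]mulrC divfK// gt_eqF.
Qed.

(** (p - 1) (q - 1) = 1 makes the two flux maps mutually inverse, so a derivative can be recovered
    from its flux. *)
Lemma fluxK z : flux p (flux q z) = z.
Proof.
have pos y : 0 < y -> flux p (flux q y) = y.
  move=> y0; rewrite (flux_gt0 _ y0) flux_gt0 ?powR_gt0// -powRrM.
  by rewrite mulrC conj_subr1M powRr1// ltW.
have [z0|z0|->] := ltgtP z 0; [|exact: pos|by rewrite !flux0].
by apply: oppr_inj; rewrite -!fluxN pos// oppr_gt0.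
Qed.

End conjugate.

Section finite_sums.
Variables (R : realType) (S : finType).
Implicit Types (f g : S -> R -> R).

Lemma is_derive_bigsum f (x : R) (df : S -> R) :
  (forall s, is_derive x (1 : R) (f s) (df s)) ->
  is_derive x (1 : R) (fun t => \sum_s f s t) (\sum_s df s).
Proof.
move=> fd; elim: (index_enum S) => [|s r IH].
  rewrite big_nil (_ : (fun _ => _) = cst 0); first exact: is_derive_cst.
  by apply/funext => t; rewrite big_nil.
rewrite big_cons (_ : (fun _ => _) = f s + (fun t => \sum_(i <- r) f i t)).
  exact: is_deriveD.
by apply/funext => t; rewrite big_cons.
Qed.

Lemma continuous_bigsum (T : topologicalType) (h : S -> T -> R) (x : T) :
  (forall s, {for x, continuous (h s)}) ->
  {for x, continuous (fun t => \sum_s h s t)}.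
Proof.
move=> fc; elim: (index_enum S) => [|s r IH].
  rewrite (_ : (fun _ => _) = cst 0); first exact: cvg_cst.
  by apply/funext => t; rewrite big_nil.
rewrite (_ : (fun _ => _) = h s + (fun t => \sum_(i <- r) h i t)).
  exact: (cvgD (fc s) IH).
by apply/funext => t; rewrite big_cons.
Qed.

End finite_sums.

Section exceptional_points.
Variable R : realType.
Implicit Types (f : R -> R) (a b x : R) (s : seq R).

Lemma subinterval_avoiding s a b : a < b ->
  exists a' b', [/\ a <= a', a' < b', b' <= b &
    forall x, a' < x < b' -> x \notin s].
Proof.
elim: s a b => [|c s IH] a b ab; first by exists a, b.
have [a' [b' [aa' ab' bb' H]]] := IH a b ab.
have [bc|cb] := leP b' c.
  exists a', b'; split=> // x /andP[ax xb]; rewrite inE negb_or H ?ax// andbT.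
  by rewrite lt_eqF// (lt_le_trans xb).
exists (Num.max a' c), b'; split=> //.
- by rewrite le_max aa'.
- by rewrite gt_max ab'.
- move=> x /andP[]; rewrite gt_max => /andP[ax cx] xb.
  by rewrite inE negb_or gt_eqF//= H// ax.
Qed.

(** Some subinterval avoids the exceptional points and the increase is strict there; weak
    monotonicity suffices on the rest. *)
Lemma derive_gt0_lt f s a b : a < b -> {within `[a, b], continuous f} ->
  (forall x, a < x < b -> x \notin s ->
     exists2 df, is_derive x (1 : R) f df & 0 < df) ->
  f a < f b.
Proof.
move=> ab cf fd; have [a' [b' [aa' ab' bb' H]]] := subinterval_avoiding s ab.
have cW u v : a <= u -> v <= b -> {within `[u, v], continuous f}.
  move=> au vb; apply: continuous_subspaceW cf; apply: subset_itv; by rewrite bnd_simp.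
have mono u v : a <= u -> u <= v -> v <= b -> f u <= f v.
  move=> au uv vb; apply: (derive_ge0_le (s := s) uv (cW _ _ au vb)) => x /andP[ux xv] xs.
  by have [|df d1 /ltW d2] := fd x _ xs; [rewrite (le_lt_trans au)//= (lt_le_trans xv)|exists df].
apply: (le_lt_trans (mono a a' _ _ _)) => //; first by rewrite (le_trans (ltW ab')).
apply: (lt_le_trans _ (mono b' b _ _ _)) => //; last by rewrite (le_trans aa')// ltW.
have fd' x : x \in `]a', b'[ -> exists2 df, is_derive x (1 : R) f df & 0 < df.
  rewrite in_itv/= => xab; apply: fd (H _ xab); move: xab => /andP[ax xb].
  by rewrite (le_lt_trans aa')//= (lt_le_trans xb).
have Hd x : x \in `]a', b'[ -> is_derive x (1 : R) f ('D_1 f x).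
  by move=> /fd'[df [fx <-] _].
have [x xab E] := MVT ab' Hd (cW _ _ aa' bb').
have [df [_ dfE] df0] := fd' x xab.
by rewrite -subr_gt0 E mulr_gt0 ?subr_gt0// dfE.
Qed.

End exceptional_points.

(** * Level sets of a piecewise affine function *)

(* A nonnegative piecewise affine function on a metric graph is a finite family
   of affine segments: on the segment [s] of length [l s] it increases from
   [al s] to [be s], while the torsion flux at distance [x] from the lower end
   is [c s - x].  The graph enters only through [flow], the flux balance of
   superlevel sets, and [cross], a form of connectedness. *)
Section level_sets.
Variables (R : realType) (p q : R).
Hypotheses (p1 : 1 < p) (q1 : 1 < q) (pq : p + q = p * q).
Variables (S : finType) (al be l c : S -> R) (M : R).
Hypotheses (al0 : forall s, 0 <= al s) (albe : forall s, al s < be s)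
  (beM : forall s, be s <= M) (l0 : forall s, 0 < l s)
  (maxM : exists s, be s = M).

Definition levels : seq R := [seq al s | s <- enum S] ++ [seq be s | s <- enum S].

Definition crossing s (t : R) := al s < t < be s.

Hypothesis flow : forall t : R, 0 < t -> t \notin levels ->
  \sum_s (c s * (t < al s)%R%:R + (l s - c s) * (t < be s)%R%:R) = 0.
Hypothesis cross : forall t : R, 0 < t < M -> t \notin levels ->
  exists s, crossing s t.

Let p0 : 0 < p. Proof. exact: lt_trans p1. Qed.
Let q0 : 0 < q. Proof. exact: lt_trans q1. Qed.

Definition slope s := (be s - al s) / l s.
(* Distance from the lower end of [s] to the point at level [t]. *)
Definition level_pos s t := Num.max 0 (Num.min (l s) ((t - al s) / slope s)).
(* Measure, dual energy and p-energy of super- and sublevel sets. *)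
Definition super_len t := \sum_s (l s - level_pos s t).
Definition super_dual t :=
  \sum_s (npow_int q (c s - level_pos s t) - npow_int q (c s - l s)).
Definition sub_energy t := \sum_s slope s `^ p * level_pos s t.
(** A lower sum for the integral of min(u, t)^p: on each segment [u] is replaced by its smallest
    value. *)
Definition sub_mass t := \sum_s l s * npow p (Num.min t (al s)).
(* Integral of |u'|^(p-1) over a level set, and its power entering the
   coarea inequalities. *)
Definition level_flux t := \sum_s (crossing s t)%:R * slope s `^ (p - 1).
Definition level_res t := level_flux t `^ (1 - q).
Definition ncross t : R := \sum_s (crossing s t)%:R.

Lemma slope_gt0 s : 0 < slope s.
Proof. by rewrite divr_gt0// subr_gt0. Qed.

Lemma slope_neq0 s : slope s != 0. Proof. by rewrite gt_eqF// slope_gt0. Qed.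

Lemma levelsP t : t \notin levels -> forall s, t != al s /\ t != be s.
Proof.
rewrite mem_cat negb_or => /andP[Ha Hb] s; split.
  by apply: contraNneq Ha => ->; rewrite map_f// mem_enum.
by apply: contraNneq Hb => ->; rewrite map_f// mem_enum.
Qed.

Lemma level_pos_ge0 s t : 0 <= level_pos s t.
Proof. by rewrite le_max lexx. Qed.

Lemma level_pos_le s t : level_pos s t <= l s.
Proof. by rewrite ge_max ltW//= ge_min lexx. Qed.

Lemma level_pos_below s t : t <= al s -> level_pos s t = 0.
Proof.
move=> ta; apply/eqP; rewrite eq_le level_pos_ge0 andbT ge_max lexx/= ge_min.
by rewrite orbC mulr_le0_ge0 ?subr_le0// invr_ge0 (ltW (slope_gt0 s)).
Qed.

Lemma level_pos_above s t : be s <= t -> level_pos s t = l s.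
Proof.
move=> bt; apply/eqP; rewrite eq_le level_pos_le/= le_max le_min lexx/=.
apply/orP; right; rewrite ler_pdivlMr ?slope_gt0// /slope mulrC divfK ?(gt_eqF (l0 s))//.
by rewrite lerD2r.
Qed.

Lemma level_pos_in s t : crossing s t -> level_pos s t = (t - al s) / slope s.
Proof.
move=> /andP[/ltW at_ /ltW tb]; rewrite /level_pos.
have h0 : 0 <= (t - al s) / slope s by rewrite divr_ge0 ?subr_ge0// (ltW (slope_gt0 s)).
rewrite min_r ?max_r// ler_pdivrMr ?slope_gt0// /slope mulrC divfK ?(gt_eqF (l0 s))//.
by rewrite lerD2r.
Qed.

Lemma crossing_near s t : t \notin levels ->
  \forall x \near t, crossing s x = crossing s t.
Proof.
move=> /levelsP /(_ s)[ta tb].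
have [at_|ta'] := ltP (al s) t; last first.
  near=> x; have xa : x < al s by near: x; apply: lt_nbhsl; rewrite lt_neqAle ta.
  by rewrite /crossing !ltNge ta' ltW.
have [tb'|bt] := ltP t (be s); last first.
  near=> x; have xb : be s < x by near: x; apply: lt_nbhsr; rewrite lt_neqAle eq_sym tb.
  by rewrite /crossing [x < _]ltNge (ltW xb) [t < _]ltNge bt !andbF.
near=> x; have xa : al s < x by near: x; exact: lt_nbhsr.
have xb : x < be s by near: x; exact: lt_nbhsl.
by rewrite /crossing xa xb at_ tb'.
Unshelve. all: by end_near. Qed.

Lemma is_derive_level_pos s t : t \notin levels ->
  is_derive t (1 : R) (level_pos s) ((crossing s t)%:R / slope s).
Proof.
move=> tl; have := tl => /levelsP /(_ s)[ta tb].
have [at_|ta'] := ltP (al s) t; last first.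
  rewrite /crossing ltNge ta'/= mul0r.
  apply: (@is_derive_ext _ (fun=> 0)).
  near=> x; rewrite level_pos_below// ltW//; near: x.
  by apply: lt_nbhsl; rewrite lt_neqAle ta.
have [tb'|bt] := ltP t (be s); last first.
  rewrite /crossing [t < _]ltNge bt andbF mul0r.
  apply: (@is_derive_ext _ (fun=> l s)).
  near=> x; rewrite level_pos_above// ltW//; near: x.
  by apply: lt_nbhsr; rewrite lt_neqAle eq_sym tb.
have ct : crossing s t by rewrite /crossing at_ tb'.
rewrite ct mul1r.
apply: (@is_derive_ext _ (fun x => (slope s)^-1 * (x - al s))).
  near=> x; have cx : crossing s x.
    by near: x; apply: filterS (crossing_near s tl) => x ->.
  by rewrite (level_pos_in cx) mulrC.
have d := is_deriveZ (slope s)^-1 (is_deriveB (is_derive_id t 1) (is_derive_const (al s) t)).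
by rewrite subr0 /GRing.scale/= mulr1 in d.
Unshelve. all: by end_near. Qed.

Lemma continuous_level_pos s : continuous (level_pos s).
Proof.
move=> t.
apply: (@continuous_maxr _ (fun=> 0) (fun x => Num.min (l s) ((x - al s) / slope s))).
  exact: cvg_cst.
apply: (@continuous_minr _ (fun=> l s) (fun x => (x - al s) / slope s)).
  exact: cvg_cst.
by apply: cvgM; [apply: cvgB; [exact: cvg_id|exact: cvg_cst]|exact: cvg_cst].
Qed.

Lemma continuous_super_len : continuous super_len.
Proof.
move=> t; apply: continuous_bigsum => s; apply: cvgB; first exact: cvg_cst.
exact: continuous_level_pos.
Qed.

Lemma continuous_super_dual : continuous super_dual.
Proof.
move=> t; apply: continuous_bigsum => s; apply: cvgB; last exact: cvg_cst.
apply: (@continuous_comp _ _ _ (fun t => c s - level_pos s t) (npow_int q)).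
  by apply: cvgB; [exact: cvg_cst|exact: continuous_level_pos].
exact: is_derive1_continuous (is_derive_npow_int _ q0).
Qed.

Lemma continuous_sub_energy : continuous sub_energy.
Proof.
move=> t; apply: continuous_bigsum => s; apply: cvgM; first exact: cvg_cst.
exact: continuous_level_pos.
Qed.

Lemma is_derive_super_len t : t \notin levels ->
  is_derive t (1 : R) super_len (- \sum_s (crossing s t)%:R / slope s).
Proof.
move=> tl; rewrite -sumrN; apply: is_derive_bigsum => s.
have := is_deriveB (is_derive_const (l s) t) (is_derive_level_pos s tl).
by rewrite sub0r.
Qed.

Lemma is_derive_seg_dual s t : t \notin levels ->
  is_derive t (1 : R) (fun t => npow_int q (c s - level_pos s t) - npow_int q (c s - l s))
   (- ((crossing s t)%:R / slope s * npow q (c s - level_pos s t))).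
Proof.
move=> tl.
have d := is_deriveB (is_derive_const (c s) t) (is_derive_level_pos s tl).
have := is_derive1_comp (is_derive_npow_int _ q0) d.
move=> /is_deriveB /(_ (is_derive_const (npow_int q (c s - l s)) t)).
by rewrite sub0r subr0 mulrN mulrC.
Qed.

Lemma is_derive_super_dual t : t \notin levels ->
  is_derive t (1 : R) super_dual
   (- \sum_s (crossing s t)%:R / slope s * npow q (c s - level_pos s t)).
Proof.
by move=> tl; rewrite -sumrN; apply: is_derive_bigsum => s; exact: is_derive_seg_dual.
Qed.

Lemma is_derive_sub_energy t : t \notin levels ->
  is_derive t (1 : R) sub_energy (level_flux t).
Proof.
move=> tl; apply: is_derive_bigsum => s.
have -> : (crossing s t)%:R * slope s `^ (p - 1) =
    slope s `^ p * ((crossing s t)%:R / slope s).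
  rewrite -(mulr_powRB1 (ltW (slope_gt0 s)) p0).
  by rewrite mulrAC mulrCA mulfV ?slope_neq0// mulr1.
exact: (is_deriveZ (slope s `^ p) (is_derive_level_pos s tl)).
Qed.

Lemma is_derive_sub_mass t : 0 < t -> t \notin levels ->
  is_derive t (1 : R) sub_mass (\sum_s (t < al s)%R%:R * (l s * (p * t `^ (p - 1)))).
Proof.
move=> t0 tl; apply: is_derive_bigsum => s.
have := tl => /levelsP /(_ s)[ta tb].
have [ta'|at_] := ltP t (al s); last first.
  rewrite mul0r; apply: (@is_derive_ext _ (fun=> l s * npow p (al s))).
  near=> x; rewrite /= min_r// ltW//; near: x.
  by apply: lt_nbhsr; rewrite lt_neqAle eq_sym ta.
rewrite mul1r; apply: (@is_derive_ext _ (fun x => l s * x `^ p)).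
  near=> x; rewrite min_l ?/npow ?gtr0_norm//; last by rewrite ltW//; near: x; exact: lt_nbhsl.
  by near: x; exact: lt_nbhsr.
have d := is_derive1_powR p t0; apply: is_derive_eq.
by rewrite /GRing.scale/=.
Unshelve. all: by end_near. Qed.

Lemma continuous_sub_mass : continuous sub_mass.
Proof.
move=> t; apply: continuous_bigsum => s; apply: cvgM; first exact: cvg_cst.
apply: (@continuous_comp _ _ _ (fun x => Num.min x (al s)) (npow p)).
  apply: (@continuous_minr _ id (fun=> al s)); [exact: cvg_id|exact: cvg_cst].
exact: continuous_npow.
Qed.

Lemma super_len_le t : super_len t <= \sum_s l s.
Proof. by apply: ler_sum => s _; rewrite gerBl level_pos_ge0. Qed.

Lemma super_len_ge0 t : 0 <= super_len t.
Proof. by apply: sumr_ge0 => s _; rewrite subr_ge0 level_pos_le. Qed.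

Lemma super_len_gt0 t : t < M -> 0 < super_len t.
Proof.
move=> tM; have [s sM] := maxM.
rewrite /super_len (bigD1 s)//= ltr_pwDl//; last first.
  by apply: sumr_ge0 => i _; rewrite subr_ge0 level_pos_le.
rewrite subr_gt0 gt_max l0 gt_min; apply/orP; right.
by rewrite ltr_pdivrMr ?slope_gt0// /slope mulrC divfK ?(gt_eqF (l0 s))// sM ltrD2r.
Qed.

Lemma super_lenM : super_len M = 0.
Proof. by apply: big1 => s _; rewrite level_pos_above ?subrr. Qed.

Lemma super_dualM : super_dual M = 0.
Proof. by apply: big1 => s _; rewrite level_pos_above ?subrr. Qed.

Lemma super_dual0 : super_dual 0 = \sum_s (npow_int q (c s) - npow_int q (c s - l s)).
Proof. by apply: eq_bigr => s _; rewrite level_pos_below ?subr0. Qed.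

Lemma level_flux_ge s t : crossing s t -> slope s `^ (p - 1) <= level_flux t.
Proof.
move=> st; rewrite /level_flux (bigD1 s)//= st mul1r lerDl.
by apply: sumr_ge0 => i _; rewrite mulr_ge0 ?powR_ge0.
Qed.

Lemma level_res_ge0 t : 0 <= level_res t. Proof. exact: powR_ge0. Qed.

(** 1 - q = - 1 / (p - 1) is negative, so a single term of [level_flux] already bounds the power of
    the sum from above. *)
Lemma level_res_le s t : crossing s t -> level_res t <= (slope s)^-1.
Proof.
move=> st; have m0 := slope_gt0 s.
have i0 : 0 < slope s `^ (p - 1) by rewrite powR_gt0// slope_gt0.
have -> : (slope s)^-1 = (slope s `^ (p - 1)) `^ (1 - q).
  by rewrite -powRrM -[1 - q]opprB mulrN conj_subr1M// powR_inv1// ltW.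
rewrite /level_res -[1 - q]opprB !powRN lef_pV2 ?posrE ?powR_gt0//; last first.
  exact: lt_le_trans (level_flux_ge st).
by apply: ler_powRl; rewrite ?subr_ge0 ?(ltW q1) ?(ltW i0)// level_flux_ge.
Qed.

Lemma ncross_res t : ncross t * level_res t <= \sum_s (crossing s t)%:R / slope s.
Proof.
rewrite mulr_suml; apply: ler_sum => s _.
by case: (boolP (crossing s t)) => [/level_res_le|_]; rewrite ?mul1r ?mul0r.
Qed.

(** In the balance a segment above the level contributes c + (l - c) = l, and a crossed one l - c,
    which is its length above the level minus the flux c - level_pos through it. Adding the balance
    therefore leaves only fluxes through crossing points. *)
Lemma super_len_flux t : 0 < t -> t \notin levels ->
  super_len t <= \sum_s (crossing s t)%:R * `|c s - level_pos s t|.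
Proof.
move=> t0 tl; rewrite -[leRHS]add0r -{1}(flow t0 tl) -big_split/=; apply: ler_sum => s _.
have [ta tb] := levelsP tl s; rewrite /crossing /=.
have [ta'|at_] := ltP t (al s).
  rewrite (lt_trans ta' (albe s)) ltNge (ltW ta')/= level_pos_below ?(ltW ta')//.
  by rewrite mul0r !mulr1; lra.
have at' : al s < t by rewrite lt_neqAle eq_sym ta.
rewrite at'/=; case: ltP => [tb'|bt].
  rewrite mulr0 add0r mulr1 mul1r addrAC -lerBlDl.
  by have := ler_norm (c s - level_pos s t); lra.
by rewrite level_pos_above// subrr !mulr0 mul0r !addr0.
Qed.

(** Hoelder's inequality applied to [super_len_flux], in the form of Young's inequality summed over
    the crossing segments. *)
Lemma super_dual_res t : 0 < t < M -> t \notin levels ->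
  super_len t `^ q * level_res t <=
  \sum_s (crossing s t)%:R / slope s * npow q (c s - level_pos s t).
Proof.
move=> /andP[t0 tM] tl; set B := (\sum_s _).
have mu0 := super_len_gt0 tM.
have [s0 cs0] : exists s, crossing s t by apply: cross => //; rewrite t0.
have I0 : 0 < level_flux t.
  by apply: lt_le_trans (level_flux_ge cs0); rewrite powR_gt0// slope_gt0.
(* The optimal scaling: the first Young terms add up to [super_len t], and absorbing them on the
   left leaves the factor p - 1 on both sides. *)
set k := super_len t / level_flux t; have k0 : 0 < k by rewrite divr_gt0.
have F s : crossing s t ->
    p * `|c s - level_pos s t| <= k * slope s `^ (p - 1) +
      (p - 1) * (k `^ (1 - q) * ((slope s)^-1 * npow q (c s - level_pos s t))).
  move=> cs; set f := `|_|; have m0 := slope_gt0 s.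
  (* Young's inequality is applied to d and f / d; this d turns its two terms into those of
     [level_flux] and of the dual energy. *)
  pose d := (k * slope s `^ (p - 1)) `^ p^-1.
  have km0 : 0 < k * slope s `^ (p - 1) by rewrite mulr_gt0// powR_gt0.
  have d0 : 0 < d by rewrite powR_gt0// slope_gt0.
  have dp : d `^ p = k * slope s `^ (p - 1).
    by rewrite /d -powRrM mulVf ?gt_eqF// powRr1// ltW.
  have dq : d `^ q = k `^ (q - 1) * slope s.
    have {1}-> : q = p * (q - 1) by rewrite mulrBr mulr1 -pq; ring.
    rewrite powRrM dp powRM ?powR_ge0 ?(ltW k0)// -powRrM.
    by rewrite conj_subr1M// powRr1// ltW.
  have := young p1 q1 pq (ltW d0) (divr_ge0 (normr_ge0 _) (ltW d0) : 0 <= f / d).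
  rewrite dp [d * _]mulrC divfK ?(gt_eqF d0)// => /le_trans; apply.
  rewrite lerD2l ler_wpM2l ?subr_ge0 ?(ltW p1)//.
  rewrite powRM ?invr_ge0 ?(ltW d0)//; last exact: normr_ge0.
  rewrite -(powR_inv1 (ltW d0)) -powRrM mulN1r powRN dq invfM.
  by rewrite -powRN opprB mulrCA [_ * (slope s)^-1]mulrC.
have : p * super_len t <= k * level_flux t + (p - 1) * (k `^ (1 - q) * B).
  apply: (@le_trans _ _ (p * \sum_s (crossing s t)%:R * `|c s - level_pos s t|)).
    by rewrite ler_pM2l// super_len_flux.
  rewrite 3!mulr_sumr mulr_sumr -big_split; apply: ler_sum => s _ /=.
  case: (boolP (crossing s t)) => [cs|_]; last by rewrite !mul0r !mulr0 addr0.
  by rewrite !mul1r F.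
rewrite {1}/k divfK ?(gt_eqF I0)// -lerBlDl -{2}[super_len t]mul1r -mulrBl.
rewrite ler_pM2l ?subr_gt0// -[1 - q]opprB powRN mulrC ler_pdivlMr ?powR_gt0//.
apply: le_trans; rewrite /level_res /k powRM ?(ltW mu0) ?invr_ge0 ?(ltW I0)//.
rewrite -(powR_inv1 (ltW I0)) -powRrM mulN1r opprB mulrA.
by rewrite mulr_powRB1// ltW.
Qed.

(** The guaranteed decay rate of [super_dual]. Its antiderivatives replace the torsion of superlevel
    sets. *)
Definition level_rate t := super_len t `^ q * level_res t.
Definition double_crossing t := (1 < #|[pred s | crossing s t]|)%N.

Lemma level_rate_ge0 t : 0 <= level_rate t.
Proof. by rewrite mulr_ge0 ?powR_ge0. Qed.

Lemma level_rate_gt0 t : 0 < t < M -> t \notin levels -> 0 < level_rate t.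
Proof.
move=> t0M tl; have [s cs] := cross t0M tl.
have /andP[_ tM] := t0M.
rewrite mulr_gt0 ?powR_gt0 ?super_len_gt0//.
by apply: lt_le_trans (level_flux_ge cs); rewrite powR_gt0// slope_gt0.
Qed.

Lemma level_rate_le t : level_rate t <= (\sum_s l s) `^ q * \sum_s (slope s)^-1.
Proof.
apply: ler_pM; rewrite ?powR_ge0//.
  by apply: ler_powRl; rewrite ?(ltW q0) ?super_len_ge0 ?super_len_le.
have sl0 i : 0 <= (slope i)^-1 by rewrite invr_ge0 (ltW (slope_gt0 i)).
case: (pickP (crossing ^~ t)) => [s cs|nc].
  apply: le_trans (level_res_le cs) _.
  by rewrite (bigD1 s)//= lerDl sumr_ge0.
(* Without crossing segments the base is 0, and 0 to a nonzero power is 0 by convention, even for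
   the negative exponent 1 - q. *)
rewrite /level_res /level_flux big1 ?powR0 ?sumr_ge0//.
  by rewrite subr_eq0 lt_eqF.
by move=> i _; rewrite nc mul0r.
Qed.

Lemma crossings_near t : t \notin levels ->
  \forall x \near t, (crossing ^~ x) =1 (crossing ^~ t).
Proof.
move=> tl.
have H : \forall x \near t, {in enum S, forall s, crossing s x = crossing s t}.
  elim: (enum S) => [|s r IH]; first by near=> x.
  near=> x; move=> i; rewrite inE => /predU1P[->|ir].
    by near: x; exact: crossing_near.
  by move: i ir; near: x.
by apply: filterS H => x H s; apply: H; rewrite mem_enum.
Unshelve. all: by end_near. Qed.

Lemma continuous_level_rate t : t \notin levels -> {for t, continuous level_rate}.
Proof.
move=> tl; have c1 : {for t, continuous (fun x => super_len x `^ q)}.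
  rewrite (_ : (fun x => _ `^ q) = npow q \o super_len); last first.
    by apply/funext => x; rewrite /npow/= ger0_norm ?super_len_ge0.
  by apply: continuous_comp; [exact: continuous_super_len|exact: continuous_npow].
apply: (@cvgM _ _ _ _ (fun x => super_len x `^ q) level_res _ _ c1).
apply: cvg_near_cst; apply: filterS (crossings_near tl) => x H.
rewrite /level_res /level_flux; congr (_ `^ _).
by apply: eq_bigr => s _; rewrite H.
Qed.

Lemma continuous_double_rate t : t \notin levels ->
  {for t, continuous (fun x => (double_crossing x)%:R * level_rate x)}.
Proof.
move=> tl; apply: cvgM; last exact: continuous_level_rate.
apply: cvg_near_cst; apply: filterS (crossings_near tl) => x H.
rewrite /double_crossing; congr (nat_of_bool (1 < _)%N)%:R.
by apply: eq_card => s; rewrite !inE H.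
Qed.

Lemma double_res t : 0 < t < M -> t \notin levels ->
  (1 + (double_crossing t)%:R) * level_res t <= \sum_s (crossing s t)%:R / slope s.
Proof.
move=> t0M tl; apply: le_trans (ncross_res t); rewrite ler_wpM2r ?level_res_ge0//.
have -> : ncross t = #|[pred s | crossing s t]|%:R.
  by rewrite /ncross -natr_sum -sum1_card [in RHS]big_mkcond.
have [s cs] := cross t0M tl.
have : (0 < #|[pred s | crossing s t]|)%N by apply/card_gt0P; exists s.
by rewrite -[1]/1%:R -natrD ler_nat /double_crossing; case: #|_| => [|[|n]].
Qed.

(** * Integrated decay estimates for dual energy and length *)

Section antiderivatives.
Variable K : R -> R.
Hypotheses (cK : continuous K)
  (dK : forall t, 0 < t -> t \notin levels -> is_derive t (1 : R) K (level_rate t)).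

Lemma rate_le_dual a b : 0 <= a -> a <= b -> b <= M ->
  K b - K a <= super_dual a - super_dual b.
Proof.
move=> a0 ab bM.
have : - (super_dual a + K a) <= - (super_dual b + K b).
  apply: (@derive_ge0_le _ (fun t => - (super_dual t + K t)) levels) => //.
    by apply: continuous_within => x _; apply: cvgN; apply: cvgD; [exact: continuous_super_dual|exact: cK].
  move=> x /andP[ax xb] xl; have x0 : 0 < x by exact: le_lt_trans ax.
  have d := is_deriveN (is_deriveD (is_derive_super_dual xl) (dK x0 xl)).
  eexists; first exact: d.
  rewrite opprD opprK subr_ge0; apply: super_dual_res => //.
  by rewrite x0 (lt_le_trans xb).
by rewrite lerN2; lra.
Qed.

Lemma rate_lt a b : 0 <= a -> a < b -> b <= M -> K a < K b.
Proof.
move=> a0 ab bM; apply: (@derive_gt0_lt _ _ levels) => //.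
  by apply: continuous_within => x _; exact: cK.
move=> x /andP[ax xb] xl; have x0 : 0 < x by exact: le_lt_trans ax.
exists (level_rate x); [exact: dK|apply: level_rate_gt0 => //].
by rewrite x0 (lt_le_trans xb).
Qed.

Variable K2 : R -> R.
Hypotheses (cK2 : continuous K2)
  (dK2 : forall t, 0 < t -> t \notin levels ->
     is_derive t (1 : R) K2 ((double_crossing t)%:R * level_rate t)).

(** [super_len] decreases at least at the rate [ncross t * level_res t], so a doubly crossed level
    counts twice; [K2] collects this surplus. *)
Lemma rate_le_len a b : 0 <= a -> a <= b -> b <= M ->
  (K b - K a) + (K2 b - K2 a) <=
  npow_int q (super_len a) - npow_int q (super_len b).
Proof.
move=> a0 ab bM.
pose F t := npow_int q (super_len t).
have : - (F a + (K a + K2 a)) <= - (F b + (K b + K2 b)).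
  apply: (@derive_ge0_le _ (fun t => - (F t + (K t + K2 t))) levels) => //.
    apply: continuous_within => x _; apply: cvgN; apply: cvgD.
      apply: (@continuous_comp _ _ _ super_len (npow_int q)).
        exact: continuous_super_len.
      exact: is_derive1_continuous (is_derive_npow_int _ q0).
    by apply: cvgD; [exact: cK|exact: cK2].
  move=> x /andP[ax xb] xl; have x0 : 0 < x by exact: le_lt_trans ax.
  have dF := is_derive1_comp (is_derive_npow_int (super_len x) q0) (is_derive_super_len xl).
  have d := is_deriveN (is_deriveD dF (is_deriveD (dK x0 xl) (dK2 x0 xl))).
  eexists; first exact: d.
  rewrite opprD mulrN opprK subr_ge0 /npow ger0_norm ?super_len_ge0//.
  rewrite -{1}[level_rate x]mul1r -mulrDl mulrCA ler_wpM2l ?powR_ge0//.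
  by apply: double_res => //; rewrite x0 (lt_le_trans xb).
by rewrite lerN2 /F; lra.
Qed.

Variable X : pred S.
Hypothesis Xdouble : forall t s, 0 < t < M -> t \notin levels -> X s ->
  crossing s t -> double_crossing t.

Definition super_dual_on t := \sum_s
  (X s)%:R * (npow_int q (c s - level_pos s t) - npow_int q (c s - l s)).

(** At a doubly crossed level [K - K2] is stationary. At any other level no segment of [X] is
    crossed, so the whole decay of [super_dual] takes place off [X]. *)
Lemma rate_le_dual_off a b : 0 <= a -> a <= b -> b <= M ->
  (K b - K a) - (K2 b - K2 a) <=
  (super_dual a - super_dual b) - (super_dual_on a - super_dual_on b).
Proof.
move=> a0 ab bM.
have cX : continuous super_dual_on.
  move=> t; apply: continuous_bigsum => s; apply: cvgM; first exact: cvg_cst.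
  apply: cvgB; last exact: cvg_cst.
  apply: (@continuous_comp _ _ _ (fun t => c s - level_pos s t) (npow_int q)).
    by apply: cvgB; [exact: cvg_cst|exact: continuous_level_pos].
  exact: is_derive1_continuous (is_derive_npow_int _ q0).
pose F t := super_dual t - super_dual_on t.
have : - (F a + (K a - K2 a)) <= - (F b + (K b - K2 b)).
  apply: (@derive_ge0_le _ (fun t => - (F t + (K t - K2 t))) levels) => //.
    apply: continuous_within => x _; apply: cvgN; apply: cvgD.
      by apply: cvgB; [exact: continuous_super_dual|exact: cX].
    by apply: cvgB; [exact: cK|exact: cK2].
  move=> x /andP[ax xb] xl; have x0 : 0 < x by exact: le_lt_trans ax.
  have x0M : 0 < x < M by rewrite x0 (lt_le_trans xb).
  pose dX s := (X s)%:R * - ((crossing s x)%:R / slope s * npow q (c s - level_pos s x)).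
  have dXd : is_derive x (1 : R) super_dual_on (\sum_s dX s).
    apply: is_derive_bigsum => s.
    exact: (is_deriveZ (X s)%:R (is_derive_seg_dual s xl)).
  have dF := is_deriveB (is_derive_super_dual xl) dXd.
  have d := is_deriveN (is_deriveD dF (is_deriveB (dK x0 xl) (dK2 x0 xl))).
  eexists; first exact: d.
  rewrite oppr_ge0; case: (boolP (double_crossing x)) => [dc|ndc].
    rewrite mul1r subrr addr0 -sumrN -sumrB; apply: sumr_le0 => s _.
    rewrite /dX; set u := _ / _ * _.
    have u0 : 0 <= u by rewrite /u !mulr_ge0 ?powR_ge0 ?invr_ge0 ?(ltW (slope_gt0 s))// ?powR_ge0.
    by case: (X s); rewrite ?mul1r ?mul0r; lra.
  rewrite mul0r subr0 [X in _ - X]big1 => [|s _].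
    by rewrite subr0 addrC subr_le0; apply: super_dual_res.
  rewrite /dX; case: (boolP (X s)) => [Xs|_]; last by rewrite mul0r.
  case: (boolP (crossing s x)) => [cs|_]; last by rewrite !mul0r oppr0 mulr0.
  by rewrite (Xdouble x0M xl Xs cs) in ndc.
by rewrite lerN2 /F; lra.
Qed.

End antiderivatives.

(* The Kohler-Jobin comparison.  [Kt M - Kt t] plays the role of the torsion of
   the superlevel set {u > t}; [rad] is the length of the interval with that
   torsion, and the rearranged function takes the value [ht t] where the
   interval {u* > ht t} has length [rad t].  The weight [sg] records the gain
   available when {u > t} is longer than that interval by a factor [th]. *)
Section comparison.
Variables (Kt : R -> R) (t0 sg0 th lam : R) (A : R -> R) (rmax : R).
Hypotheses (sg0_gt0 : 0 < sg0) (sg0_le1 : sg0 <= 1) (th0 : 0 < th)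
  (sgth : 1 <= sg0 * th) (sgthp : 1 <= sg0 `^ p * th `^ (p - 1)).
Definition weight t := if t < t0 then sg0 else 1.
Hypotheses (cKt : continuous Kt)
  (dKt : forall t : R, 0 < t -> t \notin t0 :: levels ->
     is_derive t (1 : R) Kt (weight t `^ q * level_rate t)).
(** An interval of length r with one Dirichlet end has torsion integral r^(q+1) / (q + 1); this
    formula solves for r. *)
Definition rad t := ((q + 1) * (Kt M - Kt t)) `^ (q + 1)^-1.
Hypotheses (rad_le : forall t : R, 0 <= t <= M -> rad t <= super_len t)
  (rad_le_th : forall t : R, 0 <= t < t0 -> th * rad t <= super_len t).
Hypotheses (lam0 : 0 < lam) (rad0 : rad 0 < rmax)
  (dA : forall r : R, 0 < r < rmax ->
     is_derive r (1 : R) A (lam + (p - 1) * A r `^ q))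
  (A_ge : forall r : R, 0 < r < rmax -> lam * r <= A r).

Let weight_gt0 t : 0 < weight t. Proof. by rewrite /weight; case: ifP. Qed.
Let weight_le1 t : weight t <= 1. Proof. by rewrite /weight; case: ifP. Qed.
Let q10 : 0 < q + 1. Proof. by rewrite addr_gt0. Qed.

Let Kt_lt (a b : R) : 0 <= a -> a < b -> b <= M -> Kt a < Kt b.
Proof.
move=> a0 ab bM; apply: (@derive_gt0_lt _ _ (t0 :: levels)) => //.
  by apply: continuous_within => x _; exact: cKt.
move=> x /andP[ax xb] xl; have x0 : 0 < x by exact: le_lt_trans ax.
exists (weight x `^ q * level_rate x); first exact: dKt.
rewrite mulr_gt0 ?powR_gt0// level_rate_gt0 ?x0 ?(lt_le_trans xb)//.
by move: xl; rewrite inE negb_or => /andP[].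
Qed.

Let rad_gt0 (t : R) : 0 <= t -> t < M -> 0 < rad t.
Proof. by move=> t0' tM; rewrite powR_gt0// mulr_gt0// subr_gt0 Kt_lt. Qed.

Let rad_lt (a b : R) : 0 <= a -> a < b -> b < M -> rad b < rad a.
Proof.
move=> a0 ab bM; apply: ltr_powRl.
- by rewrite invr_gt0.
- by rewrite mulr_ge0 ?subr_ge0 ?(ltW q10)// ltW// Kt_lt// (le_trans a0)// ltW.
- by rewrite ltr_pM2l// ltrD2l ltrN2 Kt_lt// ltW.
Qed.

Let is_derive_rad (t : R) : 0 < t -> t < M -> t \notin t0 :: levels ->
  is_derive t (1 : R) rad (- (weight t * super_len t / rad t) `^ q * level_res t).
Proof.
move=> t_gt0 tM tl.
have P : 0 < (q + 1) * (Kt M - Kt t) by rewrite mulr_gt0// subr_gt0 Kt_lt// ltW.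
have d := is_deriveZ (q + 1) (is_deriveB (is_derive_const (Kt M) t) (dKt t_gt0 tl)).
have d2 := @is_derive_powR_comp R (fun t => (q + 1) * (Kt M - Kt t)) (q + 1)^-1 t _ P d.
apply: (is_derive_eq d2); rewrite sub0r /GRing.scale/=.
have r0 := rad_gt0 (ltW t_gt0) tM.
have mu0 := super_len_ge0 t.
have -> : ((q + 1) * (Kt M - Kt t)) `^ ((q + 1)^-1 - 1) = rad t `^ (- q).
  rewrite /rad -powRrM; congr (_ `^ _); field; exact: lt0r_neq0.
rewrite !powRM ?mulr_ge0 ?invr_ge0 ?(ltW r0) ?(ltW (weight_gt0 _))//.
rewrite -(powR_inv1 (ltW r0)) -powRrM mulN1r /level_rate.
set X := rad t `^ _; field; exact: lt0r_neq0.
Qed.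

Let continuous_rad (t : R) : 0 <= t -> t < M -> {for t, continuous rad}.
Proof.
move=> t_ge0 tM.
have P : 0 < (q + 1) * (Kt M - Kt t) by rewrite mulr_gt0// subr_gt0 Kt_lt.
apply: (@continuous_comp _ _ _ (fun t => (q + 1) * (Kt M - Kt t)) (fun x => x `^ (q + 1)^-1)).
  by apply: cvgM; [exact: cvg_cst|apply: cvgB; [exact: cvg_cst|exact: cKt]].
exact: is_derive1_continuous (is_derive1_powR (q + 1)^-1 P).
Qed.

Section up_to.
Variable T : R.
Hypotheses (T0 : 0 <= T) (TM : T < M).

Let clamp t := Num.max 0 (Num.min t T).
Let clampP t : 0 <= clamp t <= T.
Proof. by rewrite le_max lexx ge_max T0 ge_min lexx orbT. Qed.
Let clamp_id t : 0 <= t -> t <= T -> clamp t = t.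
Proof. by move=> a b; rewrite /clamp min_l// max_r. Qed.

(** [rad] vanishes at [M], so the slope of [ht] is controlled only up to a level [T < M]. Clamping
    its argument to [0, T] makes the integrand bounded on the whole line. *)
Lemma exists_height : exists ht : R -> R,
  [/\ ht 0 = 0, continuous ht &
   forall t : R, 0 < t < T -> t != t0 ->
     is_derive t (1 : R) ht (weight t * super_len t / rad t)].
Proof.
pose g t := weight t * (super_len (clamp t) / rad (clamp t)).
have rT := rad_gt0 T0 TM.
have gB t : `|g t| <= (\sum_s l s) / rad T.
  have /andP[c0 cT] := clampP t.
  have r0 := rad_gt0 c0 (le_lt_trans cT TM).
  rewrite ger0_norm; last first.
    by rewrite mulr_ge0 ?divr_ge0 ?super_len_ge0// ltW.
  rewrite -[leRHS]mul1r; apply: ler_pM; rewrite ?(ltW (weight_gt0 _))//.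
    by rewrite divr_ge0 ?super_len_ge0// ltW.
  apply: ler_pM; rewrite ?super_len_ge0 ?invr_ge0 ?(ltW r0) ?super_len_le//.
  rewrite lef_pV2//; move: cT; rewrite le_eqVlt => /predU1P[->//|cT].
  by apply: ltW; exact: rad_lt.
have cclamp : continuous clamp.
  move=> t; apply: (@continuous_maxr _ (fun=> 0) (fun x => Num.min x T)).
    exact: cvg_cst.
  apply: (@continuous_minr _ id (fun=> T)); [exact: cvg_id|exact: cvg_cst].
have gc t : t \notin [:: t0] -> {for t, continuous g}.
  rewrite inE => tt0; apply: cvgM.
    apply: cvg_near_cst; rewrite /weight; have [h|h] := ltP t t0.
      by near=> x; rewrite ifT//; near: x; exact: lt_nbhsl.
    near=> x; rewrite ifF//; apply/negbTE; rewrite -leNgt ltW//.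
    by near: x; apply: lt_nbhsr; rewrite lt_neqAle eq_sym tt0.
  have /andP[c0 cT] := clampP t.
  have cM := le_lt_trans cT TM.
  apply: cvgM.
    apply: (@continuous_comp _ _ _ clamp super_len); first exact: cclamp.
    exact: continuous_super_len.
  apply: cvgV; first by rewrite gt_eqF// rad_gt0.
  apply: (@continuous_comp _ _ _ clamp rad); first exact: cclamp.
  exact: continuous_rad.
have [ht [h0 hc hd _]] := exists_antiderivative gB gc.
exists ht; split=> // t /andP[tt tT] tt0.
have := hd t tt; rewrite inE tt0 => /(_ isT).
by rewrite /g clamp_id ?mulrA// ltW.
Unshelve. all: by end_near. Qed.

(** The function [H] below vanishes at level 0, is nondecreasing, and differs from
    [sub_energy - lam * sub_mass] by a term that is nonnegative at [T]. Its derivative is the sum of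
    a Young defect, produced by the Riccati equation, and of a mass term controlled by t <= ht t. *)
Lemma kohler_jobin_upto : lam * sub_mass T <= sub_energy T.
Proof.
have [ht [h0 hc hd]] := exists_height.
have ht_ge_on a b k : 0 <= a -> a <= b -> b <= T ->
    (forall x, a < x < b -> k <= weight x * super_len x / rad x) ->
    k * (b - a) <= ht b - ht a.
  move=> a0 ab bT H.
  suff : ht a - k * a <= ht b - k * b by rewrite mulrBr; lra.
  apply: (@derive_ge0_le _ (fun t => ht t - k * t) [:: t0]) => //.
    apply: continuous_within => x _; apply: cvgB; first exact: hc.
    by apply: cvgM; [exact: cvg_cst|exact: cvg_id].
  move=> x /andP[ax xb]; rewrite inE => xt0.
  have d := hd x _ xt0; rewrite (le_lt_trans a0 ax) (lt_le_trans xb bT) in d.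
  have d' := is_deriveB (d isT) (is_deriveZ k (is_derive_id x 1)).
  eexists; first exact: d'.
  by rewrite subr_ge0 /GRing.scale/= mulr1 H ?ax.
have rate_ge x : 0 < x < T -> x < t0 -> sg0 * th <= weight x * super_len x / rad x.
  move=> /andP[x0 xT] xt0; rewrite /weight xt0/= ler_pdivlMr ?(rad_gt0 (ltW x0)) ?(lt_trans xT)//.
  by rewrite -mulrA ler_pM2l// rad_le_th// ltW.
have rate_ge1 x : 0 < x < T -> 1 <= weight x * super_len x / rad x.
  move=> /andP[x0 xT]; have [xt0|xt0] := ltP x t0.
    by apply: (le_trans sgth); apply: rate_ge; rewrite ?x0.
  rewrite /weight ltNge xt0/= mul1r ler_pdivlMr ?(rad_gt0 (ltW x0)) ?(lt_trans xT)// mul1r.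
  by rewrite rad_le// !ltW// (lt_trans xT).
have ht_ge t : 0 <= t -> t <= T -> t <= ht t.
  move=> t_ge0 tT; have := ht_ge_on 0 t 1 (lexx _) t_ge0 tT.
  rewrite mul1r h0 !subr0; apply => x /andP[x0 xt].
  by apply: rate_ge1; rewrite x0 (lt_le_trans xt).
have ht_ge_th t : 0 <= t -> t <= T -> t < t0 -> sg0 * th * t <= ht t.
  move=> t_ge0 tT tt0; have := ht_ge_on 0 t (sg0 * th) (lexx _) t_ge0 tT.
  rewrite h0 !subr0; apply => x /andP[x0 xt].
  by apply: rate_ge; rewrite ?x0 ?(lt_le_trans xt tT) ?(lt_trans xt tt0).
(* Subtracting lam * rad removes the constant term of the Riccati equation from B', and leaves lam *
   rad * (ht^p)', which pays for the mass. *)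
pose B t := A (rad t) - lam * rad t.
pose H t := sub_energy t - lam * sub_mass t - B t * npow p (ht t).
have radP t : 0 <= t -> t <= T -> 0 < rad t < rmax.
  move=> t_ge0 tT; rewrite rad_gt0 ?(le_lt_trans tT)//=.
  move: t_ge0; rewrite le_eqVlt => /predU1P[<-//|t_gt0].
  by apply: lt_trans rad0; apply: rad_lt; rewrite ?(le_lt_trans tT).
have : H 0 <= H T.
  apply: (@derive_ge0_le _ H (t0 :: levels)) => //.
    apply: continuous_within => t /=; rewrite in_itv/= => /andP[t_ge0 tT].
    have tM := le_lt_trans tT TM.
    apply: cvgB.
      apply: cvgB; first exact: continuous_sub_energy.
      by apply: cvgM; [exact: cvg_cst|exact: continuous_sub_mass].
    apply: cvgM; last first.
      by apply: (@continuous_comp _ _ _ ht (npow p)); [exact: hc|exact: continuous_npow].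
    apply: cvgB; last first.
      by apply: cvgM; [exact: cvg_cst|exact: continuous_rad].
    apply: (@continuous_comp _ _ _ rad A); first exact: continuous_rad.
    exact: is_derive1_continuous (dA (radP _ t_ge0 tT)).
  move=> t /andP[t_gt0 tT] tl0.
  have tM := lt_trans tT TM.
  have [tt0 tl] : t != t0 /\ t \notin levels.
    by move: tl0; rewrite inE negb_or => /andP[].
  have r0 := rad_gt0 (ltW t_gt0) tM.
  have rr := radP _ (ltW t_gt0) (ltW tT).
  have drad := is_derive_rad t_gt0 tM tl0.
  set hp := weight t * super_len t / rad t in drad.
  have hpE : hp = weight t * super_len t / rad t by [].
  clearbody hp.
  have dht : is_derive t 1 ht hp by rewrite hpE; apply: hd; rewrite ?t_gt0.
  have dB := is_deriveB (is_derive1_comp (dA rr) drad) (is_deriveZ lam drad).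
  have ht0 : 0 < ht t by apply: lt_le_trans (ht_ge _ _ _); rewrite // ltW.
  have dhp := is_derive1_comp (is_derive_npow (ht t) p1) dht.
  have dH := is_deriveB (is_deriveB (is_derive_sub_energy tl)
    (is_deriveZ lam (is_derive_sub_mass t_gt0 tl))) (is_deriveM dB dhp).
  eexists; first exact: dH.
  rewrite /GRing.scale/= (flux_gt0 _ ht0) /npow (ger0_norm (ltW ht0)).
  have [s cs] : exists s, crossing s t by apply: cross => //; rewrite t_gt0.
  have I0 : 0 < level_flux t.
    by apply: lt_le_trans (level_flux_ge cs); rewrite powR_gt0 ?slope_gt0.
  have hp1 : 1 <= hp by rewrite hpE; apply: rate_ge1; rewrite t_gt0.
  have hp0 : 0 < hp by exact: lt_le_trans hp1.
  have Ar0 : 0 < A (rad t) by apply: lt_le_trans (A_ge rr); rewrite mulr_gt0.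
  (* Young's inequality for the energy term. *)
  have Y : p * (A (rad t) * (ht t `^ (p - 1) * hp)) <=
      level_flux t + (p - 1) * (A (rad t) `^ q * ht t `^ p * (hp `^ q * level_res t)).
    pose a := level_flux t `^ p^-1.
    have a0 : 0 < a by rewrite powR_gt0.
    have b0 : 0 <= A (rad t) * (ht t `^ (p - 1) * hp) / a.
      by rewrite divr_ge0 ?(ltW a0)// !mulr_ge0 ?powR_ge0 ?(ltW Ar0) ?(ltW hp0).
    have := young p1 q1 pq (ltW a0) b0.
    rewrite [a * _]mulrC divfK ?gt_eqF// => /le_trans; apply.
    have -> : a `^ p = level_flux t.
      by rewrite /a -powRrM mulVf ?gt_eqF// powRr1// ltW.
    rewrite lerD2l ler_wpM2l ?subr_ge0 ?(ltW p1)// !powRM ?invr_ge0 ?mulr_ge0 ?powR_ge0 ?(ltW a0) ?(ltW Ar0) ?(ltW hp0)//.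
    rewrite -powRrM conj_subr1l// -(powR_inv1 (ltW a0)) -!powRrM mulN1r.
    have -> : p^-1 * - q = 1 - q.
      have -> : p^-1 = 1 - q^-1 by rewrite -(conj_inv p1 q1 pq) addrK.
      by rewrite mulrBl mul1r mulrN mulVf ?gt_eqF// opprK addrC.
    by rewrite -/(level_res t); lra.
  have N1 : \sum_i (t < al i)%R%:R * (l i * (p * t `^ (p - 1))) <=
      p * t `^ (p - 1) * super_len t.
    rewrite mulr_sumr; apply: ler_sum => i _; have [ta|_] := ltP t (al i).
      by rewrite mul1r level_pos_below ?(ltW ta)// subr0 mulrC.
    by rewrite mul0r mulr_ge0 ?subr_ge0 ?level_pos_le// mulr_ge0 ?powR_ge0// ltW.
  (* With weight 1 this is t <= ht t. Below [t0] the factor lost in the weight is regained from sg0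
     * th * t <= ht t by means of [sgthp]. *)
  have N2 : t `^ (p - 1) * super_len t <= ht t `^ (p - 1) * hp * rad t.
    rewrite hpE -[ht t `^ _ * _ * _]mulrA divfK ?gt_eqF// mulrA.
    rewrite ler_wpM2r ?super_len_ge0//; rewrite /weight; case: ifP => tt0'; last first.
      by rewrite mulr1 ler_powRl ?ht_ge ?subr_ge0 ?(ltW p1) ?(ltW t_gt0) ?(ltW tT).
    have h1 : t `^ (p - 1) * (sg0 * th) `^ (p - 1) <= ht t `^ (p - 1).
      rewrite -powRM ?mulr_ge0 ?(ltW t_gt0) ?(ltW sg0_gt0) ?(ltW th0)// mulrC ler_powRl ?subr_ge0 ?(ltW p1)//.
        by rewrite !mulr_ge0 ?(ltW t_gt0) ?(ltW sg0_gt0) ?(ltW th0).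
      by rewrite ht_ge_th ?(ltW t_gt0) ?(ltW tT).
    apply: le_trans (ler_wpM2r (ltW sg0_gt0) h1).
    rewrite -mulrA ler_peMr ?powR_ge0// powRM ?(ltW sg0_gt0) ?(ltW th0)//.
    by rewrite mulrC mulrA (mulr_powRB1 (ltW sg0_gt0) p0).
  have N3 := ler_wpM2l (ltW (mulr_gt0 lam0 p0)) N2.
  have N4 := ler_wpM2l (ltW lam0) N1.
  set X := \sum_i _ in N4 *.
  move: Y N3 N4; rewrite /GRing.opp/=.
  set a := A (rad t) `^ q; set hP := ht t `^ p; set hP1 := ht t `^ (p - 1).
  set hq := hp `^ q; set J := level_res t; set r := rad t.
  set Ar := A _; set mu := super_len t; set tp := t `^ _; set I := level_flux t.
  move=> Y N3 N4; rewrite -/(_ - _).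
  have -> : I - lam * X - ((Ar - lam * r) * (p * hP1 * hp) +
      hP * ((lam + (p - 1) * a) * (- hq * J) - lam * (- hq * J))) =
    (I + (p - 1) * (a * hP * (hq * J)) - p * (Ar * (hP1 * hp))) +
    (lam * p * (hP1 * hp * r) - lam * X) by ring.
  by rewrite addr_ge0// subr_ge0//; apply: le_trans N4 _; rewrite -[lam * p * (tp * mu)]mulrA mulrA in N3 *; apply: le_trans N3; rewrite !mulrA.
rewrite /H h0 /npow normr0 powR0 ?gt_eqF// mulr0 subr0.
have -> : sub_energy 0 = 0 by apply: big1 => s _; rewrite level_pos_below ?mulr0.
have -> : sub_mass 0 = 0.
  by apply: big1 => s _; rewrite min_l// /npow normr0 powR0 ?mulr0// gt_eqF.
rewrite mulr0 subr0; have B0 : 0 <= B T by rewrite subr_ge0 A_ge// radP.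
have := mulr_ge0 B0 (powR_ge0 `|ht T| p); rewrite /npow.
by set X := _ * (_ `^ _); lra.
Qed.

End up_to.

(** At the largest lower value [T] the truncation in [sub_mass] no longer acts, and T < M because
    every segment has [al s < be s]. *)
Lemma kohler_jobin_segments :
  lam * \sum_s l s * al s `^ p <= \sum_s slope s `^ p * l s.
Proof.
pose T := \big[Num.max/0]_s al s.
have [sM sME] := maxM.
have T0 : 0 <= T by rewrite /T; elim/big_ind : _ => // x y x0 y0; rewrite le_max x0.
have TM : T < M.
  rewrite /T; elim/big_ind : _ => [|x y xM yM|s _].
  - by rewrite -sME; apply: le_lt_trans (albe sM).
  - by rewrite gt_max xM.
  - exact: lt_le_trans (albe s) (beM s).
have alT s : al s <= T by rewrite /T (bigD1 s)//= le_max lexx.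
apply: le_trans (le_trans (kohler_jobin_upto T0 TM) _).
  rewrite ler_wpM2l ?(ltW lam0)//; apply: ler_sum => s _.
  by rewrite min_r// /npow ger0_norm.
apply: ler_sum => s _; rewrite ler_wpM2l ?powR_ge0//.
exact: level_pos_le.
Qed.

End comparison.

Lemma npow_int_homo : {homo npow_int q : x y / x <= y}.
Proof.
move=> x y xy; apply: (@derive_ge0_le _ (npow_int q) [::]) => //.
  apply: continuous_within => z _.
  exact: is_derive1_continuous (is_derive_npow_int _ q0).
move=> z _ _; eexists; first exact: is_derive_npow_int.
exact: powR_ge0.
Qed.

Let q10 : 0 < q + 1. Proof. by rewrite addr_gt0. Qed.

Let root_le x y : 0 <= x -> x <= npow_int q y -> 0 <= y ->
  ((q + 1) * x) `^ (q + 1)^-1 <= y.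
Proof.
move=> x0 xy y0; have qi : 0 <= (q + 1)^-1 by rewrite invr_ge0 ltW.
apply: (@le_trans _ _ ((y `^ (q + 1)) `^ (q + 1)^-1)); last first.
  by rewrite -powRrM mulfV ?gt_eqF// powRr1.
apply: ler_powRl => //; first by rewrite mulr_ge0// ltW.
rewrite -(mulr_powRB1 y0 q10) addrK mulrC -ler_pdivlMr//.
by move: xy; rewrite /npow_int ger0_norm.
Qed.

(** * The comparison with and without gain *)

Section conclusion.
Variables (W lam rmax : R) (A : R -> R).
Hypothesis WE : W = super_dual 0.
Hypotheses (lam0 : 0 < lam)
  (dA : forall r : R, 0 < r < rmax ->
     is_derive r (1 : R) A (lam + (p - 1) * A r `^ q))
  (A_ge : forall r : R, 0 < r < rmax -> lam * r <= A r).

Let M0 : 0 < M.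
Proof. by have [s <-] := maxM; apply: le_lt_trans (albe s). Qed.

Let exists_rate : exists K, [/\ K 0 = 0, continuous K &
  forall t : R, 0 < t -> t \notin levels -> is_derive t (1 : R) K (level_rate t)].
Proof.
have hB t : `|level_rate t| <= (\sum_s l s) `^ q * \sum_s (slope s)^-1.
  by rewrite ger0_norm ?level_rate_ge0// level_rate_le.
have [K [K0 cK dK _]] := exists_antiderivative hB continuous_level_rate.
by exists K.
Qed.

Let exists_double : exists K, [/\ continuous K,
  forall t : R, 0 < t -> t \notin levels ->
    is_derive t (1 : R) K ((double_crossing t)%:R * level_rate t) &
  {homo K : x y / x <= y}].
Proof.
have h0 t : 0 <= (double_crossing t)%:R * level_rate t.
  by rewrite mulr_ge0 ?level_rate_ge0.
have hB t : `|(double_crossing t)%:R * level_rate t| <=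
    (\sum_s l s) `^ q * \sum_s (slope s)^-1.
  rewrite ger0_norm//; apply: le_trans (level_rate_le t).
  by case: (double_crossing t); rewrite ?mul1r ?mul0r ?level_rate_ge0.
have [K [_ cK dK mK]] := exists_antiderivative hB continuous_double_rate.
by exists K; split=> //; exact: mK.
Qed.

(** t0 = 0 means that the weight is 1 at all levels. Any upper bound [V] for the total of [K] is
    admissible, which is how a shortfall of [K] becomes a gain. *)
Let plain K V : K 0 = 0 -> continuous K ->
  (forall t : R, 0 < t -> t \notin levels -> is_derive t (1 : R) K (level_rate t)) ->
  K M <= V -> ((q + 1) * V) `^ (q + 1)^-1 < rmax ->
  lam * \sum_s l s * al s `^ p <= \sum_s slope s `^ p * l s.
Proof.
move=> K0 cK dK KV Vr; have [K2 [cK2 dK2 mK2]] := exists_double.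
have KM t : 0 <= t -> t <= M -> 0 <= K M - K t.
  move=> t0; rewrite le_eqVlt => /predU1P[->|tM]; first by rewrite subrr.
  by rewrite subr_ge0 ltW//; exact: (rate_lt cK dK).
apply: (@kohler_jobin_segments K 0 1 1 lam A rmax) => //.
- by rewrite mulr1.
- by rewrite !powR1 mulr1.
- move=> t t0; rewrite inE negb_or => /andP[_ tl].
  by rewrite /weight ltNge (ltW t0)/= powR1 mul1r; exact: dK.
- move=> t /andP[t0 tM]; apply: root_le; rewrite ?super_len_ge0 ?KM//.
  have := rate_le_len cK dK cK2 dK2 t0 tM (lexx _).
  rewrite super_lenM /npow_int mul0r mul0r subr0; apply: le_trans.
  by rewrite lerDl subr_ge0 mK2.
- by move=> t /andP[t0]; rewrite ltNge t0.
- apply: le_lt_trans Vr; rewrite /rad K0 subr0; apply: ler_powRl.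
  + by rewrite invr_ge0 ltW.
  + by rewrite mulr_ge0 ?(ltW q10)//; have := KM 0 (lexx _) (ltW M0); rewrite K0 subr0.
  + by rewrite ler_pM2l.
Qed.

Theorem segments_ge : ((q + 1) * W) `^ (q + 1)^-1 < rmax ->
  lam * \sum_s l s * al s `^ p <= \sum_s slope s `^ p * l s.
Proof.
have [K [K0 cK dK]] := exists_rate; apply: (plain K0 cK dK).
have := rate_le_dual cK dK (lexx 0) (ltW M0) (lexx _).
by rewrite K0 super_dualM !subr0 WE.
Qed.

Variables (X : pred S) (d : R).
Hypotheses (d0 : 0 < d) (Xd : 2 * d <= super_dual_on X 0)
  (Xdouble : forall (t : R) s, 0 < t < M -> t \notin levels -> X s ->
     crossing s t -> double_crossing t).

(** As long as [K2] has 3 d / 2 left to collect, K M - K t <= W gives (K M - K t) + 3 d / 2 >= (1 +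
    3 d / (2 W)) (K M - K t). The root converts this factor into one on lengths. *)
Definition gain := (1 + 3 / 2 * d / W) `^ (q + 1)^-1.

(** Either [K] misses at least d / 2 of the torsion, a gain by itself, or [K] is nearly sharp. In
    the second case the dual energy on [X] forces [K2] to collect at least 3 d / 2 beyond every
    level t < t0. The sets {u > t} are then longer than the comparison interval by the factor
    [gain], so the rate of [K] may be damped below [t0], and this saves the amount subtracted in the
    hypothesis. *)
Theorem segments_ge_gap :
  ((q + 1) * (W - (1 - gain^-1) * (d / 2))) `^ (q + 1)^-1 < rmax ->
  lam * \sum_s l s * al s `^ p <= \sum_s slope s `^ p * l s.
Proof.
move=> Hr; have qi : 0 <= (q + 1)^-1 by rewrite invr_ge0 ltW.
have dual_on_le t : 0 <= t ->
    super_dual_on X 0 - super_dual_on X t <= super_dual 0 - super_dual t.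
  move=> t0; rewrite /super_dual_on /super_dual -!sumrB; apply: ler_sum => s _.
  rewrite level_pos_below// subr0.
  have := @npow_int_homo (c s - level_pos s t) (c s).
  rewrite gerBl level_pos_ge0 => /(_ isT).
  by case: (X s); rewrite ?mul1r ?mul0r; lra.
have Xon : super_dual_on X M = 0.
  by apply: big1 => s _; rewrite level_pos_above// subrr mulr0.
have Wd : 2 * d <= W.
  have := dual_on_le M (ltW M0); rewrite Xon super_dualM !subr0 -WE.
  exact: le_trans.
have W0 : 0 < W by apply: lt_le_trans Wd; rewrite mulr_gt0.
have g1 : 1 < 1 + 3 / 2 * d / W by rewrite ltrDl !mulr_gt0 ?invr_gt0.
have gain1 : 1 < gain.
  have e : (1 : R) `^ (q + 1)^-1 = 1 by rewrite powR1.
  rewrite -[X in X < _]e /gain; apply: ltr_powRl => //.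
  by rewrite invr_gt0.
have gain0 : 0 < gain by exact: lt_trans gain1.
have gV1 : gain^-1 < 1 by rewrite invf_lt1.
have [K [K0 cK dK]] := exists_rate.
have [KM|KM] := leP (K M) (W - d / 2).
  apply: (plain K0 cK dK KM); apply: le_lt_trans Hr; apply: ler_powRl => //.
    by rewrite mulr_ge0 ?(ltW q10)//; lra.
  rewrite ler_pM2l//; have : 0 <= gain^-1 * (d / 2).
    by rewrite mulr_ge0 ?invr_ge0 ?(ltW gain0)// divr_ge0// ltW.
  by rewrite mulrBl mul1r; lra.
have [K2 [cK2 dK2 mK2]] := exists_double.
have KMW : K M <= W.
  have := rate_le_dual cK dK (lexx 0) (ltW M0) (lexx _).
  by rewrite K0 super_dualM !subr0 WE.
(* [t0] is the level where K M - K t0 = W - d / 2. Since K M <= W, the part of [K] below it is at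
   most d / 2. *)
have [t0 t0M Kt0] : exists2 t0, t0 \in `[0, M] & K t0 = K M - (W - d / 2).
  apply: IVT; rewrite ?(ltW M0)//; first by apply: continuous_within => x _; exact: cK.
  rewrite K0 min_l ?max_r//; last by apply: ltW; lra.
    by apply/andP; split; lra.
  by lra.
move: t0M; rewrite in_itv/= => /andP[t0_ge0 t0M].
(* With the exponent - 1 / q one has sg^q = gain^-1 and sg^p * gain^(p-1) = 1, so the second
   condition on the weight holds with equality. *)
pose sg := gain `^ (- q^-1).
have sg0 : 0 < sg by rewrite powR_gt0.
have sgq : sg `^ q = gain^-1.
  by rewrite /sg -powRrM mulNr mulVf ?gt_eqF// powR_inv1// ltW.
have sg1 : sg <= 1.
  rewrite -[X in _ <= X](powRr0 gain) /sg; apply: ler_powR; rewrite ?(ltW gain1)//.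
  by rewrite oppr_le0 invr_ge0 ltW.
have Kmono a b : 0 <= a -> a <= b -> b <= M -> K a <= K b.
  move=> a0; rewrite le_eqVlt => /predU1P[->//|ab] bM.
  by rewrite ltW//; exact: (rate_lt cK dK).
(* [K] with its rate multiplied by sg^q up to [t0] and unchanged afterwards. *)
pose Kt t := sg `^ q * K (Num.min t t0) + K (Num.max t t0).
have Kt_below t : t <= t0 -> Kt M - Kt t = K M - K t0 + sg `^ q * (K t0 - K t).
  by move=> tt0; rewrite /Kt (min_r t0M) (max_l t0M) (min_l tt0) (max_r tt0); lra.
have Kt_above t : t0 <= t -> Kt M - Kt t = K M - K t.
  by move=> tt0; rewrite /Kt (min_r t0M) (max_l t0M) (min_r tt0) (max_l tt0); lra.
have Kt_le t : 0 <= t -> t <= M -> 0 <= Kt M - Kt t <= K M - K t.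
  move=> t_ge0 tM; have [tt0|/ltW tt0] := leP t0 t.
    by rewrite Kt_above// lexx andbT subr_ge0 Kmono.
  rewrite Kt_below// sgq.
  have h1 := Kmono _ _ t_ge0 tt0 t0M; have h2 := Kmono _ _ t0_ge0 t0M (lexx _).
  have h3 : 0 <= gain^-1 by rewrite invr_ge0 ltW.
  have h4 : 0 <= K t0 - K t by rewrite subr_ge0.
  have h5 := mulr_ge0 h3 h4; have h6 := ler_piMl h4 (ltW gV1).
  by apply/andP; split; lra.
apply: (@kohler_jobin_segments Kt t0 sg gain lam A rmax) => //.
- rewrite -[X in _ * X](powRr1 (ltW gain0)) /sg -powRD ?(gt_eqF gain0) ?implybT//.
  rewrite -[X in X <= _](powRr0 gain); apply: ler_powR; rewrite ?(ltW gain1)//.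
  by rewrite addrC subr_ge0 invf_le1// ltW.
- rewrite /sg -powRrM -powRD ?(gt_eqF gain0) ?implybT//.
  rewrite (_ : _ + _ = 0) ?powRr0// mulNr.
  have -> : q^-1 = 1 - p^-1 by rewrite -(conj_inv p1 q1 pq) addrAC subrr add0r.
  by rewrite mulrBl mulVf ?gt_eqF// mul1r addrC subrr.
- move=> t; apply: cvgD; last first.
    apply: (@continuous_comp _ _ _ (fun t => Num.max t t0) K); last exact: cK.
    apply: (@continuous_maxr _ id (fun=> t0)); [exact: cvg_id|exact: cvg_cst].
  apply: cvgM; first exact: cvg_cst.
  apply: (@continuous_comp _ _ _ (fun t => Num.min t t0) K); last exact: cK.
  apply: (@continuous_minr _ id (fun=> t0)); [exact: cvg_id|exact: cvg_cst].
- move=> t t_gt0; rewrite inE negb_or => /andP[tt0 tl]; rewrite /weight.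
  have [lt_t|lt_t] := ltP t t0.
    apply: (@is_derive_ext _ (fun x => sg `^ q * K x + K t0)).
      near=> x; have xt : x < t0 by near: x; exact: lt_nbhsl.
      by rewrite /Kt min_l ?max_r// ltW.
    have := is_deriveD (is_deriveZ (sg `^ q) (dK t t_gt0 tl)) (is_derive_const (K t0) t).
    by rewrite addr0.
  rewrite powR1 mul1r; apply: (@is_derive_ext _ (fun x => sg `^ q * K t0 + K x)).
    near=> x; have xt : t0 < x.
      by near: x; apply: lt_nbhsr; rewrite lt_neqAle eq_sym tt0.
    by rewrite /Kt min_r ?max_l// ltW.
  have := is_deriveD (is_derive_const (sg `^ q * K t0) t) (dK t t_gt0 tl).
  by rewrite add0r.
- move=> t /andP[t_ge0 tM]; have /andP[h1 h2] := Kt_le t t_ge0 tM.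
  apply: root_le; rewrite ?super_len_ge0//; apply: le_trans h2 _.
  have := rate_le_len cK dK cK2 dK2 t_ge0 tM (lexx _).
  rewrite super_lenM /npow_int mul0r mul0r subr0; apply: le_trans.
  by rewrite lerDl subr_ge0 mK2.
- move=> t /andP[t_ge0 tt0]; have tM := le_trans (ltW tt0) t0M.
  have /andP[h1 h2] := Kt_le t t_ge0 tM.
  have R0 : 0 <= K M - K t by exact: le_trans h2.
  apply: (@le_trans _ _ (((q + 1) * ((1 + 3 / 2 * d / W) * (K M - K t))) `^ (q + 1)^-1)).
    rewrite /gain /rad -powRM ?(ltW (lt_trans ltr01 g1)) ?mulr_ge0 ?(ltW q10)//.
    apply: ler_powRl => //.
      by rewrite !mulr_ge0 ?(ltW q10)// (ltW (lt_trans ltr01 g1)).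
    by rewrite mulrCA ler_pM2l// ler_pM2l// (lt_trans ltr01 g1).
  apply: root_le; rewrite ?super_len_ge0//.
    by rewrite mulr_ge0// (ltW (lt_trans ltr01 g1)).
  have H1 := rate_le_len cK dK cK2 dK2 t_ge0 tM (lexx _).
  have n0 : npow_int q (0 : R) = 0 by rewrite /npow_int !mul0r.
  rewrite super_lenM n0 subr0 in H1.
  apply: le_trans H1; rewrite mulrDl mul1r lerD2l.
  have H2 := rate_le_dual_off cK dK cK2 dK2 Xdouble t_ge0 tM (lexx _).
  rewrite Xon super_dualM !subr0 in H2.
  have H3 := dual_on_le t t_ge0; rewrite -WE in H3.
  have H4 : K t <= K t0 by apply: Kmono => //; exact: ltW.
  apply: (@le_trans _ _ (3 / 2 * d)).
    rewrite -mulrA ler_piMr ?mulr_ge0// ?(ltW d0)//.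
    rewrite mulrC ler_pdivrMr// mul1r; apply: le_trans KMW.
    by rewrite gerBl -K0 Kmono.
  have aux (kM kt k0 k2 ph px px0 : R) : k0 = kM - (W - d / 2) -> 2 * d <= px0 ->
      kM - kt - k2 <= ph - px -> px0 - px <= W - ph -> kt <= k0 -> 3 / 2 * d <= k2.
    by move=> *; lra.
  exact: aux Kt0 Xd H2 H3 H4.
- apply: le_lt_trans Hr; have /andP[h1 h2] := Kt_le 0 (lexx _) (ltW M0).
  apply: ler_powRl => //; first by rewrite mulr_ge0// ltW.
  rewrite ler_pM2l// Kt_below// sgq K0 subr0 Kt0.
  have h3 : 0 <= gain^-1 by rewrite invr_ge0 ltW.
  have h4 : gain^-1 * (K M - (W - d / 2)) <= gain^-1 * (d / 2).
    by rewrite ler_wpM2l// lerBlDr addrC subrK.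
  have -> : K M - (K M - (W - d / 2)) = W - d / 2 by rewrite opprB addrC subrK.
  by move: h4; rewrite mulrBl mul1r; set u := _ * _; set v := _ * _; lra.
Unshelve. all: by end_near. Qed.

End conclusion.
End level_sets.

(** * The blow-up time of the generalised tangent *)

(* Summing the partial fractions of the cosecant: the Fejer kernel gives
   [pi] as the Cesaro limit of [sin (pi s) / s * cosec_sum s n]. *)
Section cosecant.
Variable R : realType.
Implicit Types (s x : R) (n j k : nat).

Lemma is_derive_exprn n x :
  is_derive x (1 : R) (fun y => y ^+ n.+1) (n.+1%:R * x ^+ n).
Proof.
rewrite (_ : (fun y => y ^+ n.+1) = id ^+ n.+1).
  apply: is_derive_eq; rewrite /GRing.scale/= mulr1.
  by [].
by apply/funext => y; rewrite exprfctE.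
Qed.

Lemma sin_le x : 0 <= x -> sin x <= x.
Proof.
move=> x0; suff : 0 - sin 0 <= x - sin x by rewrite sin0 subrr subr_ge0.
apply: (@derive_ge0_le _ (fun x => x - sin x) [::]) => //.
  apply: continuous_within => y _; apply: cvgB; [exact: cvg_id|exact: continuous_sin].
move=> y _ _; eexists; first exact: (is_deriveB (is_derive_id y 1) (is_derive_sin y)).
by rewrite subr_ge0 cos_le1.
Qed.

Lemma cos_ge x : 0 <= x -> 1 - x ^+ 2 / 2 <= cos x.
Proof.
move=> x0; suff : cos 0 + 0 ^+ 2 / 2 <= cos x + x ^+ 2 / 2.
  by rewrite cos0 expr0n/= mul0r addr0 -lerBlDr.
apply: (@derive_ge0_le _ (fun x => cos x + x ^+ 2 / 2) [::]) => //.
  apply: continuous_within => y _; apply: cvgD; first exact: continuous_cos.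
  by apply: cvgM; [exact: exprn_continuous|exact: cvg_cst].
move=> y /andP[y0 _] _.
have d : is_derive y (1 : R) (fun x : R => 2^-1 * x ^+ 2) y.
  have h := is_deriveZ (2^-1 : R) (is_derive_exprn 1 y).
  by apply: (is_derive_eq h); rewrite /GRing.scale/=; field.
have d2 := is_deriveD (is_derive_cos y) d.
exists (- sin y + y); last by rewrite addrC subr_ge0 sin_le// ltW.
by apply: is_derive_ext d2; near=> z; rewrite /= fctE/= [_ / 2]mulrC.
Unshelve. all: by end_near. Qed.

Lemma sin_ge x : 0 <= x <= 2 -> x / 3 <= sin x.
Proof.
move=> /andP[x0 x2].
suff : sin 0 - 0 + 0 ^+ 3 / 6 <= sin x - x + x ^+ 3 / 6.
  rewrite sin0 expr0n/= mul0r addr0 subr0 => h.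
  have : x ^+ 3 / 6 <= x * (2 / 3).
    rewrite exprS -mulrA ler_wpM2l// ler_pdivrMr//.
    rewrite (_ : 2 / 3 * 6 = 2 ^+ 2); last by field.
    by rewrite ler_pXn2r// nnegrE.
  by lra.
apply: (@derive_ge0_le _ (fun x => sin x - x + x ^+ 3 / 6) [::]) => //.
  apply: continuous_within => y _; apply: cvgD.
    by apply: cvgB; [exact: continuous_sin|exact: cvg_id].
  by apply: cvgM; [exact: exprn_continuous|exact: cvg_cst].
move=> y /andP[y0 _] _.
have d : is_derive y (1 : R) (fun x : R => 6^-1 * x ^+ 3) (y ^+ 2 / 2).
  have h := is_deriveZ (6^-1 : R) (is_derive_exprn 2 y).
  by apply: (is_derive_eq h); rewrite /GRing.scale/=; field.
have d2 := is_deriveD (is_deriveB (is_derive_sin y) (is_derive_id y 1)) d.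
exists (cos y - 1 + y ^+ 2 / 2); last by have := cos_ge (ltW y0); lra.
by apply: is_derive_ext d2; near=> z; rewrite /= fctE/= [_ / 6]mulrC.
Unshelve. all: by end_near. Qed.

Definition dirichlet_kernel n x := 1 + \sum_(k < n) 2 * cos (k.+1%:R * x).

Lemma dirichlet_kernelE n x :
  sin (x / 2) * dirichlet_kernel n x = sin ((n%:R + 2^-1) * x).
Proof.
rewrite /dirichlet_kernel; elim: n => [|n IH].
  by rewrite big_ord0 addr0 mulr1 add0r mulrC.
rewrite big_ord_recr/= addrA mulrDr IH.
have e1 : (n%:R + 2^-1) * x = n.+1%:R * x - x / 2 by rewrite -natr1; field.
have e2 : (n.+1%:R + 2^-1) * x = n.+1%:R * x + x / 2 by field.
by rewrite e1 e2 sinB sinD; ring.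
Qed.

Lemma fejer_kernelE n x :
  2 * sin (x / 2) ^+ 2 * (\sum_(j < n) dirichlet_kernel j x) = 1 - cos (n%:R * x).
Proof.
elim: n => [|n IH]; first by rewrite big_ord0 mulr0 mul0r cos0 subrr.
rewrite big_ord_recr/= mulrDr IH.
rewrite expr2 -!mulrA dirichlet_kernelE.
have e1 : n%:R * x = (n%:R + 2^-1) * x - x / 2 by field.
have e2 : n.+1%:R * x = (n%:R + 2^-1) * x + x / 2 by rewrite -natr1; field.
by rewrite e1 e2 cosB cosD; ring.
Qed.

(** sin (x / 2) >= x / 6 and 1 - cos <= 2 in the closed form give the constant 36. *)
Lemma fejer_kernel_bound n x : 0 < x -> x < pi ->
  0 <= \sum_(j < n) dirichlet_kernel j x <= 36 / x ^+ 2.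
Proof.
move=> x0 xpi; have x2 : 0 <= x / 2 <= 2.
  have := @pi_ge2 R; have := @pihalf_lt2 R => h1 h2.
  by rewrite divr_ge0 ?(ltW x0)//=; lra.
have := sin_ge x2; set y := sin (x / 2) => y1.
have y0 : 0 < y by apply: lt_le_trans y1; rewrite !divr_gt0.
have y20 : 0 < 2 * y ^+ 2 by rewrite mulr_gt0// exprn_gt0.
have := fejer_kernelE n x; rewrite -/y; set T := \sum_(j < n) _ => E.
have cle := cos_le1 (n%:R * x); have cge := cos_geN1 (n%:R * x).
apply/andP; split.
  by rewrite -(pmulr_rge0 _ y20) E subr_ge0.
rewrite ler_pdivlMr ?exprn_gt0//.
have h : x ^+ 2 <= 36 * y ^+ 2.
  have : x <= 6 * y by move: y1; lra.
  rewrite -(ler_pXn2r (n:=2)) ?nnegrE ?(ltW x0) ?mulr_ge0 ?(ltW y0)// exprMn => /le_trans; apply.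
  by rewrite ler_wpM2r ?exprn_ge0 ?(ltW y0)// -natrX ler_nat.
have T0 : 0 <= T by rewrite -(pmulr_rge0 _ y20) E subr_ge0.
apply: le_trans (ler_wpM2l T0 h) _; move: E cge; lra.
Qed.

Variable s : R.
Hypotheses (s0 : 0 < s) (s1 : s < 1).

Definition cosec_sum n :=
  1 + \sum_(k < n) (-1) ^+ k * (2 * s ^+ 2 / (k.+1%:R ^+ 2 - s ^+ 2)).

Let sk k : s + k.+1%:R != 0. Proof. by rewrite gt_eqF// addr_gt0. Qed.
Let sk' k : s - k.+1%:R != 0.
Proof.
rewrite subr_eq0 lt_eqF//; apply: lt_le_trans s1 _.
by rewrite ler1n.
Qed.

(* Antiderivative of [(1 - cos (s x)) * dirichlet_kernel n x]. *)
Let g n x := (x - sin (s * x) / s) + \sum_(k < n) (2 * sin (k.+1%:R * x) / k.+1%:R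
  - sin ((s + k.+1%:R) * x) / (s + k.+1%:R)
  - sin ((s - k.+1%:R) * x) / (s - k.+1%:R)).

Let is_derive_sinZ (a x : R) : a != 0 ->
  is_derive x (1 : R) (fun x => sin (a * x) / a) (cos (a * x)).
Proof.
move=> a0.
have d := is_deriveZ a^-1 (is_derive1_comp (is_derive_sin (a * x)) (is_deriveZ a (is_derive_id x 1))).
have e : a^-1 * (cos (a * x) * (a * 1)) = cos (a * x) by rewrite mulr1 mulrC mulfK.
rewrite -e.
by apply: is_derive_ext d; near=> z; rewrite /= /GRing.scale/= mulrC.
Unshelve. all: by end_near. Qed.

Let is_derive_g n x : is_derive x (1 : R) (g n)
  ((1 - cos (s * x)) * dirichlet_kernel n x).
Proof.
rewrite /dirichlet_kernel mulrDr mulr1 mulr_sumr.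
apply: is_deriveD.
  apply: is_deriveB; apply: is_derive_sinZ; exact: lt0r_neq0.
apply: is_derive_bigsum => k.
have -> : (1 - cos (s * x)) * (2 * cos (k.+1%:R * x)) =
    2 * cos (k.+1%:R * x) - cos ((s + k.+1%:R) * x) - cos ((s - k.+1%:R) * x).
  by rewrite [(s + _) * x]mulrDl [(s - _) * x]mulrBl cosD cosB; ring.
apply: is_deriveB; last exact: is_derive_sinZ.
apply: is_deriveB; last exact: is_derive_sinZ.
have := is_deriveZ (2 : R) (@is_derive_sinZ k.+1%:R x _).
rewrite pnatr_eq0 => /(_ isT); apply: is_derive_ext.
by near=> z; rewrite /= /GRing.scale/= mulrA.
Unshelve. all: by end_near. Qed.

Let sinDpi k x : sin (x + k%:R * pi) = (-1) ^+ k * sin x.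
Proof.
elim: k => [|k IH]; first by rewrite mul0r addr0 expr0 mul1r.
by rewrite -natr1 mulrDl mul1r addrA trigo.sinDpi IH exprS mulN1r mulNr.
Qed.

Let gpi n : g n pi = pi - sin (s * pi) / s * cosec_sum n.
Proof.
rewrite /g /cosec_sum [_ / s * _]mulrDr mulr1 opprD addrA; congr (_ + _).
rewrite mulr_sumr -sumrN; apply: eq_bigr => k _.
have -> : sin (k.+1%:R * pi) = 0 :> R.
  by rewrite -[X in sin X]add0r sinDpi sin0 mulr0.
have -> : sin ((s + k.+1%:R) * pi) = (-1) ^+ k.+1 * sin (s * pi).
  by rewrite mulrDl sinDpi.
have -> : sin ((s - k.+1%:R) * pi) = (-1) ^+ k.+1 * sin (s * pi).
  have := sinDpi k.+1 ((s - k.+1%:R) * pi).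
  by rewrite -mulrDl subrK => ->; rewrite mulrA -expr2 sqrr_sign mul1r.
have := sk k; have := sk' k; set m := k.+1%:R => h1 h2.
have h3 : m ^+ 2 - s ^+ 2 != 0.
  by rewrite -oppr_eq0 opprB subr_sqr mulf_neq0.
have h4 : m != 0 by rewrite /m pnatr_eq0.
clearbody m; rewrite exprS; field.
by rewrite h1 h2 h3 h4 lt0r_neq0.
Qed.

(** The sum of the [g j pi] is the integral of 1 - cos (s x) against the Fejer sum. The first factor
    is at most x^2 / 2 and cancels the singularity 36 / x^2, so the integrand lies between 0 and 18
    whatever n is. *)
Lemma cosec_sum_cesaro n :
  0 <= pi - sin (s * pi) / s * ((\sum_(j < n.+1) cosec_sum j) / n.+1%:R) <= 18 * pi / n.+1%:R.
Proof.
pose G x := \sum_(j < n.+1) g j x.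
have dG x : is_derive x (1 : R) G ((1 - cos (s * x)) * \sum_(j < n.+1) dirichlet_kernel j x).
  by rewrite mulr_sumr; apply: is_derive_bigsum => j; exact: is_derive_g.
have cG (x : R) : {for x, continuous G} := is_derive1_continuous (dG x).
have G0 : G 0 = 0.
  apply: big1 => j _; rewrite /g !mulr0 sin0 !mul0r subr0 add0r.
  by apply: big1 => k _; rewrite !mulr0 !sin0 !mulr0 !mul0r !subr0.
have Gpi : G pi = n.+1%:R * (pi - sin (s * pi) / s * ((\sum_(j < n.+1) cosec_sum j) / n.+1%:R)).
  rewrite /G; under eq_bigr do rewrite gpi.
  rewrite sumrB sumr_const card_ord -mulr_sumr -[pi *+ _]mulr_natl.
  have : n.+1%:R != 0 :> R by rewrite pnatr_eq0.
  move: (n.+1%:R) (\sum_(j < n.+1) _) => m S m0; field.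
  by rewrite m0 lt0r_neq0.
have pi0 := @pi_gt0 R.
have K x : 0 < x < pi -> 0 <= (1 - cos (s * x)) * \sum_(j < n.+1) dirichlet_kernel j x <= 18.
  move=> /andP[x0 xpi]; have /andP[T0 T1] := fejer_kernel_bound n.+1 x0 xpi.
  have c1 : 0 <= 1 - cos (s * x) by rewrite subr_ge0 cos_le1.
  rewrite mulr_ge0//=.
  have c2 : 1 - cos (s * x) <= x ^+ 2 / 2.
    have := @cos_ge (s * x); rewrite mulr_ge0 ?(ltW s0) ?(ltW x0)// => /(_ isT).
    have : (s * x) ^+ 2 <= x ^+ 2.
      rewrite ler_pXn2r ?nnegrE ?mulr_ge0 ?(ltW s0) ?(ltW x0)//.
      by rewrite ler_piMl ?(ltW x0) ?(ltW s1).
    by lra.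
  apply: le_trans (ler_pM c1 T0 c2 T1) _.
  rewrite (_ : _ * _ = 18)//; field.
  exact: lt0r_neq0.
have n0 : 0 < n.+1%:R :> R by rewrite ltr0n.
have G1 : 0 <= G pi.
  rewrite -G0; apply: (@derive_ge0_le _ G [::]); rewrite ?(ltW pi0)//.
    by apply: continuous_within => x _; exact: cG.
  move=> x xpi _; eexists; first exact: dG.
  by have /andP[] := K x xpi.
have G2 : G pi <= 18 * pi.
  suff : 18 * 0 - G 0 <= 18 * pi - G pi by rewrite G0 mulr0 subr0 subr_ge0.
  apply: (@derive_ge0_le _ (fun x => 18 * x - G x) [::]); rewrite ?(ltW pi0)//.
    apply: continuous_within => x _; apply: cvgB; last exact: cG.
    by apply: cvgM; [exact: cvg_cst|exact: cvg_id].
  move=> x xpi _; eexists.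
    exact: (is_deriveB (is_deriveZ (18 : R) (is_derive_id x 1)) (dG x)).
  by rewrite /GRing.scale/= mulr1 subr_ge0; have /andP[] := K x xpi.
by rewrite -(pmulr_rge0 _ n0) -Gpi G1/= ler_pdivlMr// mulrC -Gpi.
Qed.

(** Cesaro means only identify the value of the limit; convergence is assumed here and supplied by
    [arc_limit]. *)
Lemma cosec_sum_limit (h : R) : cosec_sum @ \oo --> h -> h = pi * s / sin (s * pi).
Proof.
move=> ch; have := cesaro ch.
set m := arithmetic_mean _ => cm.
have sp0 : 0 < sin (s * pi).
  apply: sin_gt0_pi; rewrite mulr_gt0 ?pi_gt0//=.
  by rewrite -[ltRHS]mul1r ltr_pM2r ?pi_gt0.
suff : pi - sin (s * pi) / s * h = 0.
  move/eqP; rewrite subr_eq0 => /eqP E; rewrite {1}E.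
  by field; rewrite !lt0r_neq0.
have c1 : (fun n => pi - sin (s * pi) / s * m n) @ \oo --> pi - sin (s * pi) / s * h.
  apply: cvgB; first exact: cvg_cst.
  by apply: cvgM; [exact: cvg_cst|exact: cm].
rewrite -(cvg_lim (@Rhausdorff R) c1); apply/(cvg_lim (@Rhausdorff R)).
apply: (@squeeze_cvgr _ _ _ _ (fun=> 0) (fun n => 18 * pi * n.+1%:R^-1)).
- near=> n; rewrite /m /arithmetic_mean /series/=.
  have := cosec_sum_cesaro n; rewrite big_mkord.
  by rewrite [_ / n.+1%:R]mulrC.
- exact: cvg_cst.
- rewrite -[X in _ --> X](mulr0 (18 * pi)); apply: cvgM; first exact: cvg_cst.
  exact: cvg_harmonic.
Unshelve. all: by end_near. Qed.

End cosecant.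

(** * The integral of 1 / (1 + x^q) over the half line *)

Section blowup.
Variables (R : realType) (q : R).
Hypothesis q1 : 1 < q.
Let q0 : 0 < q. Proof. exact: lt_trans q1. Qed.

Lemma geometric_remainder (y : R) n : 1 + y != 0 ->
  (1 + y)^-1 - \sum_(k < n) (- y) ^+ k = (- y) ^+ n / (1 + y).
Proof.
move=> y1; elim: n => [|n IH]; first by rewrite big_ord0 subr0 expr0 mul1r.
by rewrite big_ord_recr/= opprD addrA IH exprS; field.
Qed.

Variable Psi : R -> R.
Hypotheses (Psi0 : Psi 0 = 0) (cPsi : continuous Psi)
  (dPsi : forall x : R, 0 < x -> is_derive x (1 : R) Psi (1 + x `^ q)^-1).

Lemma arc_lt x y : 0 <= x -> x < y -> Psi x < Psi y.
Proof.
move=> x0 xy; apply: (@derive_gt0_lt _ Psi [::]) => //.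
  by apply: continuous_within => z _; exact: cPsi.
move=> z /andP[xz _] _; eexists; first by apply: dPsi; exact: le_lt_trans xz.
by rewrite invr_gt0 ltr_pwDl ?powR_ge0.
Qed.

Let expq (x : R) k : 0 <= x -> x `^ (k%:R * q) = (x `^ q) ^+ k.
Proof. by move=> x0; rewrite mulrC powRrM powR_mulrn// powR_ge0. Qed.

(** Integrates over [0, 1] the geometric expansion of 1 / (1 + x^q) in powers of x^q, whose
    remainder is at most x^(n q). *)
Lemma arc1_series n :
  `|Psi 1 - \sum_(k < n) (-1) ^+ k / (k%:R * q + 1)| <= (n%:R * q + 1)^-1.
Proof.
have kq k : 0 < k%:R * q + 1 :> R by rewrite ltr_wpDl// mulr_ge0 ?(ltW q0).
pose f x := Psi x - \sum_(k < n) (-1) ^+ k / (k%:R * q + 1) * npow (k%:R * q + 1) x.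
pose g x := (n%:R * q + 1)^-1 * npow (n%:R * q + 1) x.
have n0 k : npow (k%:R * q + 1) (0 : R) = 0 by rewrite /npow normr0 powR0// gt_eqF.
have n1 k : npow (k%:R * q + 1) (1 : R) = 1 by rewrite /npow normr1 powR1.
have -> : Psi 1 - \sum_(k < n) (-1) ^+ k / (k%:R * q + 1) = f 1 - f 0.
  rewrite /f Psi0 [X in _ - (_ - X)]big1 => [|k _]; last by rewrite n0 mulr0.
  by rewrite !subr0; under [in RHS]eq_bigr do rewrite n1 mulr1.
have -> : (n%:R * q + 1)^-1 = g 1 - g 0 by rewrite /g n0 n1 mulr0 mulr1 subr0.
apply: derive_norm_le => //.
- apply: continuous_within => x _; apply: cvgB; first exact: cPsi.
  apply: continuous_bigsum => k; apply: cvgM; first exact: cvg_cst.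
  exact: continuous_npow.
- apply: continuous_within => x _; apply: cvgM; first exact: cvg_cst.
  exact: continuous_npow.
move=> x /andP[x0 x1].
have dn k : is_derive x (1 : R) (npow (k%:R * q + 1)) ((k%:R * q + 1) * (x `^ q) ^+ k).
  have h := is_derive1_powR (k%:R * q + 1) x0.
  rewrite -(expq _ (ltW x0)) -[in X in _ * _ `^ X](addrK 1 (k%:R * q)).
  apply: is_derive_ext h; near=> y; rewrite /npow gtr0_norm//.
  by near: y; exact: lt_nbhsr.
exists ((1 + x `^ q)^-1 - \sum_(k < n) (- x `^ q) ^+ k), ((x `^ q) ^+ n); split.
- apply: is_deriveB; first exact: dPsi.
  apply: is_derive_bigsum => k.
  have := is_deriveZ ((-1) ^+ k / (k%:R * q + 1)) (dn k).
  by rewrite /GRing.scale/= mulrA divfK ?gt_eqF// -exprMn mulN1r.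
- by have := is_deriveZ (n%:R * q + 1)^-1 (dn n); rewrite /GRing.scale/= mulKf ?gt_eqF.
have y0 : 0 <= x `^ q by exact: powR_ge0.
have y1 : 0 < 1 + x `^ q by rewrite ltr_pwDl.
rewrite geometric_remainder ?gt_eqF// normrM normrX normrN (ger0_norm y0).
rewrite ler_piMr ?exprn_ge0// ger0_norm ?invr_ge0 ?(ltW y1)//.
by rewrite invf_le1// lerDl.
Unshelve. all: by end_near. Qed.

(** Beyond 1 the expansion is in powers of x^-q, from 1 / (1 + x^q) = x^-q / (1 + x^-q). *)
Lemma arc_tail_series n a : 1 <= a ->
  `|Psi a - Psi 1 - \sum_(k < n) (-1) ^+ k / (k.+1%:R * q - 1) * (1 - a `^ (1 - k.+1%:R * q))|
   <= (n.+1%:R * q - 1)^-1.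
Proof.
move=> a1; have kq k : 0 < k.+1%:R * q - 1 :> R.
  by rewrite subr_gt0; apply: (lt_le_trans q1); rewrite ler_peMl ?(ltW q0)// ler1n.
pose f x := Psi x + \sum_(k < n) (-1) ^+ k / (k.+1%:R * q - 1) * x `^ (1 - k.+1%:R * q).
pose g x := - ((n.+1%:R * q - 1)^-1 * x `^ (1 - n.+1%:R * q)).
have -> : Psi a - Psi 1 - \sum_(k < n) (-1) ^+ k / (k.+1%:R * q - 1) * (1 - a `^ (1 - k.+1%:R * q))
    = f a - f 1.
  rewrite /f; set Sa := \sum_(k < n) _ * a `^ _; set S1 := \sum_(k < n) _ * 1 `^ _.
  have -> : Psi a + Sa - (Psi 1 + S1) = Psi a - Psi 1 + (Sa - S1) by ring.
  congr (_ + _); rewrite /Sa /S1 -sumrN -sumrB; apply: eq_bigr => k _.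
  by rewrite powR1; ring.
apply: (@le_trans _ _ (g a - g 1)); last first.
  rewrite /g powR1 opprK mulr1 addrC gerBl.
  by rewrite mulr_ge0 ?powR_ge0// invr_ge0 ltW.
have dn k (x : R) : 0 < x -> is_derive x (1 : R) (fun x => x `^ (1 - k.+1%:R * q))
    (- (k.+1%:R * q - 1) * (x `^ (- q)) ^+ k.+1).
  move=> x0; have h := is_derive1_powR (1 - k.+1%:R * q) x0.
  apply: (is_derive_eq h); rewrite opprB; congr (_ * _).
  by rewrite -powR_mulrn ?powR_ge0// -powRrM; congr (_ `^ _); ring.
have cpow k (x : R) : 1 <= x -> {for x, continuous (fun x => x `^ (1 - k.+1%:R * q))}.
  by move=> x1; apply: is_derive1_continuous (dn k x (lt_le_trans ltr01 x1)).
apply: derive_norm_le => //.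
- apply: continuous_within => x /=; rewrite in_itv/= => /andP[x1 _]; apply: cvgD; first exact: cPsi.
  apply: continuous_bigsum => k; apply: cvgM; first exact: cvg_cst.
  exact: cpow.
- apply: continuous_within => x /=; rewrite in_itv/= => /andP[x1 _].
  by apply: cvgN; apply: cvgM; [exact: cvg_cst|exact: cpow].
move=> x /andP[x1 _]; have x0 : 0 < x by exact: lt_trans x1.
set y := x `^ (- q); have y0 : 0 < y by rewrite powR_gt0.
exists ((1 + x `^ q)^-1 - \sum_(k < n) (-1) ^+ k * y ^+ k.+1), (y ^+ n.+1); split.
- rewrite -sumrN; apply: is_deriveD; first exact: dPsi.
  apply: is_derive_bigsum => k.
  have := is_deriveZ ((-1) ^+ k / (k.+1%:R * q - 1)) (dn k x x0).
  by rewrite /GRing.scale/= mulNr mulrN mulrA divfK// gt_eqF.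
- have := is_deriveN (is_deriveZ (n.+1%:R * q - 1)^-1 (dn n x x0)).
  by rewrite /GRing.scale/= mulNr mulrN opprK mulKf ?gt_eqF.
have y1 : 0 < 1 + y by rewrite addr_gt0.
have -> : (1 + x `^ q)^-1 = y * (1 + y)^-1.
  by rewrite /y powRN; have := powR_gt0 q x0; set z := x `^ q => z0; field; rewrite !lt0r_neq0// addr_gt0.
have -> : \sum_(k < n) (-1) ^+ k * y ^+ k.+1 = y * \sum_(k < n) (- y) ^+ k.
  rewrite mulr_sumr; apply: eq_bigr => k _.
  by rewrite -[in RHS]mulN1r exprMn exprS mulrCA.
rewrite -mulrBr geometric_remainder ?gt_eqF// !normrM normrX normrN (gtr0_norm y0).
rewrite exprS ler_wpM2l ?(ltW y0)// ler_piMr ?exprn_ge0 ?(ltW y0)//.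
rewrite ger0_norm ?invr_ge0 ?(ltW y1)//.
by rewrite invf_le1// lerDl ltW.
Qed.

Definition arc_end : R := pi / (q * sin (pi / q)).

Let s := q^-1.
Let s0 : 0 < s. Proof. by rewrite invr_gt0. Qed.
Let s1 : s < 1. Proof. by rewrite invf_lt1. Qed.

Lemma cosec_sumE n : cosec_sum s n =
  \sum_(k < n.+1) (-1) ^+ k / (k%:R * q + 1) +
  \sum_(k < n) (-1) ^+ k / (k.+1%:R * q - 1).
Proof.
rewrite /cosec_sum big_ord_recl/= expr0 mul0r add0r invr1 mulr1 -addrA; congr (_ + _).
rewrite -big_split/=; apply: eq_bigr => k _.
have m1 : 1 <= k.+1%:R :> R by rewrite ler1n.
rewrite /bump/= add1n /s; move: (k.+1%:R) m1 => m m1.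
have h1 : 0 < m * q - 1.
  by rewrite subr_gt0; apply: (lt_le_trans q1); rewrite ler_peMl ?(ltW q0).
have h2 : 0 < m * q + 1 by apply: (lt_trans h1); lra.
rewrite [(-1) ^+ k.+1]exprS; move: ((-1) ^+ k) => z; field.
have h3 : (m * q) ^+ 2 - 1 != 0.
  by rewrite -[X in _ - X](expr1n _ 2) subr_sqr mulf_neq0// lt0r_neq0.
by rewrite (lt0r_neq0 h1) (lt0r_neq0 h2) (lt0r_neq0 q0).
Qed.

(** The expansions on the two sides of 1 add up to the partial sums [cosec_sum s] with s = 1 / q, up
    to remainders of order 1 / n. So these partial sums converge to the total integral, and
    [cosec_sum_limit] evaluates it. *)
Lemma arc_limit : Psi (2 ^+ n) @[n --> \oo] --> arc_end.
Proof.
(* Along powers of 2 the boundary terms a^(1 - k q) of the tail expansion form geometric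
   sequences. *)
pose u n := Psi (2 ^+ n).
have pow1 n : 1 <= 2 ^+ n :> R by rewrite exprn_ege1// ler1n.
have und : nondecreasing_seq u.
  apply/nondecreasing_seqP => n; rewrite /u ltW// arc_lt//.
  by rewrite exprS ltr_pMl ?ltr1n// exprn_gt0.
have uub : has_ubound (range u).
  exists (Psi 1 + (q - 1)^-1) => _ [n _ <-].
  have := arc_tail_series 0 (pow1 n); rewrite big_ord0 subr0 mul1r => h.
  by have := le_trans (ler_norm _) h; rewrite /u; lra.
have ul := nondecreasing_cvgn und uub; set L := sup _ in ul.
suff LE : L = arc_end by rewrite -LE.
have tail n : `|L - Psi 1 - \sum_(k < n) (-1) ^+ k / (k.+1%:R * q - 1)| <= (n.+1%:R * q - 1)^-1.
  pose v j := u j - Psi 1 - \sum_(k < n) (-1) ^+ k / (k.+1%:R * q - 1) * (1 - (2 `^ (1 - k.+1%:R * q)) ^+ j).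
  have vb j : `|v j| <= (n.+1%:R * q - 1)^-1.
    rewrite /v; have := arc_tail_series n (pow1 j); rewrite /u.
    have E (z : R) : (2 ^+ j) `^ z = (2 `^ z) ^+ j.
      by rewrite -[2 ^+ j]powR_mulrn// -powRrM mulrC powRrM powR_mulrn ?powR_ge0.
    by under eq_bigr do rewrite E.
  have vl : v @ \oo --> L - Psi 1 - \sum_(k < n) (-1) ^+ k / (k.+1%:R * q - 1).
    apply: cvgB; first by apply: cvgB; [exact: ul|exact: cvg_cst].
    have sumcv (F : 'I_n -> R^nat) (l : 'I_n -> R) : (forall k, F k @ \oo --> l k) ->
        (fun j => \sum_(k < n) F k j) @ \oo --> \sum_(k < n) l k.
      move=> Fl; elim: (index_enum _) => [|k r IH].
        by rewrite big_nil; under eq_fun do rewrite big_nil; exact: cvg_cst.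
      by rewrite big_cons; under eq_fun do rewrite big_cons; exact: cvgD.
    apply: sumcv => k; rewrite -[X in _ --> X]mulr1; apply: cvgM; first exact: cvg_cst.
    rewrite -[X in _ --> X]subr0; apply: cvgB; first exact: cvg_cst.
    apply: cvg_expr; rewrite ger0_norm ?powR_ge0//.
    rewrite -[ltRHS](powRr0 2) /powR pnatr_eq0/= ltr_expR ltr_pM2r ?ln_gt0 ?ltr1n//.
    by rewrite subr_lt0; apply: (lt_le_trans q1); rewrite ler_peMl ?(ltW q0)// ler1n.
  have nl := cvg_norm vl; rewrite -(cvg_lim (@Rhausdorff R) (nl _)).
  by apply: limr_le; [apply/cvg_ex; eexists; exact: (nl _)|exact: nearW].
suff cL : cosec_sum s @ \oo --> L.
  rewrite (cosec_sum_limit s0 s1 cL) /arc_end /s invfM mulrA mulrAC.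
  by rewrite [_ * pi]mulrC mulrAC.
apply/cvgrPdist_le => e e0.
have q10 : 0 < q - 1 by rewrite subr_gt0.
have K0 : 0 < 2 * (q - 1)^-1 by rewrite mulr_gt0// invr_gt0.
near=> n.
have h1 := arc1_series n.+1; have h2 := tail n.
rewrite cosec_sumE.
set S1 := \sum_(k < n.+1) _ in h1 *; set S2 := \sum_(k < n) _ in h2 *.
have -> : L - (S1 + S2) = (L - Psi 1 - S2) + (Psi 1 - S1) by ring.
apply: le_trans (ler_normD _ _) _; apply: le_trans (lerD h2 h1) _.
have n1 : 0 < n.+1%:R :> R by rewrite ltr0n.
have b0 : (q - 1) * n.+1%:R <= n.+1%:R * q - 1.
  by rewrite mulrBl mul1r mulrC lerD2l lerN2 ler1n.
have b1 : (n.+1%:R * q - 1)^-1 <= (q - 1)^-1 / n.+1%:R.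
  by rewrite -invfM lef_pV2// posrE ?(lt_le_trans _ b0) ?mulr_gt0.
have b2 : (n.+1%:R * q + 1)^-1 <= (q - 1)^-1 / n.+1%:R.
  rewrite -invfM lef_pV2// ?posrE ?mulr_gt0//; first by apply: le_trans b0 _; lra.
  by rewrite addr_gt0// mulr_gt0.
apply: le_trans (lerD b1 b2) _; rewrite -mulr2n -[_ *+ 2]mulr_natl mulrA.
rewrite mulrC -ler_pdivlMr// ltW//; near: n.
exact: (near_infty_natSinv_lt (PosNum (divr_gt0 e0 K0))).
Unshelve. all: by end_near. Qed.

End blowup.

(** * The generalised tangent *)

Section generalised_tangent.
Variables (R : realType) (q : R).
Hypothesis q1 : 1 < q.
Let q0 : 0 < q. Proof. exact: lt_trans q1. Qed.

Lemma exists_arc : exists Psi : R -> R,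
  [/\ Psi 0 = 0, continuous Psi &
      forall x : R, 0 < x -> is_derive x (1 : R) Psi (1 + x `^ q)^-1].
Proof.
have npow0 x : 0 <= npow q x by exact: powR_ge0.
have pos x : 0 < 1 + npow q x by rewrite ltr_pwDl.
have hB x : `|(1 + npow q x)^-1| <= 1.
  by rewrite ger0_norm ?invr_ge0 ?(ltW (pos _))// invf_le1// lerDl.
have hc x : x \notin [::] -> {for x, continuous (fun x => (1 + npow q x)^-1)}.
  move=> _; apply: cvgV; first by rewrite gt_eqF.
  by apply: cvgD; [exact: cvg_cst|exact: continuous_npow].
have [Psi [P0 Pc Pd _]] := exists_antiderivative hB hc.
exists Psi; split=> // x x0; have := Pd x x0 isT.
by rewrite /npow gtr0_norm.
Qed.

(** [tau] inverts the arc function [Psi], so it solves tau' = 1 + tau^q and blows up at [arc_end q];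
    for q = 2 it is the tangent, on [0, pi / 2[. *)
Lemma exists_tan : exists Psi tau : R -> R,
  [/\ Psi 0 = 0, (forall x y, 0 <= x -> x < y -> Psi x < Psi y),
      (forall x, 0 <= x -> Psi x < arc_end q /\ Psi x <= x),
      (forall r, 0 <= r < arc_end q -> 0 <= tau r /\ Psi (tau r) = r) &
      (forall r, 0 < r < arc_end q -> is_derive r (1 : R) tau (1 + tau r `^ q))].
Proof.
have [Psi [P0 Pc Pd]] := exists_arc.
have Plt x y : 0 <= x -> x < y -> Psi x < Psi y := arc_lt Pc Pd (x:=x) (y:=y).
have Plim := arc_limit q1 P0 Pc Pd.
have Ple x y : 0 <= x -> x <= y -> Psi x <= Psi y.
  by move=> x0; rewrite le_eqVlt => /predU1P[->//|/Plt h]; exact/ltW/h.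
have big (x : R) : exists n, x < 2 ^+ n.
  exists (Num.bound `|x|); apply: (@lt_trans _ _ (Num.bound `|x|)%:R).
    by apply: le_lt_trans (ler_norm _) (archi_boundP (normr_ge0 x)).
  by rewrite -natrX ltr_nat ltn_expl.
have Pend x : 0 <= x -> Psi x < arc_end q.
  move=> x0; have [n xn] := big x.
  apply: (lt_le_trans (Plt _ _ x0 xn)).
  rewrite -(cvg_lim (@Rhausdorff R) Plim); apply: limr_ge.
    by apply/cvg_ex; eexists; exact: Plim.
  near=> m; apply: Ple; first by rewrite exprn_ge0.
  rewrite ler_eXn2l ?ltr1n//; near: m; exact: nbhs_infty_ge.
have Pid x : 0 <= x -> Psi x <= x.
  move=> x0; suff : 0 - Psi 0 <= x - Psi x by rewrite P0 subrr subr_ge0.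
  apply: (@derive_ge0_le _ (fun x => x - Psi x) [::]) => //.
    by apply: continuous_within => y _; apply: cvgB; [exact: cvg_id|exact: Pc].
  move=> y /andP[y0 _] _; eexists; first exact: (is_deriveB (is_derive_id y 1) (Pd y y0)).
  by rewrite subr_ge0 invf_le1 ?ltr_pwDl ?powR_ge0// lerDl powR_ge0.
have Psurj r : 0 <= r < arc_end q -> exists x, 0 <= x /\ Psi x = r.
  move=> /andP[r0 rE].
  have [n rn] : exists n, r < Psi (2 ^+ n).
    have := cvgr_gt _ Plim _ rE; move=> [n _ H]; exists n; exact: H (leqnn n).
  have [x] : exists2 x, x \in `[0, 2 ^+ n] & Psi x = r.
    apply: IVT; first by rewrite exprn_ge0.
      by apply: continuous_within => y _; exact: Pc.
    by rewrite P0 ge_min le_max r0 (ltW rn) orbT.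
  by rewrite in_itv/= => /andP[x0 _] xr; exists x.
pose tau r := xget 0 [set x | 0 <= x /\ Psi x = r].
have tauP r : 0 <= r < arc_end q -> 0 <= tau r /\ Psi (tau r) = r.
  move=> /Psurj [x xr]; have := @xgetPex _ 0 [set x | 0 <= x /\ Psi x = r].
  by apply; exists x.
have tauK x : 0 <= x -> tau (Psi x) = x.
  move=> x0; have [] := tauP (Psi x).
    by rewrite Pend// andbT -P0 Ple.
  move=> t0 tE; apply/eqP; rewrite eq_le !leNgt; apply/andP; split; apply/negP.
    by move=> /(Plt _ _ x0); rewrite tE ltxx.
  by move=> /(Plt _ _ t0); rewrite tE ltxx.
exists Psi, tau; split=> //; first by move=> x x0; split; [exact: Pend|exact: Pid].
move=> r /andP[r0 rE]; have [] := tauP r; first by rewrite ltW.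
set x := tau r => x0 xr.
have {x0}x0 : 0 < x.
  rewrite lt_neqAle x0 andbT; apply: contraTneq r0 => xE.
  by rewrite -xr -xE P0 ltxx.
rewrite -{1}xr -[_ + _]invrK; apply: is_derive_inverse.
- near=> y; apply: tauK; apply: ltW; near: y; exact: lt_nbhsr.
- by near=> y; exact: Pc.
- exact: Pd.
- by rewrite invr_eq0 gt_eqF// ltr_pwDl ?powR_ge0.
Unshelve. all: by end_near. Qed.

End generalised_tangent.

(** * The Riccati equation *)

Section riccati.
Variables (R : realType) (p q : R).
Hypotheses (p1 : 1 < p) (q1 : 1 < q) (pq : p + q = p * q).
Let p0 : 0 < p. Proof. exact: lt_trans p1. Qed.
Let q0 : 0 < q. Proof. exact: lt_trans q1. Qed.

(** The first eigenvalue of the unit interval with one Dirichlet end; it scales with the power - p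
    of the length. *)
Definition eigen_const : R := (p - 1) * (pi_p p / 2) `^ p.
(* Length of the interval with first eigenvalue [lam]. *)
Definition riccati_len (lam : R) : R := (eigen_const / lam) `^ p^-1.

Lemma sin_pi_div : 0 < sin (pi / p).
Proof.
apply: sin_gt0_pi; rewrite divr_gt0 ?pi_gt0//= ltr_pdivrMr//.
by rewrite ltr_pMr ?pi_gt0.
Qed.

Lemma pi_p_gt0 : 0 < pi_p p.
Proof. by rewrite divr_gt0 ?mulr_gt0 ?pi_gt0 ?sin_pi_div. Qed.

Lemma eigen_const_gt0 : 0 < eigen_const.
Proof. by rewrite mulr_gt0 ?subr_gt0// powR_gt0// divr_gt0 ?pi_p_gt0. Qed.

(** pi / q = pi - pi / p, so the two sines agree. *)
Lemma arc_endE : arc_end q = (p - 1) * (pi_p p / 2).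
Proof.
rewrite /arc_end /pi_p.
have -> : pi / q = pi - pi / p.
  have -> : q^-1 = 1 - p^-1 by rewrite -(conj_inv p1 q1 pq) addrAC subrr add0r.
  by rewrite mulrBr mulr1.
have -> : sin (pi - pi / p) = sin (pi / p).
  by rewrite sinB sinpi cospi mul0r sub0r mulN1r opprK.
have s0 := sin_pi_div; move: (sin _) s0 => s s0.
have qE : q = p / (p - 1).
  have h : p - 1 != 0 by rewrite gt_eqF// subr_gt0.
  by apply: (mulIf h); rewrite divfK// mulrC (conj_subr1l pq).
rewrite qE; field.
by rewrite !lt0r_neq0// subr_gt0.
Qed.

Lemma exists_riccati lam : 0 < lam -> exists A : R -> R,
  [/\ forall r : R, 0 < r < riccati_len lam ->
        is_derive r (1 : R) A (lam + (p - 1) * A r `^ q),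
      forall r : R, 0 <= r < riccati_len lam -> lam * r <= A r,
      forall e : R, 0 < e -> exists2 d : R, 0 < d &
        forall r : R, 0 <= r < d -> r < riccati_len lam -> A r < e &
      forall B : R, exists2 d : R, 0 < d &
        forall r : R, 0 <= r -> riccati_len lam - d < r < riccati_len lam -> B < A r].
Proof.
move=> lam0; have [Psi [tau [P0 Plt Pend tauP tauD]]] := exists_tan q1.
have p10 : 0 < p - 1 by rewrite subr_gt0.
pose a := (lam / (p - 1)) `^ q^-1; pose b : R := lam / a.
have a0 : 0 < a by rewrite powR_gt0// divr_gt0.
have b0 : 0 < b by rewrite divr_gt0.
have ab : a * b = lam by rewrite mulrC divfK// gt_eqF.
have aq : (p - 1) * a `^ q = lam.
  rewrite /a -powRrM mulVf ?gt_eqF// powRr1 ?divr_ge0 ?(ltW lam0) ?(ltW p10)//.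
  by rewrite mulrC divfK// gt_eqF.
have LE : riccati_len lam = arc_end q / b.
  rewrite arc_endE; apply: (@mulIf _ b); first by rewrite gt_eqF.
  rewrite divfK ?(gt_eqF b0)//; set X := pi_p p / 2.
  have X0 : 0 < X by rewrite divr_gt0 ?pi_p_gt0.
  have bE : b = (lam / (p - 1)) `^ p^-1 * (p - 1).
    rewrite /b /a.
    have -> : q^-1 = 1 - p^-1 by rewrite -(conj_inv p1 q1 pq) addrAC subrr add0r.
    have l0 : 0 < lam / (p - 1) by rewrite divr_gt0.
    rewrite powRB ?(gt_eqF l0) ?implybT// powRr1 ?(ltW l0)//.
    have := powR_gt0 p^-1 l0; set z := _ `^ _ => z0; field.
    by rewrite !lt0r_neq0.
  rewrite bE /riccati_len /eigen_const mulrA -powRM ?divr_ge0 ?mulr_ge0 ?powR_ge0 ?(ltW p10) ?(ltW lam0)//.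
  have -> : (p - 1) * X `^ p / lam * (lam / (p - 1)) = X `^ p.
    by field; rewrite !lt0r_neq0.
  by rewrite -powRrM mulfV ?gt_eqF// powRr1 ?(ltW X0)// mulrC.
have rb r : r < riccati_len lam -> r * b < arc_end q by rewrite LE ltr_pdivlMr.
pose A (r : R) := a * tau (r * b).
have mono r x : 0 <= r < riccati_len lam -> 0 <= x -> r * b < Psi x -> tau (r * b) < x.
  move=> /andP[r0 rL] x0 rx; have [] := tauP (r * b); first by rewrite mulr_ge0 ?(ltW b0)//= rb.
  move=> t0 tE; rewrite ltNge; apply/negP; rewrite le_eqVlt => /predU1P[xt|/(Plt _ _ x0)].
    by rewrite xt tE ltxx in rx.
  by rewrite tE => /(lt_trans rx); rewrite ltxx.
exists A; split.
- move=> r /andP[r0 rL].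
  have d := tauD (r * b); rewrite mulr_gt0//= rb// in d.
  have db : is_derive r (1 : R) (fun r => r * b) b.
    have := is_deriveZ b (is_derive_id r 1); rewrite /GRing.scale/= mulr1.
    by apply: is_derive_ext; near=> z; rewrite /= /GRing.scale/= mulrC.
  have := is_deriveZ a (@is_derive1_comp R tau ( *%R^~ b) r _ _ (d isT) db); rewrite /GRing.scale/=.
  have rbP : 0 <= r * b < arc_end q by rewrite mulr_ge0 ?(ltW r0) ?(ltW b0)//= rb.
  have [t0 _] := tauP _ rbP.
  have -> : a * ((1 + tau (r * b) `^ q) * b) = lam + (p - 1) * A r `^ q.
    by rewrite /A powRM ?(ltW a0) ?t0// [X in lam + X]mulrA aq -ab; ring.
  by [].
- move=> r /andP[r0 rL]; have [] := tauP (r * b); first by rewrite mulr_ge0 ?(ltW b0)//= rb.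
  move=> t0 tE; have [_] := Pend _ t0; rewrite tE => h.
  by rewrite /A -ab -mulrA ler_pM2l// mulrC.
- move=> e e0; have ea : 0 < e / a by rewrite divr_gt0.
  have P1 : 0 < Psi (e / a) by rewrite -P0 Plt.
  exists (Psi (e / a) / b); first by rewrite divr_gt0.
  move=> r /andP[r0 rd] rL; rewrite /A mulrC -ltr_pdivlMr//; apply: (mono r).
  + by rewrite r0.
  + exact: ltW.
  + by rewrite -ltr_pdivlMr.
- move=> B; pose x := Num.max 0 (B / a).
  have x0 : 0 <= x by rewrite le_max lexx.
  have [PE _] := Pend _ x0.
  exists ((arc_end q - Psi x) / b); first by rewrite divr_gt0// subr_gt0.
  move=> r r0 /andP[r1 r2].
  have xr : Psi x < r * b.
    by rewrite -ltr_pdivrMr//; move: r1; rewrite LE mulrBl opprB addrCA subrr addr0.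
  have [] := tauP (r * b); first by rewrite mulr_ge0 ?(ltW b0)//= rb.
  move=> t0 tE; suff xt : x < tau (r * b).
    rewrite /A mulrC -ltr_pdivrMr//; apply: le_lt_trans xt.
    by rewrite le_max lexx orbT.
  rewrite ltNge; apply/negP; rewrite le_eqVlt => /predU1P[xt|/(Plt _ _ t0)].
    by rewrite -xt tE ltxx in xr.
  by rewrite tE => /(lt_trans xr); rewrite ltxx.
Unshelve. all: by end_near. Qed.

End riccati.

(** * Functions on an interval *)

Section interval.
Variable R : realType.
Implicit Types (f g F G : R -> R) (a b l x y p q : R).
Local Notation mu := (@lebesgue_measure R).

Lemma within_continuous_integrable f a b :
  {within `[a, b], continuous f} -> mu.-integrable `[a, b] (EFin \o f).
Proof. by move=> cf; apply: continuous_compact_integrable => //; exact: segment_compact. Qed.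

Lemma Rintegral_derive f F a b : a <= b ->
  {within `[a, b], continuous f} -> {within `[a, b], continuous F} ->
  (forall x, a < x < b -> is_derive x (1 : R) F (f x)) ->
  \int[mu]_(x in `[a, b]) f x = F b - F a.
Proof.
rewrite le_eqVlt => /predU1P[<- _ _ _|ab cf cF dF].
  by rewrite set_itv1 Rintegral_set1 subrr.
have H x : x \in `]a, b[ -> is_derive x (1 : R) F (f x).
  by rewrite in_itv/=; exact: dF.
rewrite /Rintegral (@continuous_FTC2 _ f F _ _ ab cf) ?fine_EFin//; last first.
  by move=> x /H[_ dE]; rewrite derive1E.
have [_ cFa cFb] := (continuous_within_itvP _ ab).1 cF.
by split => // x /H[].
Qed.

Lemma Rintegral_oo_cc f a b : {within `[a, b], continuous f} ->
  \int[mu]_(x in `]a, b[) f x = \int[mu]_(x in `[a, b]) f x.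
Proof.
move=> /within_continuous_integrable fi.
rewrite Rintegral_itv_bndo_bndc.
  rewrite Rintegral_itv_obnd_cbnd//.
  by apply: integrableS fi => //; exact: subset_itv_oc_cc.
by apply: integrableS fi => //; exact: subset_itv_oo_cc.
Qed.

Lemma within_continuous_comp (A : set R) f g : continuous g ->
  {within A, continuous f} -> {within A, continuous (fun x => g (f x))}.
Proof. by move=> cg cf x; apply: (@continuous_comp (subspace A) R R f g); [exact: cf|exact: cg]. Qed.

Lemma within_continuous_cst (A : set R) (k : R) : {within A, continuous (fun _ : R => k)}.
Proof. by apply: continuous_subspaceT => x; exact: cvg_cst. Qed.

Lemma within_continuousM (A : set R) f g : {within A, continuous f} ->
  {within A, continuous g} -> {within A, continuous (fun x => f x * g x)}.
Proof. by move=> cf cg x; apply: cvgM; [exact: cf|exact: cg]. Qed.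

Lemma within_continuousD (A : set R) f g : {within A, continuous f} ->
  {within A, continuous g} -> {within A, continuous (fun x => f x + g x)}.
Proof. by move=> cf cg x; apply: cvgD; [exact: cf|exact: cg]. Qed.

Lemma W1p_of_derive p l f g : 0 < p -> 0 < l ->
  {within `[0, l], continuous f} -> {within `[0, l], continuous g} ->
  (forall x, 0 < x < l -> is_derive x (1 : R) f (g x)) -> W1p_interval p l f g.
Proof.
move=> p0 l0 cf cg dfg.
have Lp h : {within `[0, l], continuous h} -> in_Lp p l h.
  move=> ch; split.
    apply: (@measurable_funS _ _ _ _ `[0, l]%classic) => //.
      exact: subset_itv_oo_cc.
    exact: subspace_continuous_measurable_fun.
  have := within_continuous_integrable (within_continuous_comp (continuous_npow p0) ch).
  by apply: integrableS => //; exact: subset_itv_oo_cc.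
split => //; [exact: Lp|exact: Lp|].
move=> phi [dphi cphi [a [b [a0 bl supp]]]].
have cphi1 : {within `[0, l], continuous (derive1 phi)}.
  by apply: continuous_within => x _; exact: cphi.
have cphi0 : {within `[0, l], continuous phi}.
  apply: continuous_within => x _; apply/differentiable_continuous.
  exact/derivable1_diffP.
have c1 := within_continuousM cf cphi1; have c2 := within_continuousM cg cphi0.
rewrite !Rintegral_oo_cc//; apply/eqP; rewrite -addr_eq0; apply/eqP.
rewrite -RintegralD//; [|exact: within_continuous_integrable|exact: within_continuous_integrable].
have dF x : 0 < x < l -> is_derive x (1 : R) (fun x => f x * phi x)
    (f x * phi^`()%classic x + g x * phi x).
  move=> xl; have d1 := dfg x xl.
  have d2 : is_derive x (1 : R) phi (phi^`()%classic x).
    by rewrite derive1E; exact/derivableP/dphi.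
  have := is_deriveM d1 d2; rewrite /GRing.scale/=.
  by rewrite [phi x * _]mulrC.
rewrite (Rintegral_derive (ltW l0) (within_continuousD c1 c2) (within_continuousM cf cphi0) dF).
rewrite !supp ?mulr0 ?subrr// in_itv/= negb_and -!ltNge ?bl ?orbT//.
by rewrite a0.
Qed.

Lemma classical_derivativeP l f g x : classical_derivative l f g -> 0 <= x <= l ->
  forall e, 0 < e -> \forall y \near x, y != x -> 0 <= y <= l ->
    `|(f y - f x) / (y - x) - g x| < e.
Proof.
move=> fg xl e e0; have xl' : x \in `[0, l] by rewrite in_itv.
have FF : Filter (within `[0, l] x^') by exact: within_filter.
have := @cvgr_distC_lt _ _ _ _ FF _ _ (fg x xl') e e0.
rewrite near_withinE /dnbhs near_withinE.
by apply: (@filterS _ _ (nbhs_filter x)) => y H yx yl; apply: H => //=; rewrite in_itv.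
Qed.

Lemma classical_derivative_continuous l f g : classical_derivative l f g ->
  {within `[0, l], continuous f}.
Proof.
move=> fg; apply/subspace_continuousP => x /=; rewrite in_itv/= => xl.
have FF : Filter (within `[0, l] (nbhs x)) by exact: within_filter.
apply/cvgrPdistC_lt => e e0; rewrite near_withinE.
have d0 : 0 < e / (`|g x| + 1) by rewrite divr_gt0// ltr_wpDl.
have H := classical_derivativeP fg xl ltr01.
near=> y; rewrite /= in_itv/= => yl.
have [->|yx] := eqVneq y x; first by rewrite subrr normr0.
have h1 : `|(f y - f x) / (y - x) - g x| < 1.
  by move: yx yl; near: y.
have h2 : `|(f y - f x) / (y - x)| < `|g x| + 1.
  have -> : (f y - f x) / (y - x) = g x + ((f y - f x) / (y - x) - g x).
    by rewrite addrCA subrr addr0.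
  by rewrite (le_lt_trans (ler_normD _ _))// ltrD2l.
have h3 : 0 < `|y - x| by rewrite normr_gt0 subr_eq0.
rewrite -[f y - f x](@divfK _ (y - x)) ?subr_eq0// normrM.
apply: (@lt_trans _ _ ((`|g x| + 1) * `|y - x|)); first by rewrite ltr_pM2r.
rewrite mulrC -ltr_pdivlMr ?ltr_wpDl//.
Unshelve. all: by end_near. Qed.

Lemma classical_derivative_is_derive l f g x : classical_derivative l f g ->
  0 < x < l -> is_derive x (1 : R) f (g x).
Proof.
move=> fg /andP[x0 xl].
apply/is_derive1_caratheodory.
exists (fun y => if y == x then g x else (f y - f x) / (y - x)); split.
- move=> y; have [->|yx] := eqVneq y x; first by rewrite !subrr mulr0.
  by rewrite divfK// subr_eq0.
- apply/cvgrPdistC_lt => e e0.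
  have H := classical_derivativeP fg _ e0.
  near=> y; rewrite eqxx; have [_|yx] := eqVneq y x; first by rewrite subrr normr0.
  have yl : 0 <= y <= l.
    by apply/andP; split; apply/ltW; near: y; [exact: lt_nbhsr|exact: lt_nbhsl].
  move: yx yl; near: y; apply: H.
  by rewrite !ltW.
- by rewrite eqxx.
Unshelve. all: by end_near. Qed.

Lemma is_derive_classical l f g : (forall x, 0 <= x <= l -> is_derive x (1 : R) f (g x)) ->
  classical_derivative l f g.
Proof.
move=> dfg x; rewrite in_itv/= => /dfg /is_derive1_caratheodory [h [fE hc hx]].
rewrite -hx; have FF : Filter (within `[0, l] x^') by exact: within_filter.
apply/cvgrPdistC_lt => e e0; rewrite near_withinE /dnbhs near_withinE.
have := @cvgr_distC_lt _ _ _ _ (nbhs_filter x) _ _ hc e e0.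
apply: (@filterS _ _ (nbhs_filter x)) => y H yx _; rewrite fE mulfK//.
by rewrite subr_eq0.
Qed.

End interval.

(** * The torsion function *)

Section minimisation.
Variable R : realType.

Lemma matrix_eq_closed (n m : nat) (B : 'M[R]_(n, m)) (b : 'rV[R]_m) :
  closed [set c : 'rV[R]_n | c *m B = b].
Proof.
rewrite (_ : [set c | _] = \bigcap_(j in [set: 'I_m])
    [set c : 'rV[R]_n | \sum_i c 0 i * B i j = b 0 j]); last first.
  apply/seteqP; split => c /= H.
    by move=> j _ /=; rewrite -H mxE.
  by apply/rowP => j; rewrite mxE; exact: H.
apply: closed_bigI => j _.
apply: (@preimage_closed _ _ (fun c : 'rV[R]_n => \sum_i c 0 i * B i j) [set b 0 j]).
  move=> c _; apply: continuous_bigsum => i.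
  apply: continuousM; [exact: coord_continuous|exact: cst_continuous].
exact/accessible_closed_set1/hausdorff_accessible/Rhausdorff.
Qed.

(** Linear growth confines the problem to a compact box. At a minimiser the vector of the [F i] is
    orthogonal to all directions [d] with d B = 0, hence lies in the row space of B^T; its
    coordinates [y] are Lagrange multipliers. *)
Lemma convex_minimiser (n m : nat) (B : 'M[R]_(n, m)) (b : 'rV[R]_m)
    (Phi F : 'I_n -> R -> R) (a k : 'I_n -> R) :
  (b <= B)%MS ->
  (forall i x, is_derive x (1 : R) (Phi i) (F i x)) ->
  (forall i, 0 < a i) -> (forall i x, a i * `|x| - k i <= Phi i x) ->
  exists (c : 'rV[R]_n) (y : 'I_m -> R),
    c *m B = b /\ forall i, F i (c 0 i) = \sum_j B i j * y j.
Proof.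
move=> /submxP[c0 bE] dPhi a0 aPhi.
pose E (c : 'rV[R]_n) := \sum_i Phi i (c 0 i).
have cE : continuous E.
  move=> c; apply: continuous_bigsum => i.
  apply: (@continuous_comp _ _ _ (fun c : 'rV[R]_n => c 0 i) (Phi i)).
    exact: coord_continuous.
  exact: is_derive1_continuous (dPhi i _).
pose K := \sum_i `|k i|.
have KE (c : 'rV[R]_n) i : a i * `|c 0 i| <= E c + K.
  rewrite /E /K -big_split/= (bigD1 i)//=; apply: (@le_trans _ _ (Phi i (c 0 i) + `|k i|)).
    by rewrite -lerBlDr; apply: le_trans (aPhi i (c 0 i)); rewrite lerD2l lerN2 ler_norm.
  rewrite lerDl sumr_ge0// => j _; rewrite -lerBlDr sub0r.
  apply: le_trans (aPhi j (c 0 j)); rewrite -[leLHS]add0r lerD//.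
    by rewrite mulr_ge0 ?(ltW (a0 j)).
  by rewrite lerN2 ler_norm.
pose box i : set R := `[- ((E c0 + K) / a i), (E c0 + K) / a i]%classic.
pose A := [set c : 'rV[R]_n | forall i, box i (c ord0 i)] `&` [set c | c *m B = b].
have inA (c : 'rV[R]_n) : c *m B = b -> E c <= E c0 -> A c.
  move=> cB cE0; split=> //= i; rewrite /box /= in_itv/= -ler_norml ler_pdivlMr// mulrC.
  by apply: le_trans (KE c i) _; rewrite lerD2r.
have cA : compact A.
  apply: compact_closedI; last exact: matrix_eq_closed.
  by apply: rV_compact => i; exact: segment_compact.
have [||c cAc cmin] := @EVT_min_rV R n E A _ cA.
- by exists c0; apply: inA.
- by apply: continuous_subspaceT => x; exact: cE.
have cB : c *m B = b by move: cAc; rewrite inE => -[].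
have cglob (d : 'rV[R]_n) : d *m B = 0 -> E c <= E (c + d).
  move=> dB; have [h|/ltW h] := leP (E (c + d)) (E c0); last first.
    by apply: le_trans h; apply: cmin; rewrite inE; apply: inA.
  by apply: cmin; rewrite inE; apply: inA => //; rewrite mulmxDl dB addr0.
have ortho (d : 'rV[R]_n) : d *m B = 0 -> \sum_i d 0 i * F i (c 0 i) = 0.
  move=> dB; pose f t := \sum_i Phi i (c 0 i + t * d 0 i).
  have df t : is_derive t (1 : R) f (\sum_i d 0 i * F i (c 0 i + t * d 0 i)).
    apply: is_derive_bigsum => i.
    have d1 : is_derive t (1 : R) (fun t => c 0 i + t * d 0 i) (d 0 i).
      have := is_deriveD (is_derive_const (c 0 i) t) (is_deriveZ (d 0 i) (is_derive_id t 1)).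
      rewrite add0r /GRing.scale/= mulr1; apply: is_derive_ext; near=> z.
      by rewrite /= /GRing.scale/= fctE/= mulrC.
    have := @is_derive1_comp R (Phi i) (fun t => c 0 i + t * d 0 i) t _ _ (dPhi i _) d1.
    by rewrite mulrC.
  have fE t : f t = E (c + t *: d).
    by apply: eq_bigr => i _; rewrite !mxE.
  have : is_derive (0 : R) (1 : R) f 0.
    apply: (@derive1_at_min R f (-1) 1 0) => //.
    - by rewrite in_itv/= ltrN10 ltr01.
    - move=> t _; rewrite !fE scale0r addr0; apply: cglob.
      by rewrite -scalemxAl dB scaler0.
  move=> [_ h1]; have [_ h2] := df 0; rewrite -[RHS]h1 h2.
  by apply: eq_bigr => i _; rewrite mul0r addr0.
pose Fr : 'rV[R]_n := \row_i F i (c 0 i).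
(* The columns of the cokernel of B^T are directions to which [ortho] applies. *)
have : (Fr <= B^T)%MS.
  rewrite submxE; apply/eqP/matrixP => i j; rewrite ord1 mxE [RHS]mxE.
  pose d : 'rV[R]_n := (col j (cokermx B^T))^T.
  have dB : d *m B = 0.
    apply: trmx_inj; rewrite trmx_mul trmxK trmx0.
    by rewrite colE mulmxA mulmx_coker mul0mx.
  rewrite -[RHS](ortho d dB); apply: eq_bigr => i' _.
  by rewrite !mxE mulrC.
move=> /submxP[y Fy]; exists c, (fun j => y 0 j); split=> // i.
have := congr1 (fun M : 'rV[R]_n => M 0 i) Fy; rewrite !mxE => ->.
by apply: eq_bigr => j _; rewrite !mxE mulrC.
Unshelve. all: by end_near. Qed.

End minimisation.

(** * Torsion fluxes and existence of the torsion function *)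

Section torsion.
Variables (R : realType) (G : metric_graph R) (VD : {set vertex G}).
Variables (p q : R).
Hypotheses (p1 : 1 < p) (q1 : 1 < q) (pq : p + q = p * q).
Implicit Types (c : edge G -> R) (f : vertex G -> R).

Let p0 : 0 < p. Proof. exact: lt_trans p1. Qed.
Let q0 : 0 < q. Proof. exact: lt_trans q1. Qed.

(* A torsion flux is [c e - x] on the edge [e]; this is the weak form of the
   Kirchhoff conditions off [VD]. *)
Definition flow_balance c := forall f, (forall v, v \in VD -> f v = 0) ->
  \sum_e (c e * f (src e) + (len e - c e) * f (tgt e)) = 0.

(** The sum over the edges of the integrals of |c e - x|^q. *)
Definition dual_energy c :=
  \sum_e (npow_int q (c e) - npow_int q (c e - len e)).

Lemma sum_vertex (a : edge G -> R) (s : edge G -> vertex G) f :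
  \sum_e a e * f (s e) = \sum_v f v * \sum_(e | s e == v) a e.
Proof.
rewrite (partition_big s predT)//=; apply: eq_bigr => v _.
by rewrite mulr_sumr; apply: eq_bigr => e /eqP ->; rewrite mulrC.
Qed.

Lemma kirchhoff_balance c :
  (forall v, v \notin VD ->
    \sum_(e | src e == v) c e + \sum_(e | tgt e == v) (len e - c e) = 0) ->
  flow_balance c.
Proof.
move=> H f f0; rewrite big_split/= !sum_vertex -big_split/=.
apply: big1 => v _; rewrite -mulrDr; have [/f0 ->|/H ->] := boolP (v \in VD).
  by rewrite mul0r.
by rewrite mulr0.
Qed.

Lemma continuous_flux (r : R) : 1 < r -> continuous (@flux R r).
Proof.
move=> r1 x; have pos (y : R) : 0 < y -> {for y, continuous (@flux R r)}.
  move=> y0; have d := is_derive1_powR (r - 1) y0.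
  apply: (@is_derive1_continuous _ _ _ ((r - 1) * y `^ (r - 1 - 1))).
  apply: is_derive_ext d; near=> z; rewrite flux_gt0//.
  by near: z; exact: lt_nbhsr.
have [x0|x0|->] := ltgtP x 0; [|exact: pos|].
  have -> : @flux R r = (fun x => - flux r (- x)).
    by apply/funext => y; rewrite fluxN opprK.
  have h : {for x, continuous (fun x => flux r (- x))}.
    apply: (@continuous_comp _ _ _ (fun x : R => - x) (@flux R r)).
      exact: (is_derive1_continuous (is_deriveNid x 1)).
    by apply: pos; rewrite oppr_gt0.
  exact: (continuousN h).
suff h : flux r x @[x --> (0 : R)] --> (0 : R) by rewrite -{2}(flux0 r) in h.
apply: norm_cvg0; under eq_fun do rewrite (normr_flux _ r1).
have := @continuous_npow R (r - 1) _ 0; rewrite subr_gt0 => /(_ r1).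
by rewrite /continuous_at {2}/npow normr0 powR0// gt_eqF// subr_gt0.
Unshelve. all: by end_near. Qed.

Lemma torsion_flow w : is_torsion p VD w -> exists c,
  flow_balance c /\ graph_integral w = dual_energy c.
Proof.
move=> [dw [[W1 [uv [uv0 uvl uvD]]] cw cf kir]].
pose c e := flux p (dw e 0); exists c.
have fluxE e x : 0 <= x <= len e -> flux p (dw e x) = c e - x.
  move=> /andP[x0 xl].
  have cont : {within `[0, x], continuous (fun y => flux p (dw e y) + y)}.
    apply: within_continuousD; last by apply: continuous_within => z _; exact: cvg_id.
    apply: continuous_subspaceW (classical_derivative_continuous (cf e)).
    by apply: subset_itvl; rewrite bnd_simp.
  have d0 y : 0 < y < x -> is_derive y (1 : R) (fun y => flux p (dw e y) + y) 0.
    move=> /andP[y0 yx].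
    have h : 0 < y < len e by rewrite y0 (lt_le_trans yx).
    have := is_deriveD (classical_derivative_is_derive (cf e) h) (is_derive_id y 1).
    by rewrite addNr.
  have : `|flux p (dw e x) + x - (flux p (dw e 0) + 0)| <= 0 - 0.
    apply: (@derive_norm_le _ (fun y => flux p (dw e y) + y) (fun=> 0)) => //.
      by apply: continuous_within => z _; exact: cvg_cst.
    move=> y /d0 h; exists 0, 0; split; [exact: h|exact: is_derive_const|].
    by rewrite normr0.
  rewrite subrr normr_le0 addr0 subr_eq0 => /eqP E.
  by rewrite /c -E addrK.
have wint e : \int[lebesgue_measure]_(x in `[0, len e]) w e x =
    (npow_int q (c e) - npow_int q (c e - len e)) +
    (c e * uv (src e) + (len e - c e) * uv (tgt e)).
  have l0 := len_gt0 e.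
  (* F' = |c - x|^q + w - (c - x) w', and (c - x) w' = |c - x|^q. *)
  pose F x := - npow_int q (c e - x) - (c e - x) * w e x.
  have cwe := classical_derivative_continuous (cw e).
  have dc x : is_derive x (1 : R) (fun x => c e - x) (- 1).
    by have := is_deriveB (is_derive_const (c e) x) (is_derive_id x 1); rewrite sub0r.
  have cc (x : R) : {for x, continuous (fun x => c e - x)} := is_derive1_continuous (dc x).
  have cF : {within `[0, len e], continuous F}.
    rewrite /F => x; apply: cvgB.
      apply: cvgN.
      have c1 : continuous (fun x => npow_int q (c e - x)).
        move=> y; apply: (@continuous_comp _ _ _ (fun x => c e - x) (npow_int q)); first exact: cc.
        exact: is_derive1_continuous (is_derive_npow_int _ q0).
      exact: (continuous_subspaceT c1).
    have c2 : {within `[0, len e], continuous (fun x => (c e - x) * w e x)}.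
      by apply: within_continuousM => //; apply: continuous_subspaceT => y; exact: cc.
    exact: c2.
  have dF x : 0 < x < len e -> is_derive x (1 : R) F (w e x).
    move=> /andP[x0 xl]; have xl' : 0 <= x <= len e by rewrite !ltW.
    have d1 := @is_derive1_comp R (npow_int q) (fun x => c e - x) x _ _ (is_derive_npow_int _ q0) (dc x).
    have d2 : is_derive x (1 : R) (w e) (dw e x).
      by apply: (classical_derivative_is_derive (cw e)); rewrite x0.
    have := is_deriveB (is_deriveN d1) (is_deriveM (dc x) d2).
    rewrite /GRing.scale/= mulrN1 mulrN1 opprK.
    have -> : dw e x = flux q (c e - x).
      by rewrite -fluxE// fluxK// addrC pq mulrC.
    have -> : npow q (c e - x) = (c e - x) * flux q (c e - x).
      have [->|z0] := eqVneq (c e - x) 0.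
        by rewrite mul0r /npow normr0 powR0 ?gt_eqF.
      rewrite /flux mulrCA -expr2 -real_normK ?num_real// -powR_mulrn//.
      by rewrite -powRD ?normr_eq0 ?z0 ?implybT//; congr (_ `^ _); ring.
    by rewrite opprD opprK addrA subrr add0r.
  rewrite (Rintegral_derive (ltW l0) cwe cF dF).
  by rewrite /F uv0 uvl !subr0; ring.
have bal : flow_balance c.
  apply: kirchhoff_balance => v /kir kv; rewrite -[RHS]kv /kirchhoff; congr (_ + _).
  apply: eq_bigr => e _; rewrite fluxN fluxE ?lexx ?ltW ?len_gt0//.
  by rewrite opprB.
split => //; rewrite /graph_integral (eq_bigr _ (fun e _ => wint e)) big_split/=.
by rewrite (bal uv uvD) addr0.
Qed.

Hypothesis hconn : connected_graph G.

Lemma connected_ind (P : pred (vertex G)) v0 : P v0 ->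
  (forall e : edge G, P (src e) = P (tgt e)) -> forall v, P v.
Proof.
move=> P0 H v; have /connectP[s ps ->] := hconn v0 v.
elim: s v0 P0 ps => //= x s IH v0 P0 /andP[/existsP[e J] ps]; apply: IH ps.
by case/orP: J => /andP[/eqP E1 /eqP E2]; move: P0 (H e); rewrite -E1 -E2 => -> .
Qed.

(** Solves the dual problem: minimise the q-energy of the flux among balanced fluxes. The
    multipliers of the Kirchhoff constraints are, up to sign, the vertex values of [w], and
    stationarity says that the edgewise primitives of flux q (c e - x) fit together at the
    vertices. *)
Lemma exists_torsion : VD != finset.set0 -> exists w, is_torsion p VD w.
Proof.
move=> /set0Pn[v0 v0D].
pose n := #|edge G|; pose m := #|vertex G|.
pose ev (i : 'I_n) : edge G := enum_val i; pose vv (j : 'I_m) : vertex G := enum_val j.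
(* This factor annihilates the columns of Dirichlet vertices, where no balance is imposed; the
   corresponding vertex values are then 0. *)
pose N j : R := (vv j \notin VD)%:R.
pose B : 'M[R]_(n, m) := \matrix_(i, j)
  (N j * ((src (ev i) == vv j)%:R - (tgt (ev i) == vv j)%:R)).
pose b : 'rV[R]_m := \row_j (- (N j * \sum_(e | tgt e == vv j) len e)).
pose Phi (i : 'I_n) (x : R) := q^-1 * (npow_int q x - npow_int q (x - len (ev i))).
pose F (i : 'I_n) (x : R) := q^-1 * (npow q x - npow q (x - len (ev i))).
have evE (A : edge G -> R) : \sum_i A (ev i) = \sum_e A e.
  by rewrite [RHS](reindex_onto (enum_val : 'I_n -> _) enum_rank) => [|e _];
     [apply: eq_bigl => i; rewrite enum_valK eqxx|rewrite enum_rankK].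
have vvE (A : vertex G -> R) : \sum_j A (vv j) = \sum_v A v.
  by rewrite [RHS](reindex_onto (enum_val : 'I_m -> _) enum_rank) => [|e _];
     [apply: eq_bigl => i; rewrite enum_valK eqxx|rewrite enum_rankK].
have delta (y : vertex G -> R) v : \sum_v' (v == v')%:R * y v' = y v.
  rewrite (bigD1 v)//= eqxx mul1r big1 ?addr0// => v' /negPf v'v.
  by rewrite eq_sym v'v mul0r.
pose M (y : 'I_m -> R) v : R := (v \notin VD)%:R * y (enum_rank v).
have BM y i : \sum_j B i j * y j = M y (src (ev i)) - M y (tgt (ev i)).
  transitivity (\sum_j ((src (ev i) == vv j)%:R * M y (vv j) -
      (tgt (ev i) == vv j)%:R * M y (vv j))).
    apply: eq_bigr => j _; rewrite mxE /M /N /vv enum_valK; ring.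
  have D v : \sum_j (v == vv j)%:R * M y (vv j) = M y v.
    exact: etrans (vvE (fun v' => (v == v')%:R * M y v')) (delta _ v).
  by rewrite sumrB !D.
(* The constraint can be met: a vertex function killed by [B] is constant along edges and 0 on [VD],
   hence 0 by connectedness. *)
have bB : (b <= B)%MS.
  rewrite submxE; apply/eqP/rowP => k; rewrite [RHS]mxE mxE.
  pose y j := cokermx B j k.
  have By i : M y (src (ev i)) = M y (tgt (ev i)).
    apply/eqP; rewrite -subr_eq0 -BM; apply/eqP.
    have := congr1 (fun A : 'M[R]_(n, m) => A i k) (mulmx_coker B).
    by rewrite !mxE.
  have My v : M y v = 0.
    apply/eqP; apply: (connected_ind (P := fun v => M y v == 0) (v0 := v0)).
      by rewrite /M v0D mul0r.
    by move=> e; have := By (enum_rank e); rewrite /ev enum_rankK => ->.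
  apply: big1 => j _; rewrite mxE.
  have := My (vv j); rewrite /M /vv enum_valK -/(vv j) -/(N j) /y => E.
  by rewrite mulNr mulrAC E mul0r oppr0.
have dPhi i x : is_derive x (1 : R) (Phi i) (F i x).
  have dl : is_derive x (1 : R) (fun x => x - len (ev i)) 1.
    by have := is_deriveB (is_derive_id x 1) (is_derive_const (len (ev i)) x); rewrite subr0.
  have d1 := @is_derive1_comp R (npow_int q) _ x _ _ (is_derive_npow_int _ q0) dl.
  have := is_deriveZ q^-1 (is_deriveB (is_derive_npow_int x q0) d1).
  by rewrite mulr1.
pose a i := q^-1 * len (ev i).
have a0 i : 0 < a i by rewrite mulr_gt0 ?invr_gt0 ?len_gt0.
pose k i := a i * (len (ev i) + 1).
(* On the edge |x - y| >= |x| - l, and t^q >= t - 1 for t >= 0; integrating over the edge gives the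
   linear growth. *)
have aPhi i x : a i * `|x| - k i <= Phi i x.
  rewrite /k /a -!mulrA -mulrBr ler_pM2l ?invr_gt0//.
  set l := len (ev i); have l0 : 0 < l by exact: len_gt0.
  have dl (y : R) : is_derive y (1 : R) (fun y => x - y) (- 1).
    by have := is_deriveB (is_derive_const x y) (is_derive_id y 1); rewrite sub0r.
  pose z := `|x| - (l + 1).
  have dF (y : R) : is_derive y (1 : R) (fun y => - npow_int q (x - y) - z * y)
      (npow q (x - y) - z).
    have d1 := @is_derive1_comp R (npow_int q) (fun y => x - y) y _ _ (is_derive_npow_int _ q0) (dl y).
    have := is_deriveB (is_deriveN d1) (is_deriveZ z (is_derive_id y 1)).
    by rewrite mulrN1 opprK /GRing.scale/= mulr1.
  have : - npow_int q (x - 0) - z * 0 <= - npow_int q (x - l) - z * l.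
    apply: (@derive_ge0_le _ (fun y => - npow_int q (x - y) - z * y) [::]); rewrite ?(ltW l0)//.
      by apply: continuous_within => y _; exact: is_derive1_continuous (dF y).
    move=> y /andP[y0 yl] _; eexists; first exact: dF.
    rewrite subr_ge0 /z /npow.
    have h : `|x| - l <= `|x - y|.
      have := ler_normD (x - y) y; rewrite subrK (gtr0_norm y0); lra.
    have [h1|h1] := leP 1 `|x - y|.
      by apply: le_trans (le1r_powR h1 (ltW q1)); lra.
    by apply: le_trans (powR_ge0 _ _); lra.
  by rewrite subr0 mulr0 /z mulrC; lra.
have [c [y [cB Fy]]] := convex_minimiser bB dPhi a0 aPhi.
pose ce e := c 0 (enum_rank e).
pose uv v := - M y v.
have kirE v : v \notin VD ->
    \sum_(e | src e == v) ce e + \sum_(e | tgt e == v) (len e - ce e) = 0.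
  move=> vD; have := congr1 (fun A : 'rV[R]_m => A 0 (enum_rank v)) cB.
  rewrite !mxE /N /vv enum_rankK vD mul1r sumrB addrCA.
  have -> : \sum_i c 0 i * B i (enum_rank v) =
      \sum_(e | src e == v) ce e - \sum_(e | tgt e == v) ce e.
    rewrite !(big_mkcond (fun e => _ == v)) -sumrB/= -evE; apply: eq_bigr => i _.
    rewrite mxE /N /vv enum_rankK vD mul1r mulrBr /ce /ev enum_valK.
    by do 2!case: eqP => _; rewrite ?mulr1 ?mulr0.
  by move=> ->; rewrite subrr.
have Fe e : q^-1 * (npow q (ce e) - npow q (ce e - len e)) = uv (tgt e) - uv (src e).
  have := Fy (enum_rank e); rewrite BM /F /ev enum_rankK => ->.
  by rewrite /uv opprK addrC.
pose w e x := uv (src e) + q^-1 * (npow q (ce e) - npow q (ce e - x)).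
pose dw e x := flux q (ce e - x).
have dc e (x : R) : is_derive x (1 : R) (fun x => ce e - x) (- 1).
  by have := is_deriveB (is_derive_const (ce e) x) (is_derive_id x 1); rewrite sub0r.
have dwE e (x : R) : is_derive x (1 : R) (w e) (dw e x).
  have d1 := @is_derive1_comp R (npow q) _ x _ _ (is_derive_npow _ q1) (dc e x).
  have := is_deriveD (is_derive_const (uv (src e)) x)
    (is_deriveZ q^-1 (is_deriveB (is_derive_const (npow q (ce e)) x) d1)).
  by rewrite add0r sub0r mulrN1 opprK /GRing.scale/= mulKf ?gt_eqF.
have fluxdw e x : flux p (dw e x) = ce e - x.
  by rewrite /dw fluxK// addrC pq mulrC.
exists w, dw; split.
- split.
    move=> e; apply: W1p_of_derive; rewrite ?len_gt0//.
      by apply: continuous_within => x _; exact: is_derive1_continuous (dwE e x).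
    apply: continuous_subspaceT => x.
    apply: (@continuous_comp _ _ _ (fun x => ce e - x) (@flux R q)).
      exact: is_derive1_continuous (dc e x).
    exact: continuous_flux.
  exists uv; split.
  + by move=> e; rewrite /w subr0 subrr mulr0 addr0.
  + by move=> e; rewrite /w Fe addrC subrK.
  + by move=> v vD; rewrite /uv /M vD mul0r oppr0.
- by move=> e; apply: is_derive_classical => x _; exact: dwE.
- move=> e; apply: is_derive_classical => x _.
  by rewrite (_ : (fun x => _) = (fun x => ce e - x))//; apply/funext => z; rewrite fluxdw.
- move=> v vD; rewrite /kirchhoff -[RHS](kirE v vD); congr (_ + _).
    by apply: eq_bigr => e _; rewrite fluxdw subr0.
  by apply: eq_bigr => e _; rewrite fluxN fluxdw opprB.
Qed.

End torsion.

(** * Sobolev functions on an interval *)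

Section triangular_bump.
Variable R : realType.
Implicit Types (a b h x y : R).

Lemma is_derive_shift (f : R -> R) k x df : is_derive (x - k) (1 : R) f df ->
  is_derive x (1 : R) (fun x => f (x - k)) df.
Proof.
move=> d; have dk : is_derive x (1 : R) (fun x => x - k) 1.
  by have := is_deriveB (is_derive_id x 1) (is_derive_const k x); rewrite subr0.
by have := @is_derive1_comp R f (fun x => x - k) x _ _ d dk; rewrite mulr1.
Qed.

Lemma continuous_shift (f : R -> R) k : continuous f -> continuous (fun x => f (x - k)).
Proof.
move=> cf x; apply: (@continuous_comp _ _ _ (fun x => x - k) f); last exact: cf.
by apply: cvgB; [exact: cvg_id|exact: cvg_cst].
Qed.

Definition pos_part x : R := Num.max 0 x.

Lemma continuous_pos_part : continuous pos_part.
Proof.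
move=> x; apply: (@continuous_maxr _ (fun=> 0) id); [exact: cvg_cst|exact: cvg_id].
Qed.

Lemma is_derive_pos_part_sqr x :
  is_derive x (1 : R) (fun x => x * pos_part x) (2 * pos_part x).
Proof.
have [x0|x0|->] := ltgtP x 0.
- rewrite /pos_part max_l ?(ltW x0)// mulr0.
  apply: (@is_derive_ext _ (fun=> 0)).
  near=> y; rewrite max_l ?mulr0// ltW//; near: y; exact: lt_nbhsl.
- rewrite /pos_part max_r ?(ltW x0)//.
  apply: (@is_derive_ext _ (fun y => y * y)).
    near=> y; rewrite max_r// ltW//; near: y; exact: lt_nbhsr.
  have := is_deriveM (is_derive_id x 1) (is_derive_id x 1).
  by rewrite /GRing.scale/= mulr1 mulr_natl mulr2n.
- rewrite /pos_part maxxx mulr0; apply/is_derive1_caratheodory; exists pos_part; split.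
  + by move=> z; rewrite mul0r !subr0 mulrC.
  + exact: continuous_pos_part.
  + by rewrite /pos_part maxxx.
Unshelve. all: by end_near. Qed.

(* Triangular bump on [0, 2h], and its antiderivative, which is 0 for x <= 0
   and 1 for x >= 2h. *)
Definition tri h x := (pos_part x - 2 * pos_part (x - h) + pos_part (x - 2 * h)) / h ^+ 2.
Definition tri_int h x := (x * pos_part x - 2 * ((x - h) * pos_part (x - h)) +
  (x - 2 * h) * pos_part (x - 2 * h)) / (2 * h ^+ 2).

Variable h : R.
Hypothesis h0 : 0 < h.

Lemma tri_ge0 x : 0 <= tri h x.
Proof.
rewrite divr_ge0 ?exprn_ge0 ?(ltW h0)// /pos_part.
case: (leP 0 x) => h1; case: (leP 0 (x - h)) => h2; case: (leP 0 (x - 2 * h)) => h3;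
  move: h0 h1 h2 h3; lra.
Qed.

Lemma tri_out x : x <= 0 \/ 2 * h <= x -> tri h x = 0.
Proof.
rewrite /tri /pos_part => -[] H.
  by rewrite !max_l ?mulr0 ?subrr ?addr0 ?mul0r//; move: h0 H; lra.
by rewrite !max_r; [|move: h0 H; lra..]; rewrite (_ : _ + _ = 0) ?mul0r//; ring.
Qed.

Lemma is_derive_tri_int x : is_derive x (1 : R) (tri_int h) (tri h x).
Proof.
have sh k := is_derive_shift (is_derive_pos_part_sqr (x - k)).
have d := is_deriveZ (2 * h ^+ 2)^-1 (is_deriveD (is_deriveB (is_derive_pos_part_sqr x)
  (is_deriveZ (2 : R) (sh h))) (sh (2 * h))).
have -> : tri h x = (2 * h ^+ 2)^-1 * (2 * pos_part x - 2 * (2 * pos_part (x - h)) +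
    2 * pos_part (x - 2 * h)).
  by rewrite /tri; field; exact: lt0r_neq0.
by apply: is_derive_ext d; near=> z; rewrite /= /GRing.scale/= mulrC.
Unshelve. all: by end_near. Qed.

Lemma continuous_tri : continuous (tri h).
Proof.
have c k := @continuous_shift pos_part k continuous_pos_part.
move=> x; apply: cvgM; last exact: cvg_cst.
apply: cvgD; last exact: c.
apply: cvgB; first exact: continuous_pos_part.
by apply: cvgM; [exact: cvg_cst|exact: c].
Qed.

Lemma tri_int_le0 x : x <= 0 -> tri_int h x = 0.
Proof.
move=> x0; rewrite /tri_int /pos_part !max_l ?mulr0 ?subrr ?addr0 ?mul0r//; move: h0; lra.
Qed.

Lemma tri_int_ge1 x : 2 * h <= x -> tri_int h x = 1.
Proof.
move=> x0; rewrite /tri_int /pos_part !max_r; [|move: h0; lra..].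
by field; exact: lt0r_neq0.
Qed.

Lemma tri_int_homo : {homo tri_int h : x y / x <= y}.
Proof.
move=> x y xy; apply: (@derive_ge0_le _ (tri_int h) [::]) => //.
  by apply: continuous_within => z _; exact: is_derive1_continuous (is_derive_tri_int z).
by move=> z _ _; eexists; [exact: is_derive_tri_int|exact: tri_ge0].
Qed.

End triangular_bump.

Section sobolev.
Variable R : realType.
Implicit Types (f g : R -> R) (a b l x y p : R).
Local Notation mu := (@lebesgue_measure R).

Lemma integrable_oo_cc f a b :
  mu.-integrable `]a, b[ (EFin \o f) -> mu.-integrable `[a, b] (EFin \o f).
Proof.
move=> /integrableP[mf If]; apply/integrableP.
have mf' : measurable_fun `[a, b] (EFin \o f).
  by apply/emeasurable_fun_itv_obnd_cbndP/emeasurable_fun_itv_bndo_bndcP.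
split => //; rewrite -integral_itv_obnd_cbnd; last first.
  by apply: measurableT_comp => //; exact/emeasurable_fun_itv_obnd_cbndP.
rewrite -integral_itv_bndo_bndc//.
by apply: measurableT_comp => //; exact/emeasurable_fun_itv_bndo_bndcP.
Qed.

Lemma integrable_cst k a b : mu.-integrable `[a, b] (EFin \o (fun _ : R => k)).
Proof. by apply: within_continuous_integrable; exact: within_continuous_cst. Qed.

Lemma in_Lp_integrable p l f : 1 <= p -> in_Lp p l f ->
  mu.-integrable `]0, l[ (EFin \o (fun x => `|f x|)).
Proof.
move=> p1 [mf fi].
have i1 : mu.-integrable `]0, l[ (EFin \o (fun x => 1 + `|f x| `^ p)).
  rewrite (_ : _ \o _ = (fun x => (1%:E + (`|f x| `^ p)%:E)%E)); last by apply/funext.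
  apply: integrableD => //.
  by apply: integrableS (integrable_cst 1 0 l) => //; exact: subset_itv_oo_cc.
apply: le_integrable i1 => //.
  by apply/measurable_EFinP; apply: measurableT_comp.
move=> x _ /=; rewrite lee_fin normr_id [leRHS]ger0_norm ?addr_ge0 ?powR_ge0//.
have [h1|/ltW h1] := leP 1 `|f x|; last by apply: le_trans h1 _; rewrite lerDl powR_ge0.
by apply: le_trans (le1r_powR h1 p1) _; rewrite lerDr.
Qed.

Lemma bump_average f h a l e : 0 < h -> 0 <= a -> a + 2 * h <= l ->
  {within `[0, l], continuous f} -> forall z,
  (forall x, a <= x <= a + 2 * h -> `|f x - z| <= e) ->
  `|\int[mu]_(x in `[0, l]) (f x * tri h (x - a)) - z| <= e.
Proof.
move=> h0 a0 ahl cf z fz.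
have l0 : 0 <= l by move: h0 a0 ahl; lra.
have ct : {within `[0, l], continuous (fun x => tri h (x - a))}.
  by apply: continuous_subspaceT; apply: continuous_shift; exact: continuous_tri.
have c1 := within_continuousM cf ct.
have cst := @within_continuous_cst R `[0, l].
have c2 := within_continuousM (cst z) ct; have c3 := within_continuousM (cst e) ct.
have dT x := is_derive_shift (is_derive_tri_int h0 (x - a)).
have mass k : \int[mu]_(x in `[0, l]) (k * tri h (x - a)) = k.
  have dk x : 0 < x < l -> is_derive x (1 : R) (fun x => k * tri_int h (x - a)) (k * tri h (x - a)).
    by move=> _; exact: (is_deriveZ k (dT x)).
  have cI : {within `[0, l], continuous (fun x => k * tri_int h (x - a))}.
    apply: within_continuousM => //; apply: continuous_subspaceT => x.
    exact: is_derive1_continuous (dT x).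
  rewrite (Rintegral_derive l0 (within_continuousM (cst k) ct) cI dk).
  by rewrite tri_int_ge1 ?tri_int_le0 ?mulr1 ?mulr0 ?subr0//; move: h0 a0 ahl; lra.
have I := within_continuous_integrable.
rewrite -[X in _ - X](mass z) -RintegralB//; [|exact: I|exact: I].
under eq_Rintegral do rewrite -mulrBl.
have c4 : {within `[0, l], continuous (fun x => (f x - z) * tri h (x - a))}.
  by apply: within_continuousM => //; exact: (within_continuousD cf).
apply: le_trans (le_normr_Rintegral _ _) _ => //; first exact: I.
rewrite -[leRHS](mass e); apply: le_Rintegral => //.
- by apply: integrable_norm; exact: I c4.
- exact: I.
move=> x _; rewrite normrM (ger0_norm (tri_ge0 h0 _)).
have [/fz|] := boolP (a <= x <= a + 2 * h); first by apply: ler_wpM2r; exact: tri_ge0.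
rewrite negb_and -!ltNge => /orP H; rewrite tri_out ?mulr0//.
by case: H => H; [left|right]; move: H; lra.
Qed.

(** The weak derivative is tested with a C^1 approximation of the indicator of ]a, b[. Its
    derivative is a bump near [a] minus a bump near [b], and the averages of [f] against these bumps
    are close to f a and f b by continuity. *)
Lemma W1p_increment p l f g a b : 1 < p -> W1p_interval p l f g ->
  0 <= a -> a < b -> b <= l ->
  `|f b - f a| <= \int[mu]_(x in `]a, b[) `|g x|.
Proof.
move=> p1 [cf _ [mg ig] wd] a0 ab bl.
have l0 : 0 < l by apply: le_lt_trans (lt_le_trans ab bl).
have ig1 := in_Lp_integrable (ltW p1) (conj mg ig).
have iab : mu.-integrable `]a, b[ (EFin \o (fun x => `|g x|)).
  apply: integrableS ig1 => //.
  by apply: subset_itv; rewrite bnd_simp.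
apply/ler_addgt0Pl => e e0.
have e20 : 0 < e / 2 by rewrite divr_gt0.
have xc y : 0 <= y <= l -> exists2 d : R, 0 < d &
    forall x, 0 <= x <= l -> `|x - y| < d -> `|f x - f y| <= e / 2.
  move=> yl; have yl' : `[0, l]%classic y by rewrite /= in_itv.
  have FF : Filter (within `[0, l] (nbhs y)) by exact: within_filter.
  have /subspace_continuousP/(_ y yl') cy := cf.
  have := @cvgr_dist_lt _ _ _ _ FF _ _ cy _ e20.
  rewrite near_withinE => -[d /= d0 H]; exists d => // x xl xy.
  by apply: ltW; rewrite distrC; apply: H; rewrite /= ?in_itv//= distrC.
have [|da da0 Ha] := xc a; first by rewrite a0 (le_trans (ltW ab)).
have [|db db0 Hb] := xc b; first by rewrite bl (le_trans a0 (ltW ab)).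
(* The factor 8 leaves room for two disjoint bumps of width 2 h, each at distance h from its end of
   the interval. *)
pose h := Num.min (Num.min da db) (b - a) / 8.
have h0 : 0 < h by rewrite divr_gt0// !lt_min da0 db0 subr_gt0 ab.
have h1 : 8 * h <= da by rewrite /h mulrC divfK// !ge_min lexx.
have h2 : 8 * h <= db by rewrite /h mulrC divfK// !ge_min lexx orbT.
have h3 : 8 * h <= b - a by rewrite /h mulrC divfK// ge_min lexx orbT.
pose a1 := a + h; pose b1 := b - 3 * h.
pose phi x := tri_int h (x - a1) - tri_int h (x - b1).
have dphi x : is_derive x (1 : R) phi (tri h (x - a1) - tri h (x - b1)).
  by apply: is_deriveB; apply: is_derive_shift; exact: is_derive_tri_int.
have dphiE : derive1 phi = (fun x => tri h (x - a1) - tri h (x - b1)).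
  by apply/funext => x; rewrite derive1E; have [_ ->] := dphi x.
have ctk k := @continuous_shift R (tri h) k (@continuous_tri R h).
have supp x : x \notin `[a1, b1 + 2 * h] -> phi x = 0.
  rewrite in_itv/= negb_and -!ltNge => /orP[H|H]; rewrite /phi.
    by rewrite !tri_int_le0 ?subrr//; move: H; rewrite /a1 /b1; move: h0 h3; lra.
  by rewrite !tri_int_ge1 ?subrr//; move: H; rewrite /a1 /b1; move: h0 h3; lra.
have phi01 x : 0 <= phi x <= 1.
  rewrite /phi; apply/andP; split.
    by rewrite subr_ge0; apply: tri_int_homo => //; rewrite /a1 /b1; move: h0 h3; lra.
  have t1 y : 0 <= tri_int h y <= 1.
    have m0 : Num.min 0 y <= 0 by rewrite ge_min lexx.
    have m1 : 2 * h <= Num.max (2 * h) y by rewrite le_max lexx.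
    rewrite -[X in X <= _ <= _](tri_int_le0 h0 m0) -[X in _ <= _ <= X](tri_int_ge1 h0 m1).
    by rewrite !tri_int_homo// ?ge_min ?le_max ?lexx ?orbT.
  have /andP[_ u1] := t1 (x - a1); have /andP[u2 _] := t1 (x - b1).
  by move: u1 u2; lra.
have tphi : test_function l phi.
  split.
  - by move=> x; have [] := dphi x.
  - by rewrite dphiE => x; apply: cvgB; exact: ctk.
  - by exists a1, (b1 + 2 * h); split => //; rewrite /a1 /b1; move: h0 h3 a0 bl; lra.
have cW k : {within `[0, l], continuous (fun x => tri h (x - k))}.
  by apply: continuous_subspaceT; exact: ctk.
have I := within_continuous_integrable.
have cd : {within `[0, l], continuous (fun x => tri h (x - a1) - tri h (x - b1))}.
  by apply: continuous_subspaceT => x; apply: cvgB; exact: ctk.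
have := wd phi tphi; rewrite dphiE (Rintegral_oo_cc (within_continuousM cf cd)).
under eq_Rintegral do rewrite mulrBr.
rewrite RintegralB//; [|exact: I (within_continuousM cf (cW a1))|exact: I (within_continuousM cf (cW b1))].
have [A1 A2 A3 A4] : [/\ 0 <= a1, a1 + 2 * h <= l, 0 <= b1 & b1 + 2 * h <= l].
  by rewrite /a1 /b1; split; move: h0 h3 a0 bl; lra.
have Ba : `|\int[mu]_(x in `[0, l]) (f x * tri h (x - a1)) - f a| <= e / 2.
  apply: bump_average => // x /andP[x1 x2]; apply: Ha.
    by move: x1 x2 A1 A2; lra.
  rewrite ger0_norm; move: x1 x2; rewrite /a1; move: h0 h1; lra.
have Bb : `|\int[mu]_(x in `[0, l]) (f x * tri h (x - b1)) - f b| <= e / 2.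
  apply: bump_average => // x /andP[x1 x2]; apply: Hb.
    by move: x1 x2 A3 A4; lra.
  rewrite ler0_norm; move: x1 x2; rewrite /b1; move: h0 h2; lra.
move=> E.
have mphi : measurable_fun `]0, l[ phi.
  apply: (@measurable_funS _ _ _ _ setT) => //.
  apply: continuous_measurable_fun => x; exact: is_derive1_continuous (dphi x).
have igphi : mu.-integrable `]0, l[ (EFin \o (fun x => g x * phi x)).
  apply: le_integrable ig1 => //.
    by apply/measurable_EFinP; exact: measurable_funM.
  move=> x _ /=; rewrite lee_fin normr_id normrM.
  have /andP[u1 u2] := phi01 x.
  by rewrite ler_piMr// ger0_norm.
have G1 : `|\int[mu]_(x in `]0, l[) (g x * phi x)| <= \int[mu]_(x in `]a, b[) `|g x|.
  apply: le_trans (le_normr_Rintegral _ _) _ => //.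
  rewrite [leRHS]Rintegral_mkcond [leLHS]Rintegral_mkcond; apply: le_Rintegral => //.
  - rewrite -restrict_EFin; apply/integrable_restrict => //=; rewrite setTI.
    exact: (integrable_norm igphi).
  - by rewrite -restrict_EFin; apply/integrable_restrict => //=; rewrite setTI.
  move=> x _; rewrite /patch; case: ifPn => xl; last by case: ifPn => _; rewrite ?normr_ge0 ?lexx.
  case: ifPn => [_|xab].
    rewrite normrM; have /andP[u1 u2] := phi01 x.
    by rewrite ler_piMr// ger0_norm.
  rewrite supp ?mulr0 ?normr0//; apply: contra xab; rewrite inE/= !in_itv/= /a1 /b1.
  by move=> /andP[x1 x2]; move: x1 x2 h0; lra.
have aux (X Y Z V fa fb : R) : X - Y = - Z -> `|X - fa| <= e / 2 ->
    `|Y - fb| <= e / 2 -> `|Z| <= V -> `|fb - fa| <= e + V.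
  rewrite -(normrN Z) => <- Xa Yb XY; rewrite (_ : fb - fa = (X - fa) - (Y - fb) - (X - Y)); last by ring.
  apply: le_trans (ler_normB _ _) _; apply: lerD => //.
  by apply: le_trans (ler_normB _ _) _; rewrite [leRHS]splitr lerD.
exact: aux E Ba Bb G1.
Qed.

(** Jensen's inequality, by integrating p z^(p-1) |g| <= |g|^p + (p - 1) z^p with [z] the absolute
    mean slope. *)
Lemma W1p_energy p q l f g a b : 1 < p -> 1 < q -> p + q = p * q ->
  W1p_interval p l f g -> 0 <= a -> a < b -> b <= l ->
  (`|f b - f a| / (b - a)) `^ p * (b - a) <= \int[mu]_(x in `]a, b[) (`|g x| `^ p).
Proof.
move=> p1 q1 pq W a0 ab bl; have Inc := W1p_increment p1 W a0 ab bl.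
have [_ _ [mg ig] _] := W.
have ba0 : 0 < b - a by rewrite subr_gt0.
set z := `|f b - f a| / (b - a); have z0 : 0 <= z by rewrite divr_ge0// ltW.
have sub : `]a, b[%classic `<=` `]0, l[%classic by apply: subset_itv; rewrite bnd_simp.
have igp : mu.-integrable `]a, b[ (EFin \o (fun x => `|g x| `^ p)).
  by apply: integrableS ig.
have cint k : mu.-integrable `]a, b[ (EFin \o (fun _ : R => k)).
  apply: integrableS (integrable_cst k a b) => //; exact: subset_itv_oo_cc.
have ig1 : mu.-integrable `]a, b[ (EFin \o (fun x => `|g x|)).
  exact: integrableS (in_Lp_integrable (ltW p1) (conj mg ig)).
have lenE k : \int[mu]_(x in `]a, b[) (fun=> k) x = k * (b - a).
  rewrite Rintegral_cst//= lebesgue_measure_itv/= lte_fin ab.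
  by rewrite -EFinB.
have : \int[mu]_(x in `]a, b[) (p * z `^ (p - 1) * `|g x|) <=
    \int[mu]_(x in `]a, b[) (`|g x| `^ p + (p - 1) * z `^ p).
  apply: le_Rintegral => //.
  - rewrite (_ : _ \o _ = (fun x => ((p * z `^ (p - 1))%:E * (`|g x|)%:E)%E)); last by apply/funext.
    exact: integrableZl.
  - rewrite (_ : _ \o _ = (fun x => ((`|g x| `^ p)%:E + ((p - 1) * z `^ p)%:E)%E)); last by apply/funext.
    by apply: integrableD => //; exact: cint.
  move=> x _; have := young p1 q1 pq (normr_ge0 (g x)) (powR_ge0 z (p - 1)).
  by rewrite -powRrM (conj_subr1l pq) mulrAC -mulrA.
rewrite RintegralZl// RintegralD//.
rewrite (lenE ((p - 1) * z `^ p)) => H.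
have H2 : p * z `^ (p - 1) * (z * (b - a)) <= p * z `^ (p - 1) * \int[mu]_(x in `]a, b[) `|g x|.
  rewrite ler_wpM2l ?mulr_ge0 ?powR_ge0 ?(ltW (lt_trans _ p1))//.
  by rewrite /z divfK ?gt_eqF.
have zE : z `^ (p - 1) * z = z `^ p by rewrite mulrC mulr_powRB1// (lt_trans _ p1).
have := le_trans H2 H; rewrite mulrA -[p * _ * z]mulrA zE.
by set I := \int[mu]_(_ in _) _; move: (z `^ p) (b - a) => u v; lra.
Qed.

End sobolev.

(** * Subdivided graphs *)

Section subdivision.
Variables (R : realType) (G : metric_graph R) (VD : {set vertex G}).
Variables (p q : R).
Hypotheses (p1 : 1 < p) (q1 : 1 < q) (pq : p + q = p * q).
Hypotheses (hconn : connected_graph G) (VD0 : VD != finset.set0).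

(* Each edge is cut into [N] segments of equal length; [Y e i] is the value of
   a piecewise affine function at the [i]-th node of [e]. *)
Definition node_values (N : nat) (Y : edge G -> nat -> R) : Prop :=
  (forall e i, 0 <= Y e i) /\
  exists yv : vertex G -> R, [/\ forall e, Y e 0%N = yv (src e),
    forall e, Y e N = yv (tgt e) & forall v, v \in VD -> yv v = 0].

(* A half-edge [h] is the edge [h.1] seen from one of its ends. *)
Definition half_end (h : edge G * bool) := if h.2 then tgt h.1 else src h.1.

(* The end [h2] can be reached from [VD] without using the edge of [h1]. *)
Definition detour (h1 h2 : edge G * bool) : Prop :=
  forall P : pred (vertex G), (forall v, v \in VD -> P v) ->
    (forall e, e != h1.1 -> P (src e) = P (tgt e)) -> P (half_end h2).

(* The part of [dual_energy q c] carried by the third of [h.1] next to [h]. *)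
Definition third_dual (c : edge G -> R) (h : edge G * bool) : R :=
  if h.2 then npow_int q (c h.1 - len h.1 * (2 / 3)) - npow_int q (c h.1 - len h.1)
  else npow_int q (c h.1) - npow_int q (c h.1 - len h.1 / 3).

Section segments.
Variables (N : nat) (Y : edge G -> nat -> R) (c : edge G -> R).
Hypotheses (N0 : (0 < N)%N) (HY : node_values N Y)
  (Ydist : forall (e : edge G) i, (i < N)%N -> Y e i != Y e i.+1)
  (hc : flow_balance VD c).

Definition seg : finType := (edge G * 'I_N)%type.
Implicit Types (s : seg) (t : R) (e : edge G).

Definition mesh (e : edge G) : R := len e / N%:R.
Definition seg_lo s := Num.min (Y s.1 s.2) (Y s.1 s.2.+1).
Definition seg_hi s := Num.max (Y s.1 s.2) (Y s.1 s.2.+1).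
Definition seg_len s := mesh s.1.
(** The flux seen from the lower end: where the values decrease along the edge, the segment is read
    backwards and the flux changes sign. *)
Definition seg_flux s := if Y s.1 s.2 < Y s.1 s.2.+1
  then c s.1 - mesh s.1 * s.2%:R else mesh s.1 * s.2.+1%:R - c s.1.

Lemma mesh_gt0 e : 0 < mesh e.
Proof. by rewrite divr_gt0 ?len_gt0// ltr0n. Qed.

Lemma meshN e : mesh e * N%:R = len e.
Proof. by rewrite divfK// pnatr_eq0 -lt0n. Qed.

Lemma seg_lo_ge0 s : 0 <= seg_lo s.
Proof. by rewrite le_min !HY.1. Qed.

Lemma seg_lo_lt s : seg_lo s < seg_hi s.
Proof.
rewrite /seg_lo /seg_hi; have := Ydist s.1 (ltn_ord s.2).
by rewrite neq_lt => /orP[h|h]; rewrite gt_min !lt_max ?h ?orbT.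
Qed.

Definition height : R := \big[Num.max/0]_s seg_hi s.

Lemma seg_hi_height s : seg_hi s <= height.
Proof. by rewrite /height (bigmax_sup s). Qed.

Lemma exists_edge : (exists e : edge G, True) \/ (seg -> False).
Proof.
have [/card_gt0P[e _]|] := ltnP 0 #|edge G|; first by left; exists e.
by rewrite leqn0 => /eqP/card0_eq E; right=> -[e i]; have := E e; rewrite inE.
Qed.

Lemma height_attained e : exists s, seg_hi s = height.
Proof.
have s0 : seg := (e, Ordinal N0).
rewrite /height (bigmax_eq_arg _ s0)//; last first.
  by move=> s _; apply: le_trans (seg_lo_ge0 s) (ltW (seg_lo_lt s)).
by eexists.
Qed.

Lemma seg_telescope (F : edge G -> nat -> R) :
  \sum_(s : seg) (F s.1 s.2 - F s.1 s.2.+1) = \sum_e (F e 0%N - F e N).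
Proof.
rewrite -(pair_big predT predT (fun e (i : 'I_N) => F e i - F e i.+1))/=.
apply: eq_bigr => e _; rewrite -(big_mkord predT (fun i => F e i - F e i.+1)).
by rewrite -opprB -telescope_sumr// -sumrN; apply: eq_bigr => i _; rewrite opprB.
Qed.

(** The inner nodes telescope. What remains is the balance tested with the indicator of the vertices
    above level [t], which vanishes on [VD] because t > 0. *)
Lemma seg_flow t : 0 < t ->
  \sum_s (seg_flux s * (t < seg_lo s)%R%:R +
    (seg_len s - seg_flux s) * (t < seg_hi s)%R%:R) = 0.
Proof.
move=> t0; have [yv [Y0 YN YD]] := HY.2.
pose F e i := (c e - mesh e * i%:R) * (t < Y e i)%R%:R.
transitivity (\sum_(s : seg) (F s.1 s.2 - F s.1 s.2.+1)).
  apply: eq_bigr => -[e i] _; rewrite /seg_flux /seg_lo /seg_hi /seg_len /F/=.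
  rewrite -natr1; have := Ydist e (ltn_ord i); rewrite neq_lt => /orP[h|h].
    by rewrite h min_l ?max_r ?(ltW h)//; ring.
  by rewrite ltNge (ltW h)/= min_r ?max_l ?(ltW h)//; ring.
rewrite seg_telescope -[RHS](hc (f := fun v => (t < yv v)%R%:R)); last first.
  by move=> v /YD ->; rewrite ltNge (ltW t0).
apply: eq_bigr => e _; rewrite /F mulr0 subr0 Y0 YN meshN; ring.
Qed.

(** [npow_int] is odd, so reading a segment backwards does not change its dual energy. *)
Lemma seg_dual (X : pred seg) (k : edge G -> nat -> bool) :
  (forall s, X s = k s.1 s.2) ->
  \sum_s (X s)%:R * (npow_int q (seg_flux s) - npow_int q (seg_flux s - seg_len s)) =
  \sum_(s : seg) (k s.1 s.2)%:R * (npow_int q (c s.1 - mesh s.1 * s.2%:R) -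
    npow_int q (c s.1 - mesh s.1 * s.2.+1%:R)).
Proof.
move=> Xk; apply: eq_bigr => -[e i] _; rewrite Xk /seg_flux /seg_len/=; congr (_ * _).
case: ifP => _; first by congr (_ - npow_int q _); rewrite -natr1; ring.
rewrite -[c e - _]opprB npow_intN -[c e - mesh e * i.+1%:R]opprB npow_intN addrC opprK.
by congr (- npow_int q _ + _); rewrite -natr1; ring.
Qed.

Lemma seg_dual_energy :
  \sum_s (npow_int q (seg_flux s) - npow_int q (seg_flux s - seg_len s)) = dual_energy q c.
Proof.
have := @seg_dual xpredT (fun _ _ => true) (fun=> erefl).
under eq_bigr do rewrite mul1r; move=> ->; under eq_bigr do rewrite mul1r.
rewrite (@seg_telescope (fun e i => npow_int q (c e - mesh e * i%:R))).
by apply: eq_bigr => e _; rewrite mulr0 subr0 meshN.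
Qed.

Local Notation levels := (levels seg_lo seg_hi).
Local Notation crossing := (crossing seg_lo seg_hi).

Lemma same_side t e (a b : nat) : (a <= b)%N -> (b <= N)%N -> t \notin levels ->
  (forall i : 'I_N, (a <= i < b)%N -> ~~ crossing (e, i) t) ->
  (t < Y e a) = (t < Y e b).
Proof.
move=> ab bN tl; elim: b ab bN => [|b IH] ab bN H.
  by move: ab; rewrite leqn0 => /eqP ->.
move: ab; rewrite leq_eqVlt => /predU1P[->//|ab].
rewrite IH//; [|exact: ltnW|]; last first.
  by move=> i /andP[ai ib]; apply: H; rewrite ai ltnW.
have := H (Ordinal bN); rewrite /= ltnSn andbT => /(_ ab).
have [] := levelsP tl (e, Ordinal bN).
rewrite /crossing /seg_lo /seg_hi/=.
rewrite gt_min lt_max; case: (ltgtP t (Y e b)) => h1; case: (ltgtP t (Y e b.+1)) => h2 //=.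
all: rewrite /Num.min /Num.max ?h1 ?h2 ?ltxx ?eqxx//.
all: try by case: ifP; rewrite ?eqxx.
Qed.

(** Without crossings the indicator of {u > t} would be constant along every edge and 0 on [VD],
    hence 0 everywhere by connectedness, against t < height. *)
Lemma seg_cross t : 0 < t < height -> t \notin levels -> exists s, crossing s t.
Proof.
move=> /andP[t0 tM] tl; apply: contrapT => nc.
have nc' s : ~~ crossing s t by apply/negP => cs; apply: nc; exists s.
have [yv [Y0 YN YD]] := HY.2.
have side e b : (b <= N)%N -> (t < Y e 0%N) = (t < Y e b).
  by move=> bN; apply: same_side.
have /set0Pn[v0 v0D] := VD0.
have all_low v : ~~ (t < yv v).
  apply: (connected_ind hconn (P := fun v => ~~ (t < yv v)) (v0 := v0)).
    by rewrite YD// -leNgt ltW.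
  by move=> e; rewrite -Y0 -YN (side e N).
have [[e _]|E] := exists_edge; last first.
  by move: tM; rewrite ltNge bigmax_le ?(ltW t0)// => s; have := E s.
have [s sM] := height_attained e.
move: tM; rewrite -sM /seg_hi lt_max -!side ?ltn_ord// ?(ltnW (ltn_ord _))//.
by rewrite Y0 (negbTE (all_low _)).
Qed.


Lemma seg_super_dual : dual_energy q c = super_dual q seg_lo seg_hi seg_len seg_flux 0.
Proof.
rewrite super_dual0 ?seg_dual_energy// => s; [exact: seg_lo_ge0|exact: seg_lo_lt|].
exact: mesh_gt0.
Qed.

Lemma subdivided_ge (lam : R) : 0 < lam ->
  ((q + 1) * dual_energy q c) `^ (q + 1)^-1 < riccati_len p lam ->
  (exists e : edge G, True) ->
  lam * \sum_s seg_len s * seg_lo s `^ p <=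
    \sum_s slope seg_lo seg_hi seg_len s `^ p * seg_len s.
Proof.
move=> lam0 Hr [e _]; have [A [dA A_ge _ _]] := exists_riccati p1 q1 pq lam0.
apply: (@segments_ge R p q p1 q1 pq seg seg_lo seg_hi seg_len seg_flux height
  seg_lo_ge0 seg_lo_lt seg_hi_height (fun s => mesh_gt0 s.1)
  (height_attained e) (fun t (t0 : 0 < t) _ => seg_flow t0) seg_cross _ lam _ A seg_super_dual lam0 dA _ Hr).
by move=> r /andP[r0 rL]; apply: A_ge; rewrite (ltW r0).
Qed.

(** * Thirds of edges whose levels are all attained twice *)

Section gap.
Variable k : nat.
Hypothesis Nk : N = (3 * k)%N.
Implicit Types h : edge G * bool.

(* The third of the edge [h.1] next to its end [h.2]. *)
Definition third h : pred seg := fun s =>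
  (s.1 == h.1) && (if h.2 then 2 * k <= s.2 else s.2 < k)%N.

Let k0 : (0 < k)%N. Proof. by move: N0; rewrite Nk muln_gt0. Qed.

Lemma third_dualE h : super_dual_on q seg_lo seg_hi seg_len seg_flux (third h) 0 =
  third_dual c h.
Proof.
pose K (e : edge G) i := (e == h.1) && (if h.2 then 2 * k <= i else i < k)%N.
transitivity (\sum_s (third h s)%:R * (npow_int q (seg_flux s) -
    npow_int q (seg_flux s - seg_len s))).
  apply: eq_bigr => s _; rewrite level_pos_below ?seg_lo_ge0 ?subr0//.
    exact: seg_lo_lt.
  by move=> s'; exact: mesh_gt0.
rewrite (@seg_dual (third h) K)//.
pose B (i : nat) := npow_int q (c h.1 - mesh h.1 * i%:R).
transitivity (\sum_(s : seg) (s.1 == h.1)%:R *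
    (B (if h.2 then maxn s.2 (2 * k) else minn s.2 k) -
     B (if h.2 then maxn s.2.+1 (2 * k) else minn s.2.+1 k))).
  apply: eq_bigr => -[e i] _; rewrite /K/=; case: eqP => [->|_]; last by rewrite !mul0r.
  rewrite mul1r /B; case: (h.2).
    have [H|] := boolP (2 * k <= i)%N; rewrite ?mul1r ?mul0r.
      by rewrite (maxn_idPl H) (maxn_idPl (leqW H)).
    by rewrite -ltnNge => H; rewrite (maxn_idPr (ltnW H)) (maxn_idPr H) subrr.
  have [H|] := boolP (i < k)%N; rewrite ?mul1r ?mul0r.
    by rewrite (minn_idPl (ltnW H)) (minn_idPl H).
  by rewrite -leqNgt => H; rewrite (minn_idPr H) (minn_idPr (leqW H)) subrr.
under eq_bigr do rewrite mulrBr.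
rewrite (@seg_telescope (fun e i => (e == h.1)%:R *
  B (if h.2 then maxn i (2 * k) else minn i k))).
rewrite (bigD1 h.1)//= eqxx !mul1r big1 ?addr0 => [|e /negbTE ->]; last by rewrite !mul0r subrr.
have N1 : (2 * k <= N)%N by rewrite Nk leq_mul2r orbT.
have N2 : (k <= N)%N by rewrite Nk leq_pmull.
have kE : mesh h.1 * k%:R = len h.1 / 3.
  by rewrite -meshN Nk natrM; field.
rewrite /third_dual /B; case: (h.2).
  rewrite max0n (maxn_idPl N1) meshN natrM mulrCA kE.
  by congr (npow_int q (_ - _) - _); ring.
by rewrite min0n (minn_idPr N2) kE mulr0 subr0.
Qed.

(** The only crossing at level [t1] lies on the edge of [h1], so the detour shows that the end [h2]
    is not above [t1]. No segment of the third at [h2] crosses [t1], so that third stays at or below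
    [t1] and cannot cross [t2 >= t1]. *)
Let single_third h1 h2 t1 t2 s1 s2 : detour h1 h2 -> h1 != h2 ->
  t1 <= t2 -> 0 < t1 -> t1 \notin levels ->
  (forall s, crossing s t1 -> s = s1) -> third h1 s1 ->
  third h2 s2 -> crossing s2 t2 -> False.
Proof.
move=> det h12 t12 t10 tl u1 X1 X2 c2.
have [yv [Y0 YN YD]] := HY.2.
have low : ~~ (t1 < yv (half_end h2)).
  apply: (det (fun v => ~~ (t1 < yv v))) => [v /YD ->|e eh1].
    by rewrite -leNgt ltW.
  rewrite -Y0 -YN (same_side (leq0n N) (leqnn N))// => i _.
  by apply: contraNN eh1 => /u1 E; case/andP: X1; rewrite -E.
have off i : crossing (h2.1, i) t1 -> ~~ third h2 (h2.1, i).
  move=> /u1 E; apply/negP; rewrite E => /andP[/eqP E2 H2].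
  have /andP[/eqP E1 H1] := X1; move: h12 => /eqP; apply.
  rewrite [h1]surjective_pairing [h2]surjective_pairing -E1 -E2; congr (_, _).
  have disj (n : nat) : (2 * k <= n)%N -> (n < k)%N -> False.
    by move=> a b; move: (leq_ltn_trans a b); rewrite ltnNge leq_pmull.
  by move: H1 H2; case: (h1.2); case: (h2.2) => // a b; have := disj (s1.2); tauto.
move: c2 => /andP[_]; have := X2; rewrite /third => /andP[/eqP E2 H2].
rewrite /seg_hi lt_max E2 => /orP H.
have {H}[j jN [jk Yj]] : exists2 j, (j <= N)%N &
    (if h2.2 then 2 * k <= j else j <= k)%N /\ t1 < Y h2.1 j.
  case: H => H; [exists (s2.2 : nat)|exists s2.2.+1]; rewrite ?ltn_ord ?(ltnW (ltn_ord _))//.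
    by split; [case: (h2.2) H2 => // /ltnW|exact: le_lt_trans H].
  by split; [case: (h2.2) H2 => // /leqW|exact: le_lt_trans H].
move: low; rewrite /half_end; case: ifP jk => b2 jk /negP; apply.
  rewrite -YN -(@same_side t1 h2.1 j N)// => i /andP[ji _].
  apply/negP => /off; rewrite /third/= eqxx b2/= => /negP; apply.
  exact: leq_trans ji.
rewrite -Y0 (@same_side t1 h2.1 0 j)// => i /andP[_ ij].
apply/negP => /off; rewrite /third/= eqxx b2/= => /negP; apply.
exact: leq_trans jk.
Qed.

(** If each third had a level crossed only once, [single_third] with the lower of the two levels in
    the role of [t1] would give a contradiction. *)
Lemma third_double h1 h2 : detour h1 h2 -> detour h2 h1 -> h1 != h2 ->
  exists2 h, h = h1 \/ h = h2 & forall t s, 0 < t < height -> t \notin levels ->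
    third h s -> crossing s t -> double_crossing seg_lo seg_hi t.
Proof.
move=> d12 d21 h12; apply: contrapT => nd.
have get h : h = h1 \/ h = h2 -> exists t s, [/\ 0 < t, t \notin levels,
    third h s, crossing s t & forall s', crossing s' t -> s' = s].
  move=> hh; apply: contrapT => ne; apply: nd; exists h => // t s /andP[t0 _] tl Xs cs.
  apply: contrapT => /negP; rewrite -leqNgt => /card_le1_eqP H; apply: ne.
  by exists t, s; split => // s' cs'; apply: H.
have [t1 [s1 [t10 tl1 X1 c1 u1]]] := get h1 (or_introl erefl).
have [t2 [s2 [t20 tl2 X2 c2 u2]]] := get h2 (or_intror erefl).
have [t12|/ltW t21] := leP t1 t2; first exact: single_third d12 h12 t12 _ _ u1 X1 X2 c2.
by apply: single_third d21 _ t21 _ _ u2 X2 X1 c1; rewrite // eq_sym.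
Qed.

Lemma subdivided_ge_gap h1 h2 lam d : detour h1 h2 -> detour h2 h1 -> h1 != h2 ->
  0 < lam -> 0 < d -> 2 * d <= third_dual c h1 -> 2 * d <= third_dual c h2 ->
  ((q + 1) * (dual_energy q c - (1 - (gain q (dual_energy q c) d)^-1) * (d / 2))) `^ (q + 1)^-1
    < riccati_len p lam ->
  lam * \sum_s seg_len s * seg_lo s `^ p <=
    \sum_s slope seg_lo seg_hi seg_len s `^ p * seg_len s.
Proof.
move=> d12 d21 h12 lam0 d0 D1 D2 Hr; have [A [dA A_ge _ _]] := exists_riccati p1 q1 pq lam0.
have [h hh Xd] := third_double d12 d21 h12.
apply: (@segments_ge_gap R p q p1 q1 pq seg seg_lo seg_hi seg_len seg_flux height
  seg_lo_ge0 seg_lo_lt seg_hi_height (fun s => mesh_gt0 s.1) (height_attained h.1)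
  (fun t (t0 : 0 < t) _ => seg_flow t0) seg_cross _ lam _ A seg_super_dual lam0 dA _
  (third h) d d0 _ Xd Hr).
- by move=> r /andP[r0 rL]; apply: A_ge; rewrite (ltW r0).
- by rewrite third_dualE; case: hh => ->.
Qed.

End gap.
End segments.
End subdivision.

(** * Uniform continuity and cutting of integrals *)

Section discretisation.
Variable R : realType.
Local Notation mu := (@lebesgue_measure R).

Lemma uniformly_continuous_segment (f : R -> R) (l : R) :
  {within `[0, l], continuous f} -> forall e : R, 0 < e -> exists2 d : R, 0 < d &
  forall x y, 0 <= x <= l -> 0 <= y <= l -> `|x - y| <= d -> `|f x - f y| <= e.
Proof.
move=> cf e e0; have e20 : 0 < e / 2 by rewrite divr_gt0.
pose P (d x : R) := 0 <= x <= l -> forall y, 0 <= y <= l -> `|x - y| <= d -> `|f x - f y| <= e.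
have cov : \forall d \near nbhs (0 : R), `[0, l] `<=` P d.
  have /compact_near_coveringP := @segment_compact R 0 l.
  apply => x xl; have xl' := xl; rewrite /= in_itv/= in xl'.
  have FF : Filter (within `[0, l] (nbhs x)) by exact: within_filter.
  have /subspace_continuousP/(_ x xl) cx := cf.
  have := @cvgr_dist_lt _ _ _ _ FF _ _ cx _ e20.
  rewrite near_withinE => -[d /= d0 H].
  have d20 : 0 < d / 2 by rewrite divr_gt0.
  exists (ball x (d / 2), ball (0 : R) (d / 2)).
    by split; exists (d / 2).
  move=> [x' k] [/= xx' k0] x'l y yl x'y.
  rewrite /ball/= in xx' k0; rewrite sub0r normrN in k0.
  have Hx : `|f x - f x'| < e / 2.
    apply: H => /=; last by rewrite in_itv.
    by apply: lt_trans xx' _; rewrite ltr_pdivrMr// ltr_pMr// ltr1n.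
  have Hy : `|f x - f y| < e / 2.
    apply: H => /=; last by rewrite in_itv.
    rewrite (_ : x - y = (x - x') + (x' - y)); last by rewrite addrA subrK.
    apply: le_lt_trans (ler_normD _ _) _; rewrite [ltRHS]splitr ltrD//.
    by apply: le_lt_trans x'y _; exact: le_lt_trans (ler_norm _) k0.
  rewrite (_ : f x' - f y = (f x - f y) - (f x - f x')); last by ring.
  apply: le_trans (ler_normB _ _) _; rewrite [leRHS]splitr.
  by rewrite lerD ?ltW.
have [d /= d0 H] := cov.
have d20 : 0 < d / 2 by rewrite divr_gt0.
exists (d / 2) => // x y xl yl xy; apply: (H (d / 2)) => //=.
by rewrite /ball/= sub0r normrN gtr0_norm// ltr_pdivrMr// ltr_pMr// ltr1n.
Qed.

Lemma Rintegral_pieces (f : R -> R) (h : R) (N : nat) : 0 <= h ->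
  mu.-integrable `[0, h * N%:R] (EFin \o f) ->
  \int[mu]_(x in `[0, h * N%:R]) f x =
  \sum_(i < N) \int[mu]_(x in `]h * i%:R, h * i.+1%:R[) f x.
Proof.
move=> h0; elim: N => [|N IH] fi.
  by rewrite big_ord0 mulr0 set_itv1 Rintegral_set1.
have le : h * N%:R <= h * N.+1%:R by rewrite ler_wpM2l// ler_nat.
have hN : 0 <= h * N%:R by rewrite mulr_ge0.
have i1 : mu.-integrable `[0, h * N%:R] (EFin \o f).
  by apply: integrableS fi => //; apply: subset_itvl; rewrite bnd_simp.
have i2 : mu.-integrable `]h * N%:R, h * N.+1%:R[ (EFin \o f).
  by apply: integrableS fi => //; apply: subset_itv; rewrite bnd_simp.
rewrite big_ord_recr/= -IH// Rintegral_itv_bndo_bndc//.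
by rewrite -(@Rintegral_itvB _ f (BLeft 0) (BRight (h * N.+1%:R)) (h * N%:R))// ?bnd_simp// addrC subrK.
Qed.

End discretisation.

(** * From generic piecewise affine functions to Sobolev functions *)

Section limit.
Variables (R : realType) (G : metric_graph R) (VD : {set vertex G}).
Variables (p q lam : R).
Hypotheses (p1 : 1 < p) (q1 : 1 < q) (pq : p + q = p * q) (lam0 : 0 < lam).
Implicit Types (e : edge G) (N : nat).
Local Notation mu := (@lebesgue_measure R).

Let p0 : 0 < p. Proof. exact: lt_trans p1. Qed.

Hypothesis generic_ge : forall N (Y : edge G -> nat -> R), (0 < N)%N -> (3 %| N)%N ->
  node_values VD N Y -> (forall e i, (i < N)%N -> Y e i != Y e i.+1) ->
  lam * \sum_(s : seg G N) seg_len s * seg_lo Y s `^ p <=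
    \sum_s slope (seg_lo Y) (seg_hi Y) (@seg_len _ G N) s `^ p * seg_len s.

(* A perturbation of the node values separating adjacent nodes. *)
Definition node_bump N e (i : nat) : nat :=
  if i == 0%N then nat_of_bool (src e \notin VD)
  else if i == N then nat_of_bool (tgt e \notin VD) else (2 + odd i)%N.

Lemma node_bump_neq N e i : (2 < N)%N -> (i < N)%N -> node_bump N e i != node_bump N e i.+1.
Proof.
move=> N2 iN; rewrite /node_bump /=.
case: i iN => [|i] iN.
  have /negbTE -> : 1%N != N by rewrite neq_ltn (ltnW N2).
  by case: (src e \in VD).
rewrite /= [i.+1 == N]ltn_eqF//; case: (i.+2 == N); last by case: (odd i).
by case: (tgt e \in VD); case: (odd i).
Qed.

Let energy_sum N (Y : edge G -> nat -> R) : R := \sum_(s : seg G N)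
  npow p ((Y s.1 s.2.+1 - Y s.1 s.2) / seg_len s) * seg_len s.
Let mass_sum N (Y : edge G -> nat -> R) : R := \sum_(s : seg G N)
  seg_len s * npow p (seg_lo Y s).

(** Both sides depend continuously on the size x of the perturbation, and adjacent nodes collide for
    finitely many x only. A strict failure at x = 0 would persist at a small x without
    collisions. *)
Lemma nodes_ge N (Y : edge G -> nat -> R) : (0 < N)%N -> (3 %| N)%N ->
  node_values VD N Y -> lam * mass_sum N Y <= energy_sum N Y.
Proof.
move=> N0 N3 [Y0 [yv [Ys Yt YD]]].
have N2 : (2 < N)%N by apply: dvdn_leq N3.
pose Z (x : R) e i := Y e i + x * (node_bump N e i)%:R.
pose F (x : R) : R := energy_sum N (Z x) - lam * mass_sum N (Z x).
have cZ e i (x : R) : {for x, continuous (fun x => Z x e i)}.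
  apply: cvgD; first exact: cvg_cst.
  by apply: cvgM; [exact: cvg_id|exact: cvg_cst].
have cF : {for (0 : R), continuous F}.
  apply: cvgB; last apply: cvgM; first 2 last.
  - apply: (@continuous_bigsum R (seg G N) R (fun s x => seg_len s * npow p (seg_lo (Z x) s))) => s.
    apply: cvgM; first exact: cvg_cst.
    apply: (@continuous_comp _ _ _ (fun x => seg_lo (Z x) s) (npow p)).
      by apply: continuous_minr; exact: cZ.
    exact: continuous_npow.
  - apply: (@continuous_bigsum R (seg G N) R (fun s x =>
      npow p ((Z x s.1 s.2.+1 - Z x s.1 s.2) / seg_len s) * seg_len s)) => s.
    apply: cvgM; last exact: cvg_cst.
    apply: (@continuous_comp _ _ _ (fun x => (Z x s.1 s.2.+1 - Z x s.1 s.2) / seg_len s) (npow p)).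
      by apply: cvgM; [apply: cvgB; exact: cZ|exact: cvg_cst].
    exact: continuous_npow.
  - exact: cvg_cst.
have Z0 : Z 0 = Y.
  by apply/funext => e; apply/funext => i; rewrite /Z mul0r addr0.
rewrite -subr_ge0 -[in X in 0 <= X]Z0 leNgt; apply/negP => F0.
pose bad := [seq (Y s.1 s.2 - Y s.1 s.2.+1) /
  ((node_bump N s.1 s.2.+1)%:R - (node_bump N s.1 s.2)%:R) | s : seg G N <- enum (seg G N)].
have /= [d /= d0 Hd] := cvgr_lt _ cF _ F0.
have [a [b [a0 ab bd nb]]] := subinterval_avoiding bad d0.
pose x := (a + b) / 2.
have /andP[ax xb] : a < x < b by rewrite /x !midf_lt.
have x0 : 0 < x by exact: le_lt_trans ax.
have : F x < 0.
  by apply: Hd; rewrite /ball/= sub0r normrN gtr0_norm// (lt_le_trans xb).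
rewrite ltNge => /negP; apply; rewrite subr_ge0.
have Zn : node_values VD N (Z x).
  split=> [e i|]; first by rewrite addr_ge0// mulr_ge0// ltW.
  (* The bump at a vertex depends only on membership in [VD], so the perturbed values still agree
     across edges and vanish on [VD]. *)
  exists (fun v => yv v + x * (v \notin VD)%:R); split=> [e|e|v vD].
  - by rewrite /Z Ys.
  - by rewrite /Z Yt /node_bump eqxx; case: eqP => // E; rewrite E in N0.
  - by rewrite vD mulr0 addr0 YD.
have Zd e i : (i < N)%N -> Z x e i != Z x e i.+1.
  move=> iN; have := nb x; rewrite ax xb => /(_ isT); apply: contraNneq => E.
  apply/mapP; exists (e, Ordinal iN); first by rewrite mem_enum.
  have D0 : (node_bump N e i.+1)%:R - (node_bump N e i)%:R != 0 :> R.
    by rewrite subr_eq0 eqr_nat eq_sym node_bump_neq.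
  rewrite /=; apply: (canRL (mulfK D0)); move: E; rewrite /Z => E.
  have aux (a1 a2 u v : R) : a1 + u = a2 + v -> v - u = a1 - a2 by lra.
  by rewrite mulrBr; exact: aux E.
have lo0 (s : seg G N) : 0 <= seg_lo (Z x) s by rewrite le_min !Zn.1.
have := generic_ge N0 N3 Zn Zd.
have -> : \sum_(s : seg G N) seg_len s * seg_lo (Z x) s `^ p = mass_sum N (Z x).
  by apply: eq_bigr => s _; rewrite /npow ger0_norm.
congr (_ <= _); apply: eq_bigr => s _; congr (_ * _); rewrite /npow normrM; congr (_ `^ _).
rewrite [X in _ = _ * X]gtr0_norm ?invr_gt0 ?mesh_gt0//; congr (_ / _).
rewrite /seg_hi /seg_lo; case: ltP => h.
  by rewrite gtr0_norm// subr_gt0.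
by rewrite ler0_norm ?subr_le0// opprB.
Qed.

(** |u| is interpolated on a fine mesh. The energy does not increase, by Jensen's inequality, and
    the lower sum for the mass loses at most d * L by uniform continuity, which costs at most [eta]
    after multiplication by [lam]. *)
Lemma sobolev_ge u du : W1p_D p VD u du ->
  lam * graph_integral (fun e x => `|u e x| `^ p) <=
  graph_integral (fun e x => `|du e x| `^ p).
Proof.
move=> [W [uv [us ut uD]]]; apply/ler_addgt0Pr => eta eta0.
pose L := \sum_(e : edge G) len e.
have L0 : 0 <= L by apply: sumr_ge0 => e _; rewrite ltW ?len_gt0.
pose d := eta / (lam * (L + 1)).
have L1 : 0 < L + 1 by rewrite ltr_wpDl.
have d0 : 0 < d by rewrite divr_gt0// mulr_gt0.
have cu e : {within `[0, len e], continuous (fun x => npow p (u e x))}.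
  by apply: within_continuous_comp; [exact: continuous_npow|have [] := W e].
have [r /all_and2[r0 Hr]] := choice (fun e =>
  let: ex_intro2 r r0 Hr := uniformly_continuous_segment (cu e) d0 in
  ex_intro (fun r => 0 < r /\ _) r (conj r0 Hr)).
(* Large enough for all edges at once, since each len e / r e is at most [n]; the factor 3 makes the
   thirds of edges unions of segments. *)
pose n := (Num.truncn (\sum_(e : edge G) len e / r e)).+1; pose N := (3 * n)%N.
have N0 : (0 < N)%N by rewrite muln_gt0.
have N3 : (3 %| N)%N by rewrite dvdn_mulr.
have meshr e : mesh N e <= r e.
  rewrite ler_pdivrMr ?ltr0n// mulrC -ler_pdivrMr//.
  apply: (@le_trans _ _ n%:R); last by rewrite ler_nat leq_pmull.
  apply: (@le_trans _ _ (\sum_(e : edge G) len e / r e)).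
    rewrite (bigD1 e)//= lerDl sumr_ge0// => e' _.
    by rewrite divr_ge0 ?(ltW (r0 _)) ?(ltW (len_gt0 _)).
  by rewrite ltW// truncnS_gt.
pose x e i : R := mesh N e * i%:R.
have m0 e : 0 < mesh N e := mesh_gt0 N0 e.
have xN e : x e N = len e by rewrite /x meshN.
have x_le e i : (i <= N)%N -> x e i <= len e.
  by move=> iN; rewrite -(xN e) ler_pM2l// ler_nat.
have x_ge e i : 0 <= x e i by rewrite mulr_ge0// ltW.
have xS e i : x e i.+1 - x e i = mesh N e by rewrite /x -natr1; ring.
pose Y e i := `|u e (x e i)|.
have Yn : node_values VD N Y.
  split=> [e i|]; first exact: normr_ge0.
  exists (fun v => `|uv v|); split=> [e|e|v vD].
  - by rewrite /Y /x mulr0 us.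
  - by rewrite /Y xN ut.
  - by rewrite uD// normr0.
have H := nodes_ge N0 N3 Yn.
have pieces (f : graph_fun G) : (forall e, mu.-integrable `[0, len e] (EFin \o f e)) ->
    graph_integral f = \sum_(s : seg G N) \int[mu]_(y in `]x s.1 s.2, x s.1 s.2.+1[) f s.1 y.
  move=> fi; rewrite /graph_integral.
  rewrite -(pair_big predT predT (fun e (i : 'I_N) => \int[mu]_(y in `]x e i, x e i.+1[) f e y))/=.
  apply: eq_bigr => e _; rewrite -(Rintegral_pieces (ltW (m0 e))) meshN//; exact: fi.
have E1 : energy_sum N Y <= graph_integral (fun e x => `|du e x| `^ p).
  rewrite pieces => [|e]; last by apply: integrable_oo_cc; have [_ _ []] := W e.
  apply: ler_sum => -[e i] _; rewrite /seg_len/=.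
  have xx : x e i < x e i.+1 by rewrite -subr_gt0 xS.
  apply: le_trans (W1p_energy p1 q1 pq (W e) (x_ge e i) xx (x_le _ _ (ltn_ord i))).
  rewrite xS ler_wpM2r ?(ltW (m0 e))// /npow normrM [X in _ * X]gtr0_norm ?invr_gt0//.
  rewrite ler_powRl ?(ltW p0) ?mulr_ge0 ?invr_ge0 ?(ltW (m0 e))// ler_wpM2r ?invr_ge0 ?(ltW (m0 e))//.
  exact: ler_dist_dist.
have E2 : graph_integral (fun e x => `|u e x| `^ p) <= mass_sum N Y + d * L.
  rewrite pieces => [|e]; last exact: within_continuous_integrable (cu e).
  have -> : d * L = \sum_(s : seg G N) seg_len s * d.
    rewrite mulrC mulr_suml -(pair_big predT predT (fun e (i : 'I_N) => mesh N e * d))/=.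
    by apply: eq_bigr => e _; rewrite sumr_const card_ord -mulrnAl -mulr_natr meshN.
  rewrite -big_split/=; apply: ler_sum => -[e i] _; rewrite /seg_len/=.
  rewrite -mulrDr; set k := _ + d.
  have xx : x e i < x e i.+1 by rewrite -subr_gt0 xS.
  have -> : mesh N e * k = \int[mu]_(y in `]x e i, x e i.+1[) (fun=> k) y.
    by rewrite Rintegral_cst//= lebesgue_measure_itv/= lte_fin xx -EFinB/= xS mulrC.
  apply: le_Rintegral => //.
  - apply: integrableS (within_continuous_integrable (cu e)) => //.
    by apply: subset_itv; rewrite bnd_simp ?x_ge ?x_le.
  - apply: integrableS (integrable_cst k 0 (len e)) => //.
    by apply: subset_itv; rewrite bnd_simp ?x_ge ?x_le.
  move=> y; rewrite /= in_itv/= => /andP[y1 y2].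
  have yl : 0 <= y <= len e.
    by rewrite (le_trans (x_ge e i) (ltW y1)) (le_trans (ltW y2) (x_le e i.+1 (ltn_ord i))).
  have near_node j : (j <= N)%N -> `|y - x e j| <= mesh N e -> `|u e y| `^ p <= npow p (Y e j) + d.
    move=> jN yj; rewrite -lerBlDl /npow /Y normr_id.
    apply: le_trans (ler_norm _) _; apply: Hr => //; first by rewrite x_ge x_le.
    exact: le_trans (meshr e).
  rewrite /k /seg_lo/=; have h := xS e i; case: (ltP (Y e i) (Y e i.+1)) => _; apply: near_node; rewrite ?(ltnW (ltn_ord i)) ?ltn_ord//.
    by rewrite gtr0_norm ?subr_gt0// -h lerB// ltW.
  by rewrite ler0_norm ?subr_le0 ?(ltW y2)// opprB -h lerB// ltW.
apply: le_trans (_ : lam * (mass_sum N Y + d * L) <= _).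
  by rewrite ler_pM2l.
rewrite mulrDr lerD ?(le_trans H E1)//.
have -> : lam * (d * L) = eta * (L / (L + 1)).
  by rewrite /d; field; rewrite !gt_eqF.
by rewrite ger_pMr// ler_pdivrMr// mul1r lerDl.
Qed.

End limit.

(** * Lower bounds for the first eigenvalue *)

Section positivity.
Variable R : realType.
Local Notation mu := (@lebesgue_measure R).

Lemma within_continuous_Rintegral_gt0 (f : R -> R) (l x : R) : 0 < l ->
  {within `[0, l], continuous f} -> (forall y, 0 <= f y) -> 0 <= x <= l -> 0 < f x ->
  0 < \int[mu]_(y in `[0, l]) f y.
Proof.
move=> l0 cf f0 /andP[x0 xl] fx.
have fx2 : 0 < f x / 2 by rewrite divr_gt0.
have [d d0 Hd] := uniformly_continuous_segment cf fx2.
pose a := Num.max 0 (x - d); pose b := Num.min l (x + d).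
have ab : a < b.
  rewrite gt_max !lt_min l0/=; apply/andP; split; first by move: x0 d0; lra.
  by apply/andP; split; move: xl d0; lra.
have a0 : 0 <= a by rewrite le_max lexx.
have bl : b <= l by rewrite ge_min lexx.
have sub : `[a, b]%classic `<=` `[0, l]%classic.
  by apply: subset_itv; rewrite bnd_simp.
have fi := within_continuous_integrable cf.
apply: lt_le_trans (_ : \int[mu]_(y in `[a, b]) (fun=> f x / 2) y <= _).
  rewrite Rintegral_cst//= lebesgue_measure_itv/= lte_fin ab -EFinB/=.
  by rewrite mulr_gt0// subr_gt0.
apply: le_trans (_ : \int[mu]_(y in `[a, b]) f y <= _).
  apply: le_Rintegral => //.
  - exact: integrable_cst.
  - exact: integrableS fi.
  move=> y; rewrite /= in_itv/= ge_max le_min => /andP[/andP[y0 yx] /andP[yl xy]].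
  have : `|f x - f y| <= f x / 2.
    by apply: Hd; rewrite ?x0 ?xl ?y0 ?yl// ler_distlC; apply/andP; split; lra.
  by rewrite ler_distl => /andP[]; lra.
rewrite [leRHS]Rintegral_mkcond [leLHS]Rintegral_mkcond; apply: le_Rintegral => //.
- rewrite -restrict_EFin; apply/integrable_restrict => //=; rewrite setTI.
  exact: integrableS fi.
- by rewrite -restrict_EFin; apply/integrable_restrict => //=; rewrite setTI.
move=> y _; rewrite /patch; case: ifPn => yab; last by case: ifPn.
rewrite ifT//; move: yab; rewrite !inE; exact: sub.
Qed.

End positivity.

Section lambda1_bounds.
Variables (R : realType) (G : metric_graph R) (VD : {set vertex G}).
Variables (p q : R).
Hypotheses (p1 : 1 < p) (q1 : 1 < q) (pq : p + q = p * q).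
Implicit Types (u du : graph_fun G) (e : edge G).

Let p0 : 0 < p. Proof. exact: lt_trans p1. Qed.
Let q10 : 0 < q + 1. Proof. by rewrite addr_gt0// (lt_trans _ q1). Qed.

Lemma mass_gt0 u du : W1p_D p VD u du -> nonzero_fun u ->
  0 < graph_integral (fun e x => `|u e x| `^ p).
Proof.
move=> [W _] [e [x [xl ux]]]; rewrite /graph_integral (bigD1 e)//=.
apply: ltr_pwDl; last first.
  by apply: sumr_ge0 => e' _; apply: Rintegral_ge0 => y _; exact: powR_ge0.
apply: (@within_continuous_Rintegral_gt0 _ _ _ x).
- exact: len_gt0.
- by apply: (within_continuous_comp (continuous_npow p0)); have [] := W e.
- by move=> y; exact: powR_ge0.
- by rewrite in_itv/= in xl.
- by apply: powR_gt0; rewrite normr_gt0.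
Qed.

Lemma lambda1_le u du : W1p_D p VD u du -> nonzero_fun u ->
  lambda1 p VD * graph_integral (fun e x => `|u e x| `^ p) <=
  graph_integral (fun e x => `|du e x| `^ p).
Proof.
move=> W nz; rewrite -ler_pdivlMr ?(mass_gt0 W nz)//.
apply: ge_inf; last by exists u, du.
exists 0 => _ [v [dv [_ _ ->]]].
by rewrite divr_ge0// sumr_ge0// => e _; apply: Rintegral_ge0 => y _; exact: powR_ge0.
Qed.

(** A parabola on one edge, 0 on the others. It ensures that the infimum in [lambda1] is taken over
    a nonempty set and is not a default value. *)
Lemma exists_test_fun e : exists u du, W1p_D p VD u du /\ nonzero_fun u.
Proof.
pose f (x : R) := x * (len e - x); pose g x : R := len e - x - x.
have df (x : R) : is_derive x (1 : R) f (g x).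
  have d := is_deriveM (is_derive_id x 1) (is_deriveB (is_derive_const (len e) x) (is_derive_id x 1)).
  apply: is_derive_eq d _; change (x * (0 - 1) + (len e - x) * 1 = g x); rewrite /g; ring.
exists (fun e' x => (e' == e)%:R * f x), (fun e' x => (e' == e)%:R * g x); split.
  split=> [e'|].
    have d (x : R) : is_derive x (1 : R) (fun x => (e' == e)%:R * f x) ((e' == e)%:R * g x).
      exact: (is_deriveZ (e' == e)%:R (df x)).
    apply: W1p_of_derive => //; rewrite ?len_gt0//.
      by apply: continuous_within => x _; exact: is_derive1_continuous (d x).
    apply: continuous_within => x _; apply: cvgM; first exact: cvg_cst.
    by apply: cvgB; [apply: cvgB; [exact: cvg_cst|exact: cvg_id]|exact: cvg_id].
  exists (fun=> 0); split=> // e'; first by rewrite /f mul0r mulr0.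
  by rewrite /f; case: eqP => [->|_]; rewrite ?mul0r// subrr !mulr0.
exists e, (len e / 2); split.
  by rewrite in_itv/= divr_ge0 ?(ltW (len_gt0 _))//= ler_pdivrMr// ler_peMr ?ler1n// ltW ?len_gt0.
rewrite eqxx mul1r /f; apply: lt0r_neq0; rewrite mulr_gt0 ?divr_gt0 ?len_gt0//.
by rewrite subr_gt0 ltr_pdivrMr// ltr_pMr ?len_gt0// ltr1n.
Qed.

Lemma lambda1_ge (lam : R) : (exists e : edge G, True) ->
  (forall u du, W1p_D p VD u du ->
    lam * graph_integral (fun e x => `|u e x| `^ p) <=
    graph_integral (fun e x => `|du e x| `^ p)) ->
  lam <= lambda1 p VD.
Proof.
move=> [e _] H; apply: lb_le_inf.
  by have [u [du [W nz]]] := exists_test_fun e; eexists; exists u, du.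
move=> _ [u [du [W nz ->]]]; rewrite ler_pdivlMr ?(mass_gt0 W nz)//; exact: H.
Qed.

(** The first eigenvalue of the interval with torsion integral [W], whose length is ((q + 1) W)^(1 /
    (q + 1)). *)
Definition kj_value (W : R) : R := eigen_const p * ((q + 1) * W) `^ (- (p / (q + 1))).

Lemma riccati_len_gt (W lam : R) : 0 < W -> 0 < lam -> lam < kj_value W ->
  ((q + 1) * W) `^ (q + 1)^-1 < riccati_len p lam.
Proof.
move=> W0 lam0 H; have X0 : 0 < (q + 1) * W by rewrite mulr_gt0.
have C0 := eigen_const_gt0 p1.
have -> : ((q + 1) * W) `^ (q + 1)^-1 = (((q + 1) * W) `^ (p / (q + 1))) `^ p^-1.
  by rewrite -powRrM mulrAC mulfV ?gt_eqF// mul1r.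
apply: ltr_powRl; rewrite ?invr_gt0 ?powR_ge0// ltr_pdivlMr//.
by move: H; rewrite /kj_value powRN ltr_pdivlMr ?powR_gt0// mulrC.
Qed.

Lemma kj_value_le (W : R) : 0 < W -> (exists e : edge G, True) ->
  (forall lam, 0 < lam -> ((q + 1) * W) `^ (q + 1)^-1 < riccati_len p lam ->
   forall u du, W1p_D p VD u du ->
    lam * graph_integral (fun e x => `|u e x| `^ p) <=
    graph_integral (fun e x => `|du e x| `^ p)) ->
  kj_value W <= lambda1 p VD.
Proof.
move=> W0 He H; have K0 : 0 < kj_value W.
  by rewrite mulr_gt0 ?eigen_const_gt0// powR_gt0// mulr_gt0.
rewrite leNgt; apply/negP => lt1.
(* The midpoint would do for the contradiction; the maximum with kj_value W / 2 keeps [lam]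
   positive. *)
pose lam := Num.max (kj_value W / 2) ((lambda1 p VD + kj_value W) / 2).
have lam0 : 0 < lam by rewrite lt_max divr_gt0.
have lamK : lam < kj_value W.
  by rewrite gt_max !midf_lt// andbT ltr_pdivrMr// ltr_pMr// ltr1n.
have := lambda1_ge He (H lam lam0 (riccati_len_gt W0 lam0 lamK)).
by rewrite leNgt lt_max !midf_lt// orbT.
Qed.

Lemma kj_value_lt (W W' : R) : 0 < W' -> W' < W -> kj_value W < kj_value W'.
Proof.
move=> W'0 WW; have W0 : 0 < W by exact: lt_trans WW.
rewrite /kj_value ltr_pM2l ?eigen_const_gt0// !powRN ltf_pV2 ?posrE ?powR_gt0 ?mulr_gt0//.
by apply: ltr_powRl; rewrite ?divr_gt0 ?(ltW (mulr_gt0 _ _))// ltr_pM2l.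
Qed.

Variable c : edge G -> R.
Hypotheses (hconn : connected_graph G) (VD0 : VD != finset.set0)
  (He : exists e : edge G, True) (hc : flow_balance VD c).

Lemma lambda1_ge_kj : 0 < dual_energy q c -> kj_value (dual_energy q c) <= lambda1 p VD.
Proof.
move=> W0; apply: kj_value_le => // lam lam0 Hr u du W.
apply: (sobolev_ge p1 q1 pq lam0 _ W) => N Y N0 _ HY Yd.
exact: (subdivided_ge p1 q1 pq hconn VD0 N0 HY Yd hc).
Qed.

(** [d], and with it the reduced torsion [W'], is determined by the flux alone. The bound with [W']
    thus holds for all test functions, and strict monotonicity of [kj_value] concludes. *)
Lemma lambda1_gt_kj h1 h2 : detour VD h1 h2 -> detour VD h2 h1 -> h1 != h2 ->
  0 < third_dual q c h1 -> 0 < third_dual q c h2 ->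
  third_dual q c h1 <= dual_energy q c ->
  kj_value (dual_energy q c) < lambda1 p VD.
Proof.
move=> d12 d21 h12 D1 D2 DW.
set W := dual_energy q c; pose m := Num.min (third_dual q c h1) (third_dual q c h2).
have m0 : 0 < m by rewrite lt_min D1 D2.
have m1 : m <= third_dual q c h1 by rewrite ge_min lexx.
have m2 : m <= third_dual q c h2 by rewrite ge_min lexx orbT.
pose d := m / 2; have d0 : 0 < d by rewrite divr_gt0.
have W0 : 0 < W by exact: lt_le_trans DW.
have g1 : 1 < gain q W d.
  have e1 : (1 : R) `^ (q + 1)^-1 = 1 by rewrite powR1.
  rewrite -[X in X < _]e1 /gain; apply: ltr_powRl; rewrite ?invr_gt0//.
  by rewrite ltrDl !mulr_gt0 ?invr_gt0.
have g0 : 0 < gain q W d by exact: lt_trans g1.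
have gV1 : (gain q W d)^-1 < 1 by rewrite invf_lt1.
have gV0 : 0 < (gain q W d)^-1 by rewrite invr_gt0.
pose W' := W - (1 - (gain q W d)^-1) * (d / 2).
have W'W : W' < W by rewrite /W' ltrBlDr ltrDl mulr_gt0 ?subr_gt0 ?divr_gt0.
have W'0 : 0 < W'.
  have aux (g : R) : 0 < g -> (1 - g) * (d / 2) < m.
    by move=> g0'; have := mulr_gt0 g0' m0; move: m0; rewrite /d; lra.
  rewrite /W' subr_gt0; apply: lt_le_trans (aux _ gV0) _; exact: le_trans DW.
apply: lt_le_trans (kj_value_lt W'0 W'W) _.
apply: kj_value_le => // lam lam0 Hr u du Wu.
apply: (sobolev_ge p1 q1 pq lam0 _ Wu) => N Y N0 /dvdnP[k Nk] HY Yd.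
rewrite mulnC in Nk.
apply: (subdivided_ge_gap p1 q1 pq hconn VD0 N0 HY Yd hc Nk d12 d21 h12 lam0 d0) => //.
  by rewrite /d mulrC divfK// gt_eqF.
by rewrite /d mulrC divfK// gt_eqF.
Qed.

End lambda1_bounds.

(** * Graphs which are not intervals *)

Section combinatorics.
Variables (R : realType) (G : metric_graph R) (VD : {set vertex G}).
Hypotheses (hconn : connected_graph G) (VD0 : VD != finset.set0)
  (VD1 : forall v, v \in VD -> deg v = 1%N).
Local Notation half_edge := (edge G * bool)%type.
Implicit Types (h : half_edge) (v x y : vertex G) (e : edge G).

Definition opp h : half_edge := (h.1, ~~ h.2).

Lemma oppK : involutive opp.
Proof. by move=> [e b]; rewrite /opp/= negbK. Qed.

Lemma opp_neq h : opp h != h.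
Proof. by case: h => e b; rewrite /opp/= xpair_eqE eqxx; case: b. Qed.

Definition star v : {set half_edge} := [set h | half_end h == v]%SET.

Lemma card_star v : #|star v| = deg v.
Proof.
pose f (b : bool) := fun e : edge G => (e, b).
have fi b : injective (f b) by move=> e1 e2 [].
have -> : star v = (f false @: [set e | src e == v] :|: f true @: [set e | tgt e == v])%SET.
  apply/setP => -[e b]; rewrite !inE /half_end/=; apply/idP/orP.
    by case: b => H; [right|left]; apply: imset_f; rewrite inE.
  by case=> /imsetP[e']; rewrite inE => H [-> ->].
rewrite cardsU (_ : _ :&: _ = finset.set0)%SET ?cards0 ?subn0; last first.
  apply/setP => -[e b]; rewrite !inE; apply/negbTE/negP.
  by case/andP => /imsetP[e1 _ [_ ->]] /imsetP[e2 _ []].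
rewrite !card_imset//; congr (_ + _)%N; apply: eq_card => e; by rewrite !inE.
Qed.

Lemma star_gt2 h1 h2 h3 v : h1 != h2 -> h2 != h3 -> h3 != h1 ->
  half_end h1 = v -> half_end h2 = v -> half_end h3 = v -> (2 < deg v)%N.
Proof.
move=> n12 n23 n31 E1 E2 E3; rewrite -card_star; apply/card_gt2P.
by exists h1, h2, h3; split; rewrite ?inE ?E1 ?E2 ?E3.
Qed.

(** Ends that belong to [VD] are reached without using any edge. *)
Lemma detours_of_pair v1 v2 : v1 \in VD -> v2 \in VD -> v1 != v2 ->
  exists h1 h2, [/\ h1 != h2, detour VD h1 h2 & detour VD h2 h1].
Proof.
move=> D1 D2 v12.
have get v : v \in VD -> exists h, half_end h = v.
  move=> /VD1; rewrite -card_star => E.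
  have /card_gt0P[h] : (0 < #|star v|)%N by rewrite E.
  by rewrite inE => /eqP; exists h.
have [h1 E1] := get _ D1; have [h2 E2] := get _ D2.
exists h1, h2; split.
- by apply: contraNneq v12 => E; rewrite -E1 -E2 E.
- by move=> P HP _; rewrite E2 HP.
- by move=> P HP _; rewrite E1 HP.
Qed.

(** At most one half-edge at [b] lies on an edge separating [b] from [VD]. With three or more
    half-edges at least two are left, and since both end at [b] each has a detour avoiding the
    other. *)
Lemma detours_of_branching (b : vertex G) : (2 < deg b)%N ->
  exists h1 h2, [/\ h1 != h2, detour VD h1 h2 & detour VD h2 h1].
Proof.
move=> b3; have /set0Pn[v0 v0D] := VD0.
pose cut e := exists P : pred (vertex G), [/\ forall v, v \in VD -> P v,
  forall e', e' != e -> P (src e') = P (tgt e') & ~~ P b].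
(* The other end of a separating edge lies on the side of [VD]; otherwise [P] would be constant
   along every edge. *)
have cut_edge h P : half_end h = b -> ~~ P b ->
    (forall e', e' != h.1 -> P (src e') = P (tgt e')) ->
    (forall v, v \in VD -> P v) -> P (half_end (opp h)) .
  case: h => e c /= hb Pb H HD; apply/negPn/negP => nP; move/negP: (Pb); apply.
  apply: (connected_ind hconn (P := P) (v0 := v0)); first exact: HD.
  move=> e'; have [->|/H//] := eqVneq e' e.
  move: hb nP Pb; rewrite /half_end/opp/=; case: c => /= -> /negbTE -> /negbTE -> //.
(* The intersection of the sets witnessing two cuts propagates along every edge. *)
have cut1 h1 h2 : half_end h1 = b -> half_end h2 = b -> cut h1.1 -> cut h2.1 -> h1 = h2.
  move=> E1 E2 [P1 [D1 H1 B1]] [P2 [D2 H2 B2]].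
  have Q1 := cut_edge _ _ E1 B1 H1 D1; have Q2 := cut_edge _ _ E2 B2 H2 D2.
  have [E|ne] := eqVneq h1.1 h2.1.
    case: h1 h2 E E1 E2 Q1 {H1 H2 Q2} => [e1 b1] [e2 b2]/= -> E1 E2 Q1.
    case: (eqVneq b1 b2) => [-> //|nb].
    have nbE : ~~ b1 = b2 by case: (b1) (b2) nb => -[].
    by move: Q1; rewrite /opp/= nbE E2 (negbTE B1).
  exfalso; move/negP: (B1); apply.
  suff /andP[] : P1 b && P2 b by [].
  apply: (connected_ind hconn (P := fun v => P1 v && P2 v) (v0 := v0)).
    by rewrite D1// D2.
  move=> e; have [Ee|n1] := eqVneq e h1.1.
    have H2' : P2 (src e) = P2 (tgt e) by apply: H2; rewrite Ee.
    have /norP[] : ~~ (P2 (src e) || P2 (tgt e)).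
      by move: E1 B2; rewrite -H2' orbb Ee /half_end; case: h1.2 => <-; rewrite ?Ee// -Ee H2'.
    by move=> /negbTE -> /negbTE ->; rewrite !andbF.
  have [Ee|n2] := eqVneq e h2.1.
    have H1' : P1 (src e) = P1 (tgt e) by exact: H1.
    have /norP[] : ~~ (P1 (src e) || P1 (tgt e)).
      by move: E2 B1; rewrite -H1' orbb Ee /half_end; case: h2.2 => <-; rewrite ?Ee// -Ee H1'.
    by move=> /negbTE -> /negbTE ->.
  by rewrite H1// H2.
have : (1 < #|[set h in star b | `[< ~ cut h.1 >]]%SET|)%N.
  have := cardsID [set h | `[< ~ cut h.1 >]]%SET (star b).
  rewrite card_star => E; move: b3; rewrite -E => b3.
  have c1 : (#|star b :\: [set h | `[< ~ cut h.1 >]]%SET| <= 1)%N.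
    apply/card_le1_eqP => h1 h2; rewrite !inE => /andP[c1 /eqP E1] /andP[c2 /eqP E2].
    by apply: cut1 => //; apply: contrapT; apply/asboolPn.
  have -> : #|[set h in star b | `[< ~ cut h.1 >]]%SET| = #|star b :&: [set h | `[< ~ cut h.1 >]]%SET|.
    by apply: eq_card => h; rewrite !inE.
  by rewrite -(ltn_add2r 1); apply: leq_trans b3 _; rewrite leq_add2l.
move=> /card_gt1P[h1 [h2 []]]; rewrite !inE => /andP[/eqP E1 /asboolP c1] /andP[/eqP E2 /asboolP c2] h12.
exists h1, h2; split=> // P HD H; apply: contrapT => /negP nP.
  by apply: c1; exists P; split=> //; rewrite -E2.
by apply: c2; exists P; split=> //; rewrite -E1.
Qed.


(** * Graphs of maximal degree two with one Dirichlet vertex *)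

Section path.
Variable v1 : vertex G.
Hypotheses (VDE : VD = [set v1]%SET) (deg2 : forall v, (deg v <= 2)%N).
Implicit Types hs : seq half_edge.

Definition stops hs : seq (vertex G) := v1 :: [seq half_end (opp h) | h <- hs].

(* A path from [v1], given by the half-edges through which it leaves its
   successive vertices. *)
Definition trail hs : Prop := [/\ uniq [seq h.1 | h <- hs], uniq (stops hs) &
  forall h0 i, (i < size hs)%N -> half_end (nth h0 hs i) = nth v1 (stops hs) i].

Let star1 h h' : half_end h = v1 -> half_end h' = v1 -> h = h'.
Proof.
move=> E E'; have := VD1 (v := v1); rewrite VDE inE eqxx -card_star => /(_ isT)/eqP/cards1P[k sk].
have : h \in star v1 by rewrite inE E.
have : h' \in star v1 by rewrite inE E'.
by rewrite sk !inE => /eqP -> /eqP ->.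
Qed.

Lemma stops_half_end hs : trail hs -> forall h, h \in hs ->
  half_end h \in stops hs /\ half_end (opp h) \in stops hs.
Proof.
move=> [_ _ H] h hin; split.
  rewrite -(nth_index h hin) H ?index_mem// mem_nth//= size_map ltnS ltnW//.
  by rewrite index_mem.
by rewrite inE (map_f (fun h => half_end (opp h)) hin) orbT.
Qed.

Lemma trail_edge hs h : trail hs -> h.1 \in [seq h.1 | h <- hs] ->
  exists2 h', h' \in hs & h = h' \/ h = opp h'.
Proof.
move=> _ /mapP[h' hin E]; exists h' => //; move: E.
case: h => e b; case: h' hin => e' b' _ /= ->; rewrite /opp/=.
by case: b b' => -[]; [left|right|right|left].
Qed.

(** The start has degree one, and at a later stop before the last the trail arrives and leaves by
    two distinct half-edges, which exhaust the degree. *)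
Lemma inner_stop hs h0 i h : trail hs -> (i < size hs)%N ->
  half_end h = nth v1 (stops hs) i -> h.1 \in [seq h.1 | h <- hs].
Proof.
move=> [Ue Us H] ihs hE; have hi := H h0 i ihs.
set hi_ := nth h0 hs i in hi.
have hin : hi_ \in hs by rewrite mem_nth.
have [->|n1] := eqVneq h hi_; first by rewrite (map_f fst hin).
case: i ihs @hi_ hi hin n1 hE => [|i] ihs hi_ hi hin n1 hE.
  by rewrite (star1 hE hi) eqxx in n1.
pose k := nth h0 hs i; have kin : k \in hs by rewrite mem_nth// ltnW.
have kE : half_end (opp k) = nth v1 (stops hs) i.+1.
  by rewrite /= (nth_map h0 _ _ (ltnW ihs)).
have [->|n2] := eqVneq h (opp k); first by rewrite (map_f fst kin).
have n3 : opp k != hi_.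
  apply/negP => /eqP /(congr1 fst) /= E.
  have := @nth_uniq _ h0.1 [seq h.1 | h <- hs] i i.+1; rewrite !size_map => /(_ (ltnW ihs) ihs Ue).
  rewrite (nth_map h0 _ _ (ltnW ihs)) (nth_map h0 _ _ ihs).
  by rewrite -/k -/hi_ E eqxx ltn_eqF.
have := star_gt2 n2 n3 _ hE kE hi; rewrite eq_sym => /(_ n1).
by rewrite ltnNge deg2.
Qed.

(** A new half-edge at the last stop would extend the trail, or lead to an earlier stop, where all
    half-edges are used, or form a loop, giving three half-edges at one vertex. *)
Lemma maximal_trail hs : trail hs -> hs != [::] ->
  (forall h, ~ trail (rcons hs h)) ->
  forall h, half_end h \in stops hs -> h.1 \in [seq h.1 | h <- hs].
Proof.
move=> tr hs0 maxi h hin.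
have [h0 _] : exists h0, h0 \in hs.
  by case: hs hs0 {tr maxi hin} => // h0 hs _; exists h0; rewrite mem_head.
have [Ue Us H] := tr.
have idx x : x \in stops hs -> exists2 i, (i <= size hs)%N & x = nth v1 (stops hs) i.
  move=> xin; exists (index x (stops hs)); last by rewrite nth_index.
  by rewrite -ltnS -(size_map (fun h => half_end (opp h))) -/(size (stops hs)) index_mem.
have [i] := idx _ hin; rewrite leq_eqVlt => /predU1P[-> hE|ihs hE]; last first.
  exact: (inner_stop h0 tr ihs hE).
apply: contrapT => /negP hnew.
have s0 : (0 < size hs)%N by rewrite lt0n size_eq0.
pose k := nth h0 hs (size hs).-1; have kin : k \in hs by rewrite mem_nth// prednK.
have kE : half_end (opp k) = half_end h.
  by rewrite hE -[in RHS](prednK s0) /= (nth_map h0)// prednK.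
have hk : opp k != h.
  by apply: contraNneq hnew => <-; rewrite (map_f fst kin).
have [oin|onew] := boolP (half_end (opp h) \in stops hs); last first.
  apply: (maxi h); split.
  - by rewrite map_rcons rcons_uniq hnew.
  - rewrite /stops map_rcons -rcons_cons rcons_uniq onew; exact: Us.
  - move=> h1 j; rewrite size_rcons ltnS nth_rcons leq_eqVlt /stops map_rcons -rcons_cons nth_rcons.
    rewrite /= size_map ltnS => /predU1P[->|jl].
      by rewrite ltnn eqxx leqnn hE.
    by rewrite jl (ltnW jl) H.
have [j] := idx _ oin; rewrite leq_eqVlt => /predU1P[-> oE|jhs oE]; last first.
  by move/negP: hnew; apply; have := inner_stop h0 tr jhs oE.
have := @star_gt2 (opp k) h (opp h) (half_end h) hk _ _ kE erefl.
rewrite eq_sym opp_neq => /(_ isT); rewrite oE -hE ltnNge deg2 => H3.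
suff : opp h != opp k by move=> /H3 /(_ erefl).
apply: contraNneq hnew => /(congr1 opp); rewrite !oppK => ->.
by rewrite (map_f fst kin).
Qed.

(** The stops of a longest trail are closed under adjacency, hence exhaust the vertices by
    connectedness; the edges of the trail then exhaust the edges. *)
Lemma interval_of_deg2 : interval_one_dirichlet VD.
Proof.
have [h1 h1E] : exists h, half_end h = v1.
  have : (0 < #|star v1|)%N by rewrite card_star VD1 ?VDE ?inE.
  by case/card_gt0P => h; rewrite inE => /eqP; exists h.
have tr1 : trail [:: h1].
  split => //=; last by move=> h0 [|i].
  rewrite /stops/= inE andbT; apply/eqP => E; have := opp_neq h1.
  by rewrite (star1 (esym E) h1E) eqxx.
pose P n := `[< exists hs, trail hs /\ size hs = n.+1 >].
have exP : exists n, P n by exists 0%N; apply/asboolP; exists [:: h1].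
have bP n : P n -> (n <= #|vertex G|)%N.
  move=> /asboolP[hs [[_ Us _] sz]]; have := max_card (mem (stops hs)).
  by rewrite (card_uniqP Us) /= size_map sz => /ltnW/ltnW.
case: (ex_maxnP exP bP) => n /asboolP[hs [tr sz]] maxn.
have hs0 : hs != [::] by rewrite -size_eq0 sz.
have used : forall h, half_end h \in stops hs -> h.1 \in [seq h.1 | h <- hs].
  apply: (maximal_trail tr hs0) => h tr'; have : P n.+1 by apply/asboolP; exists (rcons hs h); rewrite size_rcons sz.
  by move/maxn; rewrite ltnn.
have closed h : half_end h \in stops hs -> half_end (opp h) \in stops hs.
  move=> /used /(trail_edge tr)[h' h'in [->|->]]; rewrite ?oppK.
    by have [] := stops_half_end tr h'in.
  by have [] := stops_half_end tr h'in.
have all_stops v : v \in stops hs.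
  apply: (connected_ind hconn (P := fun v => v \in stops hs) (v0 := v1)).
    exact: mem_head.
  by move=> e; apply/idP/idP => H; [apply: (closed (e, false))|apply: (closed (e, true))].
have all_edges e : e \in [seq h.1 | h <- hs] by exact: (used (e, false)).
have [Ue Us H] := tr.
pose v (i : 'I_n.+2) := nth v1 (stops hs) i.
pose e (i : 'I_n.+1) := (nth h1 hs i).1.
exists n, v, e; split.
- apply: inj_card_bij; last first.
    have -> : #|vertex G| = #|mem (stops hs)|.
      by apply: eq_card => x; rewrite [RHS]all_stops.
    by rewrite card_ord (card_uniqP Us) /= size_map sz.
  have sS : size (stops hs) = n.+2 by rewrite /= size_map sz.
  move=> i j /eqP; rewrite nth_uniq ?sS// => /eqP; exact: val_inj.
- apply: inj_card_bij; last first.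
    have -> : #|edge G| = #|mem [seq h.1 | h <- hs]|.
      by apply: eq_card => x; rewrite [RHS]all_edges.
    by rewrite card_ord (card_uniqP Ue) size_map sz.
  move=> i j; rewrite /e -!(nth_map h1 h1.1 fst) ?sz// => /eqP.
  by rewrite nth_uniq ?size_map ?sz// => /eqP; exact: val_inj.
- move=> i; have iL : (i < size hs)%N by rewrite sz.
  have E1 : half_end (nth h1 hs i) = v (widen_ord (leqnSn n.+1) i) by rewrite H.
  have E2 : half_end (opp (nth h1 hs i)) = v (lift ord0 i).
    by rewrite /v /= (nth_map h1).
  rewrite /joins -E1 -E2 /e /half_end /opp/=.
  by case: (nth h1 hs i).2; rewrite !eqxx ?orbT.
- by left; rewrite VDE.
Qed.

End path.

Lemma detours_or_interval : interval_one_dirichlet VD \/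
  exists h1 h2, [/\ h1 != h2, detour VD h1 h2 & detour VD h2 h1].
Proof.
have /set0Pn[v1 D1] := VD0.
have [/existsP[v2 /andP[D2 v12]]|] := boolP [exists v2, (v2 \in VD) && (v2 != v1)].
  by right; apply: (detours_of_pair D2 D1 v12).
rewrite negb_exists => /forallP one.
have [/existsP[b b3]|] := boolP [exists b : vertex G, (2 < deg b)%N].
  by right; exact: (detours_of_branching b3).
rewrite negb_exists => /forallP deg2; left; apply: (@interval_of_deg2 v1).
  apply/setP => v; rewrite inE; apply/idP/eqP => [vD|->//].
  by have := one v; rewrite vD/= negbK => /eqP.
by move=> v; rewrite leqNgt.
Qed.

End combinatorics.

(** * The first eigenfunction of an interval *)

Section eigenfunction.
Variables (R : realType) (p q lam : R).
Hypotheses (p1 : 1 < p) (q1 : 1 < q) (pq : p + q = p * q) (lam0 : 0 < lam).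
Local Notation L := (riccati_len p lam).

(* With [A] the Riccati solution vanishing at the free end, the eigenfunction
   is [V = (lam + (p - 1) A^q)^(-1/p)], and [H = A V^p]. *)
Lemma exists_eigenfunction : exists V g H : R -> R,
  [/\ [/\ {within `[0, L], continuous V}, {within `[0, L], continuous g} &
          {within `[0, L], continuous H}],
      forall r, 0 < r < L -> is_derive r (1 : R) V (g r),
      forall r, 0 < r < L ->
        is_derive r (1 : R) H (lam * `|V r| `^ p - `|g r| `^ p) &
      [/\ V L = 0, forall r, 0 <= r < L -> V r != 0, H 0 = 0 & H L = 0]].
Proof.
have p0 : 0 < p by exact: lt_trans p1.
have q0 : 0 < q by exact: lt_trans q1.
have p10 : 0 < p - 1 by rewrite subr_gt0.
have L0 : 0 < L by rewrite powR_gt0// divr_gt0// eigen_const_gt0.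
have [A [dA A_ge A_small A_big]] := exists_riccati p1 q1 pq lam0.
have A0 (r : R) : 0 <= r < L -> 0 <= A r.
  move=> rL; apply: le_trans (A_ge _ rL); rewrite mulr_ge0 ?(ltW lam0)//.
  by case/andP: rL.
have A00 : A 0 = 0.
  apply/eqP; rewrite eq_le A0 ?lexx ?L0// andbT; apply/ler_addgt0Pr => e e0.
  by have [d d0 H] := A_small e e0; rewrite add0r ltW// H ?lexx.
pose D r := lam + (p - 1) * A r `^ q.
have D_ge r : lam <= D r by rewrite lerDl mulr_ge0 ?powR_ge0// ltW.
have D0 r : 0 < D r by exact: lt_le_trans (D_ge r).
(* T = V^p, extended by 0 at [L], where [A] blows up. *)
pose T r := if r < L then (D r)^-1 else 0.
have T0 r : 0 <= T r by rewrite /T; case: ifP => // _; rewrite invr_ge0 ltW.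
have lT r : 0 <= (1 - lam * T r) / (p - 1).
  rewrite divr_ge0 ?(ltW p10)// subr_ge0 /T; case: ifP => _; last by rewrite mulr0.
  by rewrite ler_pdivrMr// mul1r.
(* This is A^q T = |V'|^p before [L], written through [T] alone so that it is continuous up to
   [L]. *)
pose y r := (1 - lam * T r) / (p - 1).
have yE r : r < L -> y r = A r `^ q * T r.
  move=> rL; rewrite /y /T rL /D; field.
  by rewrite !gt_eqF// -/(D r).
have dT (r : R) : 0 < r < L -> is_derive r (1 : R) T (- (p * A r `^ (q - 1) * T r)).
  move=> rL; have Ar : 0 < A r.
    have /andP[r0 rL'] := rL.
    by apply: lt_le_trans (A_ge r _); rewrite ?mulr_gt0// (ltW r0).
  have d1 := is_derive_powR_comp q Ar (dA r rL).
  have d2 : is_derive r (1 : R) D ((p - 1) * (q * A r `^ (q - 1) * D r)).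
    have := is_deriveD (is_derive_const lam r) (is_deriveZ (p - 1) d1).
    by rewrite add0r.
  have d3 := is_deriveV (lt0r_neq0 (D0 r)) d2.
  apply: (@is_derive_ext _ (fun r => (D r)^-1)).
    near=> z; rewrite /T ifT//; near: z; apply: lt_nbhsl; by case/andP: rL.
  apply: is_derive_eq d3 _; rewrite /T; have /andP[_ ->] := rL.
  rewrite /GRing.scale/= -[in RHS](conj_subr1l pq) expr2 invfM.
  by field; rewrite gt_eqF.
have cT : {within `[0, L], continuous T}.
  apply/subspace_continuousP => r; rewrite /= in_itv/= => /andP[].
  have FF (z : R) : Filter (within `[0, L] (nbhs z)) by exact: within_filter.
  rewrite le_eqVlt => /predU1P[<- _|r0].
    apply/(@cvgrPdist_le _ _ _ _ (FF _)) => e e0.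
    have c : {for (0 : R), continuous (fun a : R => (lam + (p - 1) * npow q a)^-1)}.
      apply: cvgV.
        apply: lt0r_neq0; apply: lt_le_trans lam0 _.
        by rewrite lerDl mulr_ge0 ?powR_ge0// ltW.
      apply: cvgD; first exact: cvg_cst.
      by apply: cvgM; [exact: cvg_cst|exact: continuous_npow].
    have /(_ _ _ e0) := (cvgrPdist_le _ _).1 c.
    move=> [d /= d0 Hd]; have [d' d'0 H'] := A_small d d0.
    rewrite near_withinE; near=> z => zL.
    move: zL; rewrite /= in_itv/= => /andP[z0 zL].
    have zd : z < d' by near: z; exact: lt_nbhsl.
    have zL' : z < L by near: z; exact: lt_nbhsl.
    have Az : 0 <= A z by rewrite A0 ?z0.
    change (`|T 0 - T z| <= e); rewrite /T L0 zL' /D A00.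
    have := Hd (A z); rewrite /npow normr0 (ger0_norm Az); apply.
    by rewrite /ball/= sub0r normrN (ger0_norm Az) H' ?z0.
  rewrite le_eqVlt => /predU1P[->|rL]; last first.
    apply: cvg_trans (is_derive1_continuous (dT r _)); last by rewrite r0.
    exact: cvg_within_filter.
  apply/(@cvgrPdist_le _ _ _ _ (FF _)) => e e0.
  pose B := ((e^-1) / (p - 1)) `^ q^-1.
  have [d d0 Hd] := A_big B.
  rewrite near_withinE; near=> z => zL; move: zL; rewrite /= in_itv/= => /andP[z0 zL].
  change (`|T L - T z| <= e); rewrite {1}/T ltxx sub0r normrN ger0_norm// /T; case: ifP => [zL'|_]; last exact: ltW.
  have zd : L - d < z by near: z; apply: lt_nbhsr; rewrite ltrBlDr ltrDl.
  have AB : B < A z by apply: Hd => //; rewrite zd.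
  rewrite -[leRHS]invrK lef_pV2 ?posrE ?invr_gt0//.
  apply: le_trans (_ : (p - 1) * A z `^ q <= _); last by rewrite lerDr ltW.
  rewrite -ler_pdivrMl// mulrC.
  have -> : e^-1 / (p - 1) = B `^ q.
    by rewrite -powRrM mulVf ?gt_eqF// powRr1// divr_ge0 ?invr_ge0 ?(ltW e0) ?(ltW p10).
  by rewrite ler_powRl ?powR_ge0 ?(ltW q0) ?(ltW AB).
pose V r := npow p^-1 (T r); pose w r := npow p^-1 (y r).
(* Before [L] this is A T; in this form it is continuous up to [L]. *)
pose H r := npow q^-1 (y r) * npow p^-1 (T r).
have cy : {within `[0, L], continuous y}.
  have c : continuous (fun t : R => (1 - lam * t) / (p - 1)).
    move=> t; apply: cvgM; last exact: cvg_cst.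
    apply: cvgB; first exact: cvg_cst.
    by apply: cvgM; [exact: cvg_cst|exact: cvg_id].
  exact: within_continuous_comp c cT.
have ip0 : 0 < p^-1 by rewrite invr_gt0.
have iq0 : 0 < q^-1 by rewrite invr_gt0.
have cV := within_continuous_comp (continuous_npow ip0) cT.
have cw := within_continuous_comp (continuous_npow ip0) cy.
have TL : T L = 0 by rewrite /T ltxx.
have y0 : y 0 = 0 by rewrite yE// A00 powR0 ?gt_eqF// mul0r.
have npow0 (a : R) : 0 < a -> npow a 0 = 0 :> R.
  by move=> a0; rewrite /npow normr0 powR0// gt_eqF.
exists V, (fun r => - w r), H; split.
- split=> //.
    have cN : continuous (fun t : R => - t) by move=> t; apply: cvgN; exact: cvg_id.
    exact: within_continuous_comp cN cw.
  exact: within_continuousM (within_continuous_comp (continuous_npow iq0) cy) cV.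
- move=> r rL; have /andP[r0 rL'] := rL.
  have Tr : 0 < T r by rewrite /T rL' invr_gt0.
  have Ar : 0 <= A r by rewrite A0 ?(ltW r0).
  have d := is_derive_powR_comp p^-1 Tr (dT r rL).
  apply: (@is_derive_ext _ (fun r => T r `^ p^-1)).
    by near=> z; rewrite /V /npow ger0_norm.
  apply: is_derive_eq d _; rewrite /w yE// /npow ger0_norm ?mulr_ge0 ?powR_ge0//.
  rewrite powRM ?powR_ge0// -powRrM -(mulr_powRB1 (T0 r) ip0).
  have -> : q / p = q - 1.
    apply: (mulIf (lt0r_neq0 p0)); rewrite divfK ?gt_eqF// mulrBl mul1r [q * p]mulrC -pq; ring.
  by field; rewrite gt_eqF.
- move=> r rL; have /andP[r0 rL'] := rL.
  have HE : \near r, A r * T r = H r.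
    near=> z.
    have zL : z < L by near: z; exact: lt_nbhsl.
    have z0 : 0 < z by near: z; exact: lt_nbhsr.
    have Az : 0 <= A z by rewrite A0 ?(ltW z0).
    have Tz : 0 < T z by rewrite /T zL invr_gt0.
    rewrite /H /npow !ger0_norm ?lT// yE// powRM ?powR_ge0// -powRrM mulfV ?gt_eqF//.
    rewrite powRr1// -mulrA -powRD ?(gt_eqF Tz) ?implybT// addrC (conj_inv p1 q1 pq).
    by rewrite powRr1// ltW.
  apply: (is_derive_ext HE).
  have d := is_deriveM (dA r rL) (dT r rL).
  apply: is_derive_eq d _.
  have -> : `|V r| `^ p = T r.
    by rewrite /V /npow (ger0_norm (T0 r)) ger0_norm ?powR_ge0// -powRrM mulVf ?gt_eqF// powRr1.
  have -> : `|- w r| `^ p = y r.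
    rewrite normrN /w /npow (ger0_norm (lT r)) ger0_norm ?powR_ge0// -powRrM mulVf ?gt_eqF//.
    by rewrite powRr1.
  have Ar : 0 <= A r by rewrite A0 ?(ltW r0).
  have DT : D r * T r = 1 by rewrite /T rL' mulfV// gt_eqF.
  have E1 : (p - 1) * y r = 1 - lam * T r by rewrite /y mulrC divfK// gt_eqF.
  have E2 : A r * A r `^ (q - 1) * T r = y r by rewrite yE// (mulr_powRB1 Ar q0).
  (* H' = A' T + A T' = 1 - p y, and 1 = lam T + (p - 1) y. *)
  change (A r * (- (p * A r `^ (q - 1) * T r)) + T r * D r = lam * T r - y r).
  have E3 : A r * (- (p * A r `^ (q - 1) * T r)) = - (p * y r) by rewrite -E2; ring.
  by rewrite E3 [T r * _]mulrC DT; move: E1; move: (y r) (lam * T r) => u v; lra.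
split.
- by rewrite /V TL npow0.
- by move=> r /andP[_ rL]; rewrite /V /npow gt_eqF// powR_gt0// normr_gt0 /T rL invr_neq0// gt_eqF.
- by rewrite /H y0 npow0// mul0r.
- by rewrite /H TL npow0// mulr0.
Unshelve. all: by end_near. Qed.

End eigenfunction.

(** * Transplanting the eigenfunction to a path *)

Section path_upper_bound.
Variables (R : realType) (G : metric_graph R) (VD : {set vertex G}).
Variables (p q : R).
Hypotheses (p1 : 1 < p) (q1 : 1 < q) (pq : p + q = p * q).
Implicit Types (e : edge G) (v : vertex G) (c : edge G -> R).
Local Notation mu := (@lebesgue_measure R).

(* [rho] is the distance to the free end of a path, and [s e] tells whether the
   edge [e] is oriented towards that end. *)
Definition path_coordinate (L : R) (rho : vertex G -> R) (s : edge G -> R) : Prop :=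
  [/\ forall e, s e = 1 \/ s e = -1,
      forall e, rho (src e) - rho (tgt e) = s e * len e,
      forall v, v \in VD -> rho v = L,
      forall F : R -> R,
        \sum_e s e * (F (rho (src e)) - F (rho (tgt e))) = F L - F 0 &
      forall c, flow_balance VD c -> forall e, c e = s e * rho (src e)].

Lemma path_coordinate_ord0 n (v : 'I_n.+2 -> vertex G) (e : 'I_n.+1 -> edge G) :
  bijective v -> bijective e ->
  (forall i : 'I_n.+1, joins (e i) (v (widen_ord (leqnSn n.+1) i)) (v (lift ord0 i))) ->
  VD = [set v ord0]%SET ->
  exists L rho s, [/\ 0 < L, forall w, 0 <= rho w <= L & path_coordinate L rho s].
Proof.
move=> [vi vK viK] [ei eK eiK] J VDE.
pose r (i : nat) : R := \sum_(j < n.+1 | (i <= j)%N) len (e j).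
have rS (i : 'I_n.+1) : r i = len (e i) + r i.+1.
  rewrite /r (bigD1 i)//=; congr (_ + _); apply: eq_bigl => j.
  by rewrite ltn_neqAle andbC eq_sym.
have rN : r n.+1 = 0.
  by rewrite /r big_pred0// => j; rewrite leqNgt ltn_ord.
have r_ge0 i : 0 <= r i by apply: sumr_ge0 => j _; rewrite ltW ?len_gt0.
have r_le i : r i <= r 0%N.
  rewrite /r [leRHS](bigID (fun j : 'I_n.+1 => (i <= j)%N))/= lerDl.
  by apply: sumr_ge0 => j _; rewrite ltW ?len_gt0.
pose s e0 : R := if src e0 == v (widen_ord (leqnSn n.+1) (ei e0)) then 1 else -1.
pose rho w := r (vi w).
have vneq (i : 'I_n.+1) : v (lift ord0 i) == v (widen_ord (leqnSn n.+1) i) = false.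
  rewrite (inj_eq (can_inj vK)); apply/negbTE/eqP => /(congr1 val) /=.
  by rewrite /bump/= add1n => /eqP; rewrite gtn_eqF.
have ends (i : 'I_n.+1) :
    [/\ s (e i) = 1, src (e i) = v (widen_ord (leqnSn n.+1) i) & tgt (e i) = v (lift ord0 i)] \/
    [/\ s (e i) = -1, src (e i) = v (lift ord0 i) & tgt (e i) = v (widen_ord (leqnSn n.+1) i)].
  rewrite /s eK; case/orP: (J i) => /andP[/eqP -> /eqP ->]; first by left; rewrite eqxx.
  by right; rewrite vneq.
have rho_lo (i : 'I_n.+1) : rho (v (widen_ord (leqnSn n.+1) i)) = r i by rewrite /rho vK.
have rho_hi (i : 'I_n.+1) : rho (v (lift ord0 i)) = r i.+1 by rewrite /rho vK.
exists (r 0%N), rho, s; split.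
- by rewrite (rS ord0) ltr_pwDl ?len_gt0.
- by move=> w; rewrite r_ge0 r_le.
split.
- by move=> e0; rewrite /s; case: ifP => _; [left|right].
- move=> e0; rewrite -(eiK e0); case: (ends (ei e0)) => -[-> -> ->]; rewrite rho_lo rho_hi rS; ring.
- by move=> w; rewrite VDE inE => /eqP ->; rewrite /rho vK.
- move=> F; rewrite (reindex e) /=; last by exists ei => ? _.
  transitivity (\sum_(i < n.+1) (F (r i) - F (r i.+1))).
    by apply: eq_bigr => i _; case: (ends i) => -[-> -> ->]; rewrite rho_lo rho_hi; ring.
  rewrite -(big_mkord predT (fun i => F (r i) - F (r i.+1))) -opprB -[in F 0]rN.
  by rewrite -(@telescope_sumr _ 0 n.+1 (fun i => F (r i)))// -sumrN; apply: eq_bigr => i _; rewrite opprB.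
move=> c hc e0; rewrite -(eiK e0); move: (ei e0) => i {e0}.
(* Indicator of the vertices beyond the i-th edge; the balance tested with it expresses the flux on
   that edge through the length beyond it. *)
pose f w : R := (i < vi w)%N%:R.
have fD w : w \in VD -> f w = 0 by rewrite VDE inE => /eqP ->; rewrite /f vK.
have := hc f fD; rewrite (reindex e) /=; last by exists ei => ? _.
have f_lo (j : 'I_n.+1) : f (v (widen_ord (leqnSn n.+1) j)) = (i < j)%N%:R by rewrite /f vK.
have f_hi (j : 'I_n.+1) : f (v (lift ord0 j)) = (i <= j)%N%:R by rewrite /f vK.
rewrite (bigD1 i)//= (eq_bigr (fun j : 'I_n.+1 => if (i < j)%N then len (e j) else 0)); last first.
  move=> j ji; have lt : (i < j)%N = (i <= j)%N by rewrite ltn_neqAle eq_sym ji.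
  case: (ends j) => -[_ -> ->]; rewrite f_lo f_hi lt.
    by case: (i <= j)%N => /=; rewrite ?mulr1 ?mulr0; ring.
  by case: (i <= j)%N => /=; rewrite ?mulr1 ?mulr0; ring.
rewrite -big_mkcondr/= (eq_bigl (fun j : 'I_n.+1 => (i < j)%N)); last first.
  by move=> j /=; rewrite andbC; case: ltngtP => //= ij; rewrite -(inj_eq val_inj)/= gtn_eqF.
rewrite -/(r i.+1); case: (ends i) => -[-> -> ->]; rewrite f_lo f_hi ltnn leqnn ?rho_lo ?rho_hi ?rS.
  by move: (c _) (len _) (r _) => a b d /=; lra.
by move: (c _) (len _) (r _) => a b d /=; lra.
Qed.

Lemma path_coordinate_interval : interval_one_dirichlet VD ->
  exists L rho s, [/\ 0 < L, forall w, 0 <= rho w <= L & path_coordinate L rho s].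
Proof.
move=> [n [v [e [bv be J [D|D]]]]]; first exact: path_coordinate_ord0 bv be J D.
apply: (@path_coordinate_ord0 n (v \o @rev_ord _) (e \o @rev_ord _)).
- by apply: bij_comp => //; exists (@rev_ord _); exact: rev_ordK.
- by apply: bij_comp => //; exists (@rev_ord _); exact: rev_ordK.
- move=> i /=; have := J (rev_ord i); rewrite /joins orbC.
  have -> : widen_ord (leqnSn n.+1) (rev_ord i) = rev_ord (lift ord0 i).
    by apply: val_inj; rewrite /= /bump/= add1n subSS.
  have -> // : lift ord0 (rev_ord i) = rev_ord (widen_ord (leqnSn n.+1) i).
  by apply: val_inj; rewrite /= /bump/= add1n subnSK.
- by rewrite D/=; congr [set v _]%SET; apply: val_inj; rewrite /= subn1.
Qed.


Lemma within_continuous_affine (f : R -> R) (L l a b : R) :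
  {within `[0, L], continuous f} -> (forall x, 0 <= x <= l -> 0 <= a * (b - x) <= L) ->
  {within `[0, l], continuous (fun x => f (a * (b - x)))}.
Proof.
move=> cf H; apply/subspace_continuousP => x /=; rewrite in_itv/= => xl.
have hc : {for x, continuous (fun x : R => a * (b - x))}.
  by apply: cvgM; [exact: cvg_cst|apply: cvgB; [exact: cvg_cst|exact: cvg_id]].
have /subspace_continuousP/(_ (a * (b - x))) := cf; rewrite /= in_itv/= => /(_ (H x xl)) cfx.
apply: cvg_trans cfx => /= U; rewrite !nbhs_simpl /fmap/= /within/= => HU.
have := hc _ HU; rewrite !nbhs_simpl/=; apply: filterS => z Hz zl; apply: Hz.
by rewrite in_itv/= H//; rewrite in_itv/= in zl.
Qed.

Lemma is_derive_affine (f : R -> R) (a b x df : R) : is_derive (a * (b - x)) (1 : R) f df ->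
  is_derive x (1 : R) (fun x => f (a * (b - x))) (- a * df).
Proof.
move=> d; have da : is_derive x (1 : R) (fun x : R => a * (b - x)) (- a).
  have := is_deriveZ a (is_deriveB (is_derive_const b x) (is_derive_id x 1)).
  by rewrite sub0r /GRing.scale/= mulrN1.
by have := @is_derive1_comp R f (fun x : R => a * (b - x)) x _ _ d da; rewrite mulrC.
Qed.

Section upper.
Variables (L : R) (rho : vertex G -> R) (s : edge G -> R) (c : edge G -> R).
Hypotheses (L0 : 0 < L) (rhoL : forall w, 0 <= rho w <= L)
  (path : path_coordinate L rho s) (hc : flow_balance VD c).

Let s2 e : s e * s e = 1.
Proof. by have [+ _ _ _ _] := path => /(_ e)[->|->]; ring. Qed.

Let cE e : c e = s e * rho (src e).
Proof. by have [_ _ _ _ ->] := path. Qed.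

Let tgtE e : s e * (c e - len e) = rho (tgt e).
Proof.
have [_ /(_ e) H _ _ _] := path; rewrite cE mulrBr mulrA s2 -H; ring.
Qed.

Let srcE e : s e * (c e - 0) = rho (src e).
Proof. by rewrite subr0 cE mulrA s2 mul1r. Qed.

(** In the path coordinate the dual energy telescopes to the integral of x^q over [0, L]. *)
Lemma path_dual_energy : (q + 1) * dual_energy q c = L `^ (q + 1).
Proof.
have q10 : q + 1 != 0 by rewrite gt_eqF// addr_gt0// (lt_trans _ q1).
have odd e z : npow_int q (s e * z) = s e * npow_int q z.
  by have [+ _ _ _ _] := path => /(_ e)[->|->]; rewrite ?mul1r// !mulN1r npow_intN.
have [_ _ _ tele _] := path.
have -> : dual_energy q c = npow_int q L - npow_int q 0.
  rewrite -tele; apply: eq_bigr => e _; rewrite mulrBr -!odd -cE -tgtE.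
  by rewrite [s e * (_ * _)]mulrA s2 mul1r.
rewrite /npow_int mul0r mul0r subr0 gtr0_norm// mulrC divfK//.
by rewrite powRD ?(gt_eqF L0) ?implybT// powRr1 ?(ltW L0)// mulrC.
Qed.

(** For this value [lam] the length [riccati_len p lam] is exactly [L], so the eigenfunction
    composed with the path coordinate is admissible. Integrating H' edge by edge telescopes to H L -
    H 0 = 0, hence its Rayleigh quotient is [lam]. *)
Lemma lambda1_le_kj : (exists e : edge G, True) ->
  lambda1 p VD <= kj_value p q (dual_energy q c).
Proof.
move=> [e0 _]; set lam := kj_value _ _ _.
have p0 : 0 < p by exact: lt_trans p1.
have q10 : 0 < q + 1 by rewrite addr_gt0// (lt_trans _ q1).
have C0 := eigen_const_gt0 p1.
have lamE : lam = eigen_const p * L `^ (- p).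
  rewrite /lam /kj_value path_dual_energy -powRrM; congr (_ * _ `^ _).
  by rewrite mulrN mulrCA mulfV ?gt_eqF// mulr1.
have lam0 : 0 < lam by rewrite lamE mulr_gt0// powR_gt0.
have LE : riccati_len p lam = L.
  rewrite /riccati_len lamE powRN invfM invrK mulrA mulfV ?gt_eqF// mul1r.
  by rewrite -powRrM mulfV ?gt_eqF// powRr1// ltW.
have [V [g [H]]] := exists_eigenfunction p1 q1 pq lam0; rewrite LE.
move=> [[cV cg cH] dV dH [VL Vn0 H0 HL]].
have [s1 rhoE rhoD tele _] := path.
have conv e x : s e * (c e - x) = rho (src e) + (rho (tgt e) - rho (src e)) * (x / len e).
  have lne : len e != 0 by rewrite gt_eqF ?len_gt0.
  rewrite -[rho (tgt e) - _]opprB rhoE cE mulrBr mulrA s2 mul1r; field; exact: lne.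
have unit_in e x : 0 <= x <= len e -> 0 <= x / len e <= 1.
  move=> /andP[x0 xl]; rewrite divr_ge0 ?(ltW (len_gt0 _))//=.
  by rewrite ler_pdivrMr ?len_gt0// mul1r.
have inL e x : 0 <= x <= len e -> 0 <= s e * (c e - x) <= L.
  move=> /unit_in /andP[t0 t1]; rewrite conv; move: t0 t1.
  move: (x / len e) (rhoL (src e)) (rhoL (tgt e)) => t /andP[a0 aL] /andP[b0 bL] t0 t1.
  by apply/andP; split; nra.
have inLo e x : 0 < x < len e -> 0 < s e * (c e - x) < L.
  move=> /andP[x0 xl].
  have t0 : 0 < x / len e by rewrite divr_gt0 ?len_gt0.
  have t1 : x / len e < 1 by rewrite ltr_pdivrMr ?len_gt0// mul1r.
  have ne : rho (src e) != rho (tgt e).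
    rewrite -subr_eq0 rhoE; apply: mulf_neq0; last by rewrite gt_eqF ?len_gt0.
    by apply/eqP => se; have := s2 e; rewrite se mul0r => /eqP; rewrite eq_sym oner_eq0.
  rewrite conv; move: t0 t1 ne.
  move: (x / len e) (rhoL (src e)) (rhoL (tgt e)) => t /andP[a0 aL] /andP[b0 bL] t0 t1.
  by rewrite neq_lt => /orP[ab|ba]; apply/andP; split; nra.
pose u e x := V (s e * (c e - x)); pose du e x := - s e * g (s e * (c e - x)).
have cu e : {within `[0, len e], continuous (u e)}.
  exact: (within_continuous_affine cV (inL e)).
have cdu e : {within `[0, len e], continuous (du e)}.
  apply: within_continuousM; last exact: (within_continuous_affine cg (inL e)).
  exact: within_continuous_cst.
have W : W1p_D p VD u du.
  split=> [e|].
    apply: W1p_of_derive => //; rewrite ?len_gt0// => x xl.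
    by apply: is_derive_affine; apply: dV; exact: inLo.
  exists (fun v => V (rho v)); split=> [e|e|v vD].
  - by rewrite /u srcE.
  - by rewrite /u tgtE.
  - by rewrite rhoD.
have nz : nonzero_fun u.
  exists e0, (len e0 / 2); have l0 := len_gt0 e0.
  have h : 0 < len e0 / 2 < len e0.
    by rewrite divr_gt0//= ltr_pdivrMr// ltr_pMr// ltr1n.
  split; first by have /andP[h1 h2] := h; rewrite in_itv/= (ltW h1) ltW.
  by have /andP[h1 h2] := inLo _ _ h; rewrite /u Vn0// (ltW h1).
have := lambda1_le p1 W nz; set E := graph_integral (fun e x => `|du e x| `^ p).
set N := graph_integral (fun e x => `|u e x| `^ p).
suff -> : E = lam * N by rewrite ler_pM2r// (mass_gt0 p1 W nz).
apply/eqP; rewrite eq_sym -subr_eq0 /E /N /graph_integral mulr_sumr -sumrB; apply/eqP.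
transitivity (\sum_e s e * (H (rho (src e)) - H (rho (tgt e)))); last by rewrite tele HL H0 subrr.
apply: eq_bigr => e _.
have cn (f : R -> R) : {within `[0, len e], continuous f} ->
    {within `[0, len e], continuous (fun x => `|f x| `^ p)}.
  by move=> cf; exact: (within_continuous_comp (continuous_npow p0) cf).
have I := within_continuous_integrable.
have cun := cn _ (cu e); have cdn := cn _ (cdu e).
have c1 := within_continuousM (@within_continuous_cst R _ lam) cun.
rewrite -RintegralZl//; last exact: I.
rewrite -RintegralB//; [|exact: I|exact: I].
have cm : {within `[0, len e], continuous (fun x => lam * `|u e x| `^ p - `|du e x| `^ p)}.
  apply: (within_continuousD c1).
  by apply: (within_continuous_comp _ cdn) => t; apply: cvgN; exact: cvg_id.
have cK : {within `[0, len e], continuous (fun x => - s e * H (s e * (c e - x)))}.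
  apply: within_continuousM; last exact: (within_continuous_affine cH (inL e)).
  exact: within_continuous_cst.
have dK x : 0 < x < len e -> is_derive x (1 : R) (fun x => - s e * H (s e * (c e - x)))
    (lam * `|u e x| `^ p - `|du e x| `^ p).
  move=> xl; have d := is_deriveZ (- s e) (is_derive_affine (dH _ (inLo _ _ xl))).
  apply: is_derive_eq d _; rewrite /GRing.scale/= mulrA mulrNN s2 mul1r.
  congr (_ - _); rewrite /du normrM normrN; congr (_ `^ _).
  by have [->|->] := s1 e; rewrite ?normrN1 ?normr1 !mul1r.
rewrite (Rintegral_derive (ltW (len_gt0 e)) cm cK dK) srcE tgtE; ring.
Qed.

End upper.
End path_upper_bound.

(** * The Kohler-Jobin inequality *)

Section main.
Variables (R : realType) (p q : R).
Hypotheses (p1 : 1 < p) (q1 : 1 < q) (pq : p + q = p * q).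

Let p0 : 0 < p. Proof. exact: lt_trans p1. Qed.
Let q0 : 0 < q. Proof. exact: lt_trans q1. Qed.
Let q10 : 0 < q + 1. Proof. exact: addr_gt0. Qed.

Lemma npow_int_lt : {homo npow_int q : x y / x < y}.
Proof.
move=> x y xy; apply: (@derive_gt0_lt _ _ [:: 0] _ _ xy).
  by apply: continuous_within => z _; exact: is_derive1_continuous (is_derive_npow_int z q0).
move=> z _; rewrite inE => z0; exists (npow q z); first exact: is_derive_npow_int.
by rewrite /npow powR_gt0// normr_gt0.
Qed.

Section graph.
Variables (G : metric_graph R) (VD : {set vertex G}).
Hypotheses (hconn : connected_graph G) (VD0 : VD != finset.set0)
  (He : exists e : edge G, True).
Implicit Types (c : edge G -> R) (h : edge G * bool).

Lemma third_dual_gt0 c h : 0 < third_dual q c h.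
Proof.
have l0 := len_gt0 h.1; rewrite /third_dual; case: ifP => _; rewrite subr_gt0 npow_int_lt//.
  by rewrite ltrD2l ltrN2 gtr_pMr//; lra.
by rewrite ltrBlDr ltrDl divr_gt0.
Qed.

Lemma third_dual_le c h : third_dual q c h <= dual_energy q c.
Proof.
have mono x y : x <= y -> npow_int q x <= npow_int q y.
  by rewrite le_eqVlt => /predU1P[->//|/npow_int_lt/ltW].
apply: le_trans (_ : npow_int q (c h.1) - npow_int q (c h.1 - len h.1) <= _).
  have l0 := len_gt0 h.1; rewrite /third_dual; case: ifP => _.
    by rewrite lerD2r mono// gerBl mulr_ge0 ?(ltW l0)//; lra.
  by rewrite lerD2l lerN2 mono// lerD2l lerN2 ler_piMr ?(ltW l0)//; lra.
rewrite /dual_energy (bigD1 h.1)//= lerDl sumr_ge0// => e _.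
by rewrite subr_ge0 mono// gerBl ltW ?len_gt0.
Qed.

Lemma dual_energy_gt0 c : 0 < dual_energy q c.
Proof.
by have [e _] := He; apply: lt_le_trans (third_dual_le c (e, true)); exact: third_dual_gt0.
Qed.

(** Once existence is known, [torsion] selects some torsion function; whichever it is, its integral
    is the dual energy of a balanced flux. *)
Lemma rigidity_dual : exists2 c, flow_balance VD c &
  rigidity p VD = dual_energy q c `^ (p - 1).
Proof.
have ex := exists_torsion p1 q1 pq hconn VD0.
have : is_torsion p VD (torsion p VD) by apply: (xgetPex (fun _ _ => 0) ex).
by move=> /(torsion_flow q1 pq)[c [hc E]]; exists c; rewrite // /rigidity E.
Qed.

Definition kj_const : R :=
  (p - 1) * (pi_p p / 2) `^ p * (1 / (q + 1)) `^ (p * (p - 1) / (2 * p - 1)).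

(** The torsion cancels because (q + 1) (p - 1) = 2 p - 1, that is, p / (q + 1) = p (p - 1) / (2 p -
    1). *)
Lemma kj_valueE (W : R) : 0 < W ->
  kj_value p q W * (W `^ (p - 1)) `^ (p / (2 * p - 1)) = kj_const.
Proof.
move=> W0; set th := p * (p - 1) / (2 * p - 1).
have t0 : 2 * p - 1 != 0 by rewrite gt_eqF//; move: p1; lra.
have qE : (q + 1) * (p - 1) = 2 * p - 1.
  by rewrite mulrDl mul1r mulrBr mulr1 [q * p]mulrC -pq; ring.
have thE : p / (q + 1) = th.
  rewrite /th -qE; have p10 : p - 1 != 0 by rewrite subr_eq0 gt_eqF.
  by field; rewrite p10 gt_eqF.
have -> : (W `^ (p - 1)) `^ (p / (2 * p - 1)) = W `^ th.
  by rewrite -powRrM; congr (_ `^ _); rewrite /th mulrA [(p - 1) * p]mulrC.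
have E : (1 / (q + 1)) `^ th * (q + 1) `^ th = 1.
  by rewrite -powRM ?divr_ge0 ?(ltW q10)// mul1r mulVf ?gt_eqF// powR1.
rewrite /kj_value thE powRN powRM ?(ltW q10) ?(ltW W0)// /kj_const -/th /eigen_const -!mulrA.
congr (_ * (_ * _)); rewrite invfM -mulrA mulVf ?mulr1 ?gt_eqF ?powR_gt0//.
have X0 : (q + 1) `^ th != 0 by rewrite gt_eqF// powR_gt0.
by apply: (mulIf X0); rewrite E mulVf.
Qed.

Lemma kj_lower : kj_const <= lambda1 p VD * rigidity p VD `^ (p / (2 * p - 1)).
Proof.
have [c hc ->] := rigidity_dual; have W0 := dual_energy_gt0 c.
rewrite -(kj_valueE W0) ler_wpM2r ?powR_ge0//.
exact: (lambda1_ge_kj p1 q1 pq hconn VD0 He hc).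
Qed.

Lemma kj_interval : interval_one_dirichlet VD ->
  lambda1 p VD * rigidity p VD `^ (p / (2 * p - 1)) = kj_const.
Proof.
move=> HI; apply/eqP; rewrite eq_le kj_lower andbT.
have [c hc ->] := rigidity_dual; have W0 := dual_energy_gt0 c.
rewrite -(kj_valueE W0) ler_wpM2r ?powR_ge0//.
have [L [rho [s [L0 rhoL path]]]] := path_coordinate_interval HI.
exact: (lambda1_le_kj p1 q1 pq L0 rhoL path hc He).
Qed.

Lemma kj_rigid : (forall v, v \in VD -> deg v = 1%N) ->
  lambda1 p VD * rigidity p VD `^ (p / (2 * p - 1)) = kj_const ->
  interval_one_dirichlet VD.
Proof.
move=> VD1; have [c hc ->] := rigidity_dual; have W0 := dual_energy_gt0 c.
rewrite -(kj_valueE W0) => /mulIf E.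
have [//|[h1 [h2 [h12 d12 d21]]]] := detours_or_interval hconn VD0 VD1.
have := lambda1_gt_kj p1 q1 pq hconn VD0 He hc d12 d21 h12 (third_dual_gt0 c h1)
  (third_dual_gt0 c h2) (third_dual_le c h1).
by rewrite E ?ltxx// gt_eqF// !powR_gt0.
Qed.

End graph.

(** The unit interval is a path with one edge and Dirichlet set its last vertex, so the equality
    case evaluates the constant. *)
Lemma C_KJE : C_KJ p = kj_const.
Proof.
apply: kj_interval.
- move=> x y; have [->|xy] := eqVneq x y; first exact: connect0.
  apply: connect1; apply/existsP; exists tt.
  by rewrite /joins/=; case: x y xy => -[].
- by apply/set0Pn; exists true; rewrite inE.
- by exists tt.
exists 0%N, (fun i : 'I_2 => i == 1%N :> nat), (fun _ : 'I_1 => tt); split.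
- exists (fun b : bool => if b then ord_max else ord0); last by case.
  by move=> [[|[|i]] Hi] //=; apply: val_inj.
- by exists (fun=> ord0) => [i|[]//]; rewrite [RHS]ord1.
- by move=> i; rewrite ord1 /joins.
- by right.
Qed.

End main.

Theorem theorem5p2 (R : realType) (G : metric_graph R) (VD : {set vertex G})
    (p q : R) (hconn : connected_graph G) (hVD0 : VD != finset.set0)
    (hVD1 : forall v, v \in VD -> deg v = 1%N)
    (hp : 1 < p) (hq : q = p / (p - 1)) :
  [/\ C_KJ p =
        (p - 1) * (pi_p p / 2) `^ p *
          (1 / (q + 1)) `^ (p * (p - 1) / (2 * p - 1)),
      C_KJ p <= lambda1 p VD * rigidity p VD `^ (p / (2 * p - 1)) &
      lambda1 p VD * rigidity p VD `^ (p / (2 * p - 1)) = C_KJ p <->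
        interval_one_dirichlet VD].
Proof.
have p10 : 0 < p - 1 by rewrite subr_gt0.
have pq : p + q = p * q by rewrite hq; field; rewrite gt_eqF.
have q1 : 1 < q by rewrite hq ltr_pdivlMr// mul1r gtrBl.
have He : exists e : edge G, True.
  have /set0Pn[v /hVD1] := hVD0; rewrite -card_star => E.
  have /card_gt0P[[e b] _] : (0 < #|star v|)%N by rewrite E.
  by exists e.
rewrite (C_KJE hp q1 pq); split; first by [].
  exact: kj_lower.
by split; [exact: kj_rigid|exact: kj_interval].
Qed.
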